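(* Let $J,J_0\subset F[d_x,d_y]$ be non-holonomic left ideals (i.e. of differential type $1$). Then $J$ and $J_0$ are equivalent if and only if they have the same sets of all fractional-derivatives series solutions.
   Context: $F$ is a differentially closed (universal in the sense of Kolchin) differential field of characteristic $0$ with two commuting derivations $d_x,d_y$; $F[d_x,d_y]$ is the ring of linear partial differential operators over $F$. For a left ideal $J$, the Hilbert–Kolchin polynomial $K_J(z)$ equals, for large integers $z$, $\dim_F$ of the operators of order $\le z$ modulo those lying in $J$; the differential type is $\deg K_J$, and ''non-holonomic'' means of differential type $1$. Non-holonomic ideals $J,J_0$ are called equivalent if the leading coefficients of the (degree $1$) Hilbert–Kolchin polynomials of $J$, $J_0$ and $J\cap J_0$ coincide. Let $k\ge1$, let $1>s_2>\cdots>s_k>0$ be rational and $f_1,\dots,f_k\in F$ with $(d_xf_1,d_yf_1)\ne(0,0)$. The symbol $G=G^{(0)}=G_{s_2,\dots,s_k}(f_1,\dots,f_k)$ comes with $F$-linearly independent formal symbols $\{G^{(s)}\}_{s\in\mathbb Q}$ and the rule $dG^{(s)}=(df_1)G^{(1+s)}+(df_2)G^{(s_2+s)}+\cdots+(df_k)G^{(s_k+s)}$ for $d\in\{d_x,d_y\}$. With $q$ the common denominator of $s_2,\dots,s_k$ ($q=1$ if $k=1$), a fractional-derivatives series is a formal series $H=\sum_{0\le i<\infty}h_iG^{(s_0-i/q)}$ with $h_i\in F$, $s_0q\in\mathbb Z$. Operators act termwise via the Leibniz rule and the rule above. $H$ is a solution of an ideal $J$ if $pH=0$ for all $p\in J$.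 The set of all fractional-derivatives series solutions of $J$ comprises solutions for all possible $G$. *)

(* Defs.v *)
From HB Require Import structures.
From mathcomp Require Import all_boot all_order all_algebra.
From mathcomp Require Import boolp functions.

Set Implicit Arguments.
Unset Strict Implicit.
Unset Printing Implicit Defensive.

Import Order.TTheory GRing.Theory Num.Theory.
Local Open Scope ring_scope.

HB.mixin Record Field_hasTwoDerivations F of GRing.Field F := {
  dx : F -> F;
  dy : F -> F;
  dxD : forall a b, dx (a + b) = dx a + dx b;
  dyD : forall a b, dy (a + b) = dy a + dy b;
  dxM : forall a b, dx (a * b) = dx a * b + a * dx b;
  dyM : forall a b, dy (a * b) = dy a * b + a * dy b;
  dxdyC : forall a, dx (dy a) = dy (dx a)
}.

#[short(type="diffFieldType")]
HB.structure Definition DiffField :=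
  { F of GRing.Field F & Field_hasTwoDerivations F }.

Section DerivationTheory.
Variable F : diffFieldType.

Lemma dxB_subproof : zmod_morphism (@dx F).
Proof.
have H0 : dx (0 : F) = 0 by apply: (addrI (dx 0)); rewrite -dxD !addr0.
move=> a b; rewrite dxD; congr (_ + _); apply/eqP.
by rewrite -addr_eq0 -dxD addNr H0.
Qed.
Lemma dyB_subproof : zmod_morphism (@dy F).
Proof.
have H0 : dy (0 : F) = 0 by apply: (addrI (dy 0)); rewrite -dyD !addr0.
move=> a b; rewrite dyD; congr (_ + _); apply/eqP.
by rewrite -addr_eq0 -dyD addNr H0.
Qed.
HB.instance Definition _ := GRing.isZmodMorphism.Build F F (@dx F) dxB_subproof.
HB.instance Definition _ := GRing.isZmodMorphism.Build F F (@dy F) dyB_subproof.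

Lemma dx1 : dx (1 : F) = 0.
Proof. by apply: (addrI (dx 1)); rewrite addr0 -{3}[1]mulr1 dxM mulr1 mul1r. Qed.
Lemma dy1 : dy (1 : F) = 0.
Proof. by apply: (addrI (dy 1)); rewrite addr0 -{3}[1]mulr1 dyM mulr1 mul1r. Qed.

End DerivationTheory.

Definition diff_morphism (E K : diffFieldType) (h : {rmorphism E -> K}) : Prop :=
  (forall a, h (dx a) = dx (h a)) /\ (forall a, h (dy a) = dy (h a)).

Definition diff_subfield (K : diffFieldType) (P : K -> Prop) : Prop :=
  [/\ P 1,
      forall a b, P a -> P b -> P (a - b),
      forall a b, P a -> P b -> P (a / b),
      forall a, P a -> P (dx a)
    & forall a, P a -> P (dy a)].

Definition diff_generates (K : diffFieldType) (S : K -> Prop) : Prop :=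
  forall P : K -> Prop, diff_subfield P -> (forall a, S a -> P a) ->
  forall a, P a.

Definition diff_finitely_generated (K : diffFieldType) : Prop :=
  exists s : seq K, diff_generates (fun a => a \in s).

Definition diff_finitely_generated_over (E K : diffFieldType) (j : E -> K) :
    Prop :=
  exists s : seq K, diff_generates (fun a => (exists e, a = j e) \/ a \in s).

(* Kolchin's universal differential fields: every finitely generated           *)
(* differential extension of a finitely generated differential subfield of F   *)
(* embeds into F over that subfield. Subfields are given by embeddings         *)
(* i : E -> F, extensions by embeddings j : E -> K.                            *)
Definition kolchin_universal (F : diffFieldType) : Prop :=
  forall (E : diffFieldType) (i : {rmorphism E -> F}),
    diff_morphism i -> diff_finitely_generated E ->
  forall (K : diffFieldType) (j : {rmorphism E -> K}),
    diff_morphism j -> diff_finitely_generated_over j ->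
  exists h : {rmorphism K -> F}, diff_morphism h /\ forall e, h (j e) = i e.

(* An operator \sum_(i, j) a_ij d_x^i d_y^j is stored as the bivariate         *)
(* polynomial with a_ij the coefficient of 'Y^j (inner) in that of 'X^i        *)
(* (outer); its ring structure is the noncommutative one built below, not      *)
(* that of {poly {poly F}}.                                                    *)
Definition diffop (F : diffFieldType) : Type := {poly {poly F}}.
HB.instance Definition _ (F : diffFieldType) :=
  GRing.Zmodule.copy (diffop F) {poly {poly F}}.

Definition opcoef (F : diffFieldType) (p : diffop F) (i j : nat) : F :=
  (p : {poly {poly F}})`_i`_j.

Section OperatorModule.
Variable F : diffFieldType.
Implicit Types (a b : F) (p q : diffop F).

Definition opscale a p : diffop F := a%:P *: (p : {poly {poly F}}).

(* Left multiplication by d_x and d_y, from d a = a d + d(a). *)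
Definition opmulx p : diffop F :=
  map_poly (map_poly (@dx F)) p + (p : {poly {poly F}}) * 'X.
Definition opmuly p : diffop F :=
  map_poly (map_poly (@dy F)) p + 'X *: (p : {poly {poly F}}).

Lemma opP p q : (forall i j, opcoef p i j = opcoef q i j) -> p = q.
Proof. by move=> pq; apply/polyP => i; apply/polyP => j; exact: pq. Qed.

Lemma opcoef0 i j : opcoef (0 : diffop F) i j = 0.
Proof. by rewrite /opcoef !coef0. Qed.
Lemma opcoefD p q i j : opcoef (p + q) i j = opcoef p i j + opcoef q i j.
Proof. by rewrite /opcoef !coefD. Qed.
Lemma opcoef_scale a p i j : opcoef (opscale a p) i j = a * opcoef p i j.
Proof. by rewrite /opcoef /opscale coefZ coefCM. Qed.
Lemma opcoef_mulx p i j : opcoef (opmulx p) i j =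
  dx (opcoef p i j) + (if i is i'.+1 then opcoef p i' j else 0).
Proof.
rewrite /opcoef /opmulx coefD coefMX coefD !coef_map_id0 ?map_poly0 ?raddf0 //=.
by case: i => [|i] //=; rewrite coef0.
Qed.
Lemma opcoef_muly p i j : opcoef (opmuly p) i j =
  dy (opcoef p i j) + (if j is j'.+1 then opcoef p i j' else 0).
Proof.
rewrite /opcoef /opmuly coefD coefZ coefD !coef_map_id0 ?map_poly0 ?raddf0 //=.
by rewrite coefXM; case: j.
Qed.

Lemma opscaleA a b p : opscale a (opscale b p) = opscale (a * b) p.
Proof. by apply: opP => i j; rewrite !opcoef_scale mulrA. Qed.
Lemma opscale1 : left_id 1 opscale.
Proof. by move=> p; apply: opP => i j; rewrite !opcoef_scale mul1r. Qed.
Lemma opscaleDr : right_distributive opscale +%R.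
Proof.
by move=> a p q; apply: opP => i j; rewrite !(opcoef_scale, opcoefD) mulrDr.
Qed.
Lemma opscaleDl p : {morph opscale^~ p : a b / a + b}.
Proof.
by move=> a b; apply: opP => i j; rewrite !(opcoef_scale, opcoefD) mulrDl.
Qed.
HB.instance Definition _ := GRing.Zmodule_isLmodule.Build F (diffop F)
  opscaleA opscale1 opscaleDr opscaleDl.

Lemma opcoefZ a p i j : opcoef (a *: p) i j = a * opcoef p i j.
Proof. exact: opcoef_scale. Qed.

(* The action of \sum_(i, j) a_ij d_x^i d_y^j on an F-vector space on which    *)
(* d_x and d_y act as X and Y.                                                 *)
Definition opact (V : lmodType F) (X Y : V -> V) p (v : V) : V :=
  \sum_(i < size (p : {poly {poly F}}))
    \sum_(j < size (p : {poly {poly F}})`_i)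
      opcoef p i j *: iter i X (iter j Y v).

Definition opone : diffop F := (1 : {poly {poly F}}).
Definition opmul p q : diffop F := opact opmulx opmuly p q.

Let opbox p n := forall i j, (n <= i)%N || (n <= j)%N -> opcoef p i j = 0.

Let opbox_exists p : exists n0, forall n, (n0 <= n)%N -> opbox p n.
Proof.
pose r : {poly {poly F}} := p.
exists (maxn (size r) (\max_(i < size r) size (r`_i)%R)) => n.
rewrite geq_max => /andP[rn cn] i j ij; rewrite /opcoef -/r.
case: (ltnP i (size r)) => [ir|ri]; last by rewrite (nth_default 0 ri) coef0.
case/orP: ij => [ni|nj].
  by rewrite (nth_default 0 (leq_trans rn ni)) coef0.
apply: nth_default; apply: leq_trans (leq_trans cn nj).
exact: (leq_bigmax (Ordinal ir)).
Qed.

Let sum_ord_trunc (V : nmodType) (f : nat -> V) m n :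
    (forall i, (m <= i)%N -> f i = 0) -> (forall i, (n <= i)%N -> f i = 0) ->
  \sum_(i < m) f i = \sum_(i < n) f i.
Proof.
have gen k l : (k <= l)%N -> (forall i, (k <= i)%N -> f i = 0) ->
    \sum_(i < k) f i = \sum_(i < l) f i.
  move=> kl f0; rewrite (big_ord_widen _ f kl) [RHS](bigID (fun i : 'I_l => (i < k)%N)) /=.
  by rewrite [X in _ + X]big1 ?addr0 // => i; rewrite -leqNgt => /f0.
move=> fm fn; rewrite (gen m (maxn m n)) ?leq_maxl //.
by rewrite (gen n (maxn m n)) ?leq_maxr.
Qed.

Section Action.
Variables (V : lmodType F) (X Y : V -> V).
Hypothesis XD : forall u v, X (u + v) = X u + X v.
Hypothesis YD : forall u v, Y (u + v) = Y u + Y v.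
Hypothesis XZ : forall a v, X (a *: v) = dx a *: v + a *: X v.
Hypothesis YZ : forall a v, Y (a *: v) = dy a *: v + a *: Y v.
Hypothesis XY : forall v, X (Y v) = Y (X v).

Let act := opact X Y.

Lemma opact_box p n v : opbox p n ->
  act p v = \sum_(i < n) \sum_(j < n) opcoef p i j *: iter i X (iter j Y v).
Proof.
move=> pn; rewrite /act /opact.
transitivity (\sum_(i < size (p : {poly {poly F}})) \sum_(j < n)
    opcoef p i j *: iter i X (iter j Y v)).
  apply: eq_bigr => i _.
  apply: (sum_ord_trunc (f := fun j => opcoef p i j *: iter i X (iter j Y v))).
    by move=> j jp; rewrite /opcoef (nth_default _ jp) scale0r.
  by move=> j nj; rewrite pn ?scale0r // nj orbT.
apply: (sum_ord_trunc (f := fun i => \sum_(j < n) opcoef p i j *: iter i X (iter j Y v))).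
  move=> i ip; rewrite big1 // => j _.
  by rewrite /opcoef (nth_default 0 ip) coef0 scale0r.
by move=> i ni; rewrite big1 // => j _; rewrite pn ?scale0r // ni.
Qed.

Let X0 : X 0 = 0.
Proof. by apply: (addrI (X 0)); rewrite -XD !addr0. Qed.
Let Y0 : Y 0 = 0.
Proof. by apply: (addrI (Y 0)); rewrite -YD !addr0. Qed.
Let Xsum n (f : nat -> V) : X (\sum_(i < n) f i) = \sum_(i < n) X (f i).
Proof. exact: (big_morph X XD X0). Qed.
Let Ysum n (f : nat -> V) : Y (\sum_(i < n) f i) = \sum_(i < n) Y (f i).
Proof. exact: (big_morph Y YD Y0). Qed.
Let YiterX i v : Y (iter i X v) = iter i X (Y v).
Proof. by elim: i => //= i IH; rewrite -XY IH. Qed.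
Let iterXD i u v : iter i X (u + v) = iter i X u + iter i X v.
Proof. by elim: i => //= i ->. Qed.
Let iterYD i u v : iter i Y (u + v) = iter i Y u + iter i Y v.
Proof. by elim: i => //= i ->. Qed.

Lemma opactDl p q v : act (p + q) v = act p v + act q v.
Proof.
have [m pm] := opbox_exists p; have [n qn] := opbox_exists q.
have pb := pm _ (leq_maxl m n); have qb := qn _ (leq_maxr m n).
have pqb : opbox (p + q) (maxn m n).
  by move=> i j ij; rewrite opcoefD pb // qb // addr0.
rewrite (opact_box v pb) (opact_box v qb) (opact_box v pqb) -big_split.
apply: eq_bigr => i _; rewrite -big_split; apply: eq_bigr => j _.
by rewrite opcoefD scalerDl.
Qed.

Lemma opact0 v : act 0 v = 0.
Proof. by apply: (addrI (act 0 v)); rewrite -opactDl !addr0. Qed.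

Lemma opactZl a p v : act (a *: p) v = a *: act p v.
Proof.
have [n pn] := opbox_exists p; have pb := pn _ (leqnn n).
have apb : opbox (a *: p) n.
  by move=> i j ij; rewrite opcoefZ pb // mulr0.
rewrite (opact_box v pb) (opact_box v apb) scaler_sumr.
apply: eq_bigr => i _; rewrite scaler_sumr; apply: eq_bigr => j _.
by rewrite opcoefZ scalerA.
Qed.

Lemma opactDr p u v : act p (u + v) = act p u + act p v.
Proof.
rewrite /act /opact -big_split; apply: eq_bigr => i _.
rewrite -big_split; apply: eq_bigr => j _.
by rewrite iterYD iterXD scalerDr.
Qed.

Lemma opact_mulx p v : act (opmulx p) v = X (act p v).
Proof.
have [n pn] := opbox_exists p.
have pb := pn _ (leqnn n); have pb1 := pn _ (leqnSn n).
have xb : opbox (opmulx p) n.+1.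
  move=> i j ij; rewrite opcoef_mulx pb1 // raddf0 add0r.
  case: i ij => // i ij; apply: pb; move: ij; rewrite ltnS => /orP[->//|/ltnW->].
  by rewrite orbT.
rewrite (opact_box v xb) (opact_box v pb).
rewrite (Xsum n (fun i => \sum_(j < n) opcoef p i j *: iter i X (iter j Y v))).
transitivity (\sum_(i < n) \sum_(j < n)
    (dx (opcoef p i j) *: iter i X (iter j Y v)
     + opcoef p i j *: iter i.+1 X (iter j Y v))); last first.
  apply: eq_bigr => i _.
  rewrite (Xsum n (fun j => opcoef p i j *: iter i X (iter j Y v))).
  by apply: eq_bigr => j _; rewrite XZ.
under eq_bigr => i _ do
  (under eq_bigr => j _ do rewrite opcoef_mulx scalerDl; rewrite big_split).
rewrite big_split /=.
under [RHS]eq_bigr => i _ do rewrite big_split.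
rewrite [RHS]big_split /=; congr (_ + _).
  rewrite big_ord_recr /= [X in _ + X]big1 ?addr0; last first.
    by move=> j _; rewrite pb ?leqnn // raddf0 scale0r.
  apply: eq_bigr => i _; rewrite big_ord_recr /= pb ?leqnn ?orbT //.
  by rewrite raddf0 scale0r addr0.
rewrite big_ord_recl /= big1 ?add0r; last by move=> j _; rewrite scale0r.
apply: eq_bigr => i _; rewrite big_ord_recr /= pb ?leqnn ?orbT //.
by rewrite scale0r addr0.
Qed.

Lemma opact_muly p v : act (opmuly p) v = Y (act p v).
Proof.
have [n pn] := opbox_exists p.
have pb := pn _ (leqnn n); have pb1 := pn _ (leqnSn n).
have xb : opbox (opmuly p) n.+1.
  move=> i j ij; rewrite opcoef_muly pb1 // raddf0 add0r.
  case: j ij => // j ij; apply: pb; move: ij; rewrite ltnS => /orP[/ltnW->//|->].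
  by rewrite orbT.
rewrite (opact_box v xb) (opact_box v pb).
rewrite (Ysum n (fun i => \sum_(j < n) opcoef p i j *: iter i X (iter j Y v))).
transitivity (\sum_(i < n) \sum_(j < n)
    (dy (opcoef p i j) *: iter i X (iter j Y v)
     + opcoef p i j *: iter i X (iter j.+1 Y v))); last first.
  apply: eq_bigr => i _.
  rewrite (Ysum n (fun j => opcoef p i j *: iter i X (iter j Y v))).
  by apply: eq_bigr => j _; rewrite YZ YiterX.
rewrite big_ord_recr /= [X in _ + X]big1 ?addr0; last first.
  move=> j _; rewrite opcoef_muly pb ?leqnn // raddf0 add0r.
  by case: (nat_of_ord j) => [|j']; rewrite ?pb ?leqnn // scale0r.
apply: eq_bigr => i _.
under eq_bigr => j _ do rewrite opcoef_muly scalerDl.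
rewrite big_split [RHS]big_split /=; congr (_ + _).
  rewrite big_ord_recr /= pb ?leqnn ?orbT //.
  by rewrite raddf0 scale0r addr0.
by rewrite big_ord_recl /= scale0r add0r.
Qed.

Lemma opact_sum n (f : nat -> diffop F) v :
  act (\sum_(i < n) f i) v = \sum_(i < n) act (f i) v.
Proof. by rewrite (big_morph (act^~ v) (fun p q => opactDl p q v) (opact0 v)). Qed.

Lemma opact_mul p q v : act (opmul p q) v = act p (act q v).
Proof.
rewrite /opmul /opact -/act.
rewrite (opact_sum _ (fun i => \sum_(j < size (p : {poly {poly F}})`_i)
   opcoef p i j *: iter i opmulx (iter j opmuly q))).
apply: eq_bigr => i _.
rewrite (opact_sum _ (fun j => opcoef p i j *: iter i opmulx (iter j opmuly q))).
apply: eq_bigr => j _; rewrite opactZl; congr (_ *: _).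
have actX k r : act (iter k opmulx r) v = iter k X (act r v).
  by elim: k => //= k IH; rewrite opact_mulx IH.
have actY k r : act (iter k opmuly r) v = iter k Y (act r v).
  by elim: k => //= k IH; rewrite opact_muly IH.
by rewrite actX actY.
Qed.

Lemma opact_one v : act opone v = v.
Proof.
by rewrite /act /opact /opone size_poly1 big_ord1 coef1 size_poly1 big_ord1 /opcoef !coef1 scale1r.
Qed.

End Action.

Let mulxD p q : opmulx (p + q) = opmulx p + opmulx q.
Proof.
apply: opP => i j; rewrite !(opcoefD, opcoef_mulx) raddfD /= addrACA.
by case: i => *; rewrite ?addr0 ?opcoefD.
Qed.
Let mulyD p q : opmuly (p + q) = opmuly p + opmuly q.
Proof.
apply: opP => i j; rewrite !(opcoefD, opcoef_muly) raddfD /= addrACA.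
by case: j => *; rewrite ?addr0 ?opcoefD.
Qed.
Let mulxZ a p : opmulx (a *: p) = dx a *: p + a *: opmulx p.
Proof.
apply: opP => i j; rewrite !(opcoefD, opcoef_mulx, opcoefZ) dxM -addrA mulrDr.
by case: i => *; rewrite ?mulr0 ?opcoefZ.
Qed.
Let mulyZ a p : opmuly (a *: p) = dy a *: p + a *: opmuly p.
Proof.
apply: opP => i j; rewrite !(opcoefD, opcoef_muly, opcoefZ) dyM -addrA mulrDr.
by case: j => *; rewrite ?mulr0 ?opcoefZ.
Qed.
Let mulxy p : opmulx (opmuly p) = opmuly (opmulx p).
Proof.
apply: opP => i j; rewrite !(opcoef_mulx, opcoef_muly) !raddfD /= dxdyC -!addrA.
congr (_ + _); case: i j => [|i] [|j];
  rewrite ?(opcoef_mulx, opcoef_muly) ?raddf0 ?addr0 ?add0r //.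
exact: addrCA.
Qed.

Let opmulA : associative opmul.
Proof. by move=> p q r; rewrite /opmul opact_mul. Qed.
Let opmul1r : left_id opone opmul.
Proof. by move=> p; exact: opact_one. Qed.
Let opmulDl : left_distributive opmul +%R.
Proof. by move=> p q r; exact: opactDl. Qed.
Let opmulDr : right_distributive opmul +%R.
Proof. by move=> p q r; exact: opactDr. Qed.
Let opone_neq0 : opone != 0.
Proof. exact: (oner_neq0 {poly {poly F}}). Qed.

Let opcoef_delta k l i j :
  opcoef (iter k opmulx (iter l opmuly opone)) i j = ((i == k) && (j == l))%:R.
Proof.
elim: k i => [|k IH] i /=.
  elim: l j => [|l IHl] j /=.
    by rewrite /opcoef /opone coef1; case: eqP; rewrite ?coef1 ?coef0.
  rewrite opcoef_muly; case: j => [|j]; rewrite !IHl ?eqSS.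
    by case: ((i == 0%N) && (0 == l)%N); rewrite ?dx1 ?dy1 ?raddf0 addr0 andbF.
  by case: ((i == 0%N) && (j.+1 == l)); rewrite ?dy1 ?raddf0 add0r.
rewrite opcoef_mulx; case: i => [|i]; rewrite !IH ?eqSS.
  by case: (_ && _); rewrite ?dx1 ?raddf0 addr0.
by case: ((i.+1 == k) && _); rewrite ?dx1 ?raddf0 add0r.
Qed.

Let opmulr1 : right_id opone opmul.
Proof.
move=> p; apply: opP => i j; rewrite /opmul.
have [n0 pn] := opbox_exists p; pose n := maxn n0 (maxn i j).+1.
have pb := pn _ (leq_maxl n0 (maxn i j).+1).
rewrite (opact_box _ _ _ pb) -/n.
have csum m (f : nat -> diffop F) :
    opcoef (\sum_(k < m) f k) i j = \sum_(k < m) opcoef (f k) i j.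
  elim: m => [|m IH]; first by rewrite !big_ord0 opcoef0.
  by rewrite !big_ord_recr /= opcoefD IH.
have iN : (i < n)%N by rewrite leq_max ltnS leq_maxl orbT.
have jN : (j < n)%N by rewrite leq_max ltnS leq_maxr orbT.
rewrite (csum _ (fun k => \sum_(l < n) opcoef p k l *: iter k opmulx (iter l opmuly opone))).
rewrite (bigD1 (Ordinal iN)) //= (csum _ (fun l => opcoef p i l *: iter i opmulx (iter l opmuly opone))).
rewrite (bigD1 (Ordinal jN)) //= opcoefZ opcoef_delta !eqxx mulr1.
rewrite big1 ?addr0 => [|l lj]; last first.
  rewrite opcoefZ opcoef_delta eqxx /= (_ : (j == l) = false) ?mulr0 //.
  by apply/eqP => E; case/eqP: lj; apply: val_inj.
rewrite big1 ?addr0 // => k ki.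
rewrite (csum _ (fun l => opcoef p k l *: iter k opmulx (iter l opmuly opone))).
rewrite big1 // => l _; rewrite opcoefZ opcoef_delta (_ : (i == k) = false) ?mulr0 //.
by apply/eqP => E; case/eqP: ki; apply: val_inj.
Qed.

HB.instance Definition _ := GRing.Zmodule_isNzRing.Build (diffop F)
  opmulA opmul1r opmulr1 opmulDl opmulDr opone_neq0.

Let opscaleAl a p q : a *: (p * q) = (a *: p) * q.
Proof. by rewrite /GRing.mul /= /opmul opactZl. Qed.
HB.instance Definition _ := GRing.Lmodule_isLalgebra.Build F (diffop F) opscaleAl.

Definition opdx : diffop F := opmulx 1.
Definition opdy : diffop F := opmuly 1.

Lemma opdx_mul p : opdx * p = opmulx p.
Proof.
rewrite {1}/GRing.mul /= /opmul /opdx opact_mulx //.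
by congr opmulx; exact: opact_one.
Qed.
Lemma opdy_mul p : opdy * p = opmuly p.
Proof.
rewrite {1}/GRing.mul /= /opmul /opdy opact_muly //.
by congr opmuly; exact: opact_one.
Qed.

Lemma opdx_comm a : opdx * a%:A = a *: opdx + (dx a)%:A.
Proof. by rewrite opdx_mul mulxZ addrC. Qed.
Lemma opdy_comm a : opdy * a%:A = a *: opdy + (dy a)%:A.
Proof. by rewrite opdy_mul mulyZ addrC. Qed.
Lemma opdxdyC : opdx * opdy = opdy * opdx.
Proof. by rewrite opdx_mul opdy_mul mulxy. Qed.

Lemma opcoef_monomial k l i j :
  opcoef (opdx ^+ k * opdy ^+ l) i j = ((i == k) && (j == l))%:R.
Proof.
have -> : opdy ^+ l = iter l opmuly opone.
  by elim: l => //= l IH; rewrite exprS IH opdy_mul.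
rewrite -opcoef_delta; congr (opcoef _ i j).
by elim: k => /= [|k IH]; rewrite ?expr0 ?mul1r // exprS -mulrA IH opdx_mul.
Qed.

End OperatorModule.

Section Ideals.
Variable F : diffFieldType.
Implicit Types (J : diffop F -> Prop) (K : {poly rat}) (z n : nat).

Definition left_ideal J : Prop :=
  [/\ J 0, forall p q, J p -> J q -> J (p + q) & forall p q, J q -> J (p * q)].

Definition order_le (p : diffop F) z : Prop :=
  forall i j, (z < i + j)%N -> opcoef p i j = 0.

(* The operators of order <= z modulo those lying in J have F-dimension n: the *)
(* classes of some operators e_0, ..., e_(n-1) form a basis.                   *)
Definition quotient_dim J z n : Prop :=
  exists e : 'I_n -> diffop F,
    [/\ forall i, order_le (e i) z,
        forall c : 'I_n -> F, J (\sum_i c i *: e i) -> forall i, c i = 0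
      & forall p, order_le p z ->
          exists c : 'I_n -> F, J (p - \sum_i c i *: e i)].

Definition hilbert_kolchin_poly J K : Prop :=
  exists z0, forall z, (z0 <= z)%N ->
    exists2 n, quotient_dim J z n & K.[z%:R] = n%:R.

Definition differential_type J (t : nat) : Prop :=
  exists2 K, hilbert_kolchin_poly J K & size K = t.+1.

Definition nonholonomic J : Prop := differential_type J 1.

Definition equivalent_ideals J J0 : Prop :=
  exists K K0 K1 : {poly rat},
    [/\ hilbert_kolchin_poly J K,
        hilbert_kolchin_poly J0 K0,
        hilbert_kolchin_poly (fun p => J p /\ J0 p) K1,
        [/\ size K = 2%N, size K0 = 2%N & size K1 = 2%N]
      & lead_coef K = lead_coef K0 /\ lead_coef K0 = lead_coef K1].

End Ideals.

(* The data k, 1 > s_2 > ... > s_k > 0 and f_1, ..., f_k of a symbol           *)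
(* G_{s_2,...,s_k}(f_1,...,f_k); fd_tail lists (s_2, f_2), ..., (s_k, f_k).    *)
Record fd_symbol (F : diffFieldType) := FdSymbol {
  fd_head : F;
  fd_tail : seq (rat * F);
  fd_head_nonconst : (dx fd_head, dy fd_head) <> (0, 0);
  fd_exponents_decreasing : path >%R 1 (unzip1 fd_tail);
  fd_exponents_gt0 : all (fun s : rat => 0 < s) (unzip1 fd_tail)
}.

Section Series.
Variables (F : diffFieldType) (G : fd_symbol F).

Definition fd_terms : seq (rat * F) := (1, fd_head G) :: fd_tail G.

Definition fd_denominator : nat :=
  \big[lcmn/1%N]_(t <- fd_tail G) `|denq t.1|%N.

(* A formal sum \sum_s c_s G^(s) is its coefficient function s |-> c_s. Since  *)
(* d(c_s G^(s)) = (d c_s) G^(s) + \sum_j c_s (d f_j) G^(s_j + s) with s_1 = 1, *)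
(* the coefficient of G^(s) in its derivative is                               *)
(* d c_s + \sum_j (d f_j) c_(s - s_j).                                         *)
Definition fd_derive (d : F -> F) (c : rat -> F^o) : rat -> F^o :=
  fun s => d (c s) + \sum_(t <- fd_terms) d t.2 * c (s - t.1).

Definition fd_act (p : diffop F) (c : rat -> F^o) : rat -> F^o :=
  opact (fd_derive (@dx F)) (fd_derive (@dy F)) p c.

(* H = \sum_(i >= 0) h_i G^(s0 - i/q) with s0 q an integer.                    *)
Definition is_fd_series (H : rat -> F^o) : Prop :=
  exists (s0 : rat) (h : nat -> F),
    [/\ s0 * fd_denominator%:R \is a Num.int,
        forall i : nat, H (s0 - i%:R / fd_denominator%:R) = h i
      & forall s, (forall i : nat, s <> s0 - i%:R / fd_denominator%:R) ->
          H s = 0].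

Definition fd_series_solution (J : diffop F -> Prop) (H : rat -> F^o) : Prop :=
  is_fd_series H /\ forall p, J p -> fd_act p H = 0.

Let deriveD (d : {additive F -> F}) u v :
  fd_derive d (u + v) = fd_derive d u + fd_derive d v.
Proof.
apply/funext => s; rewrite /fd_derive !fctE raddfD addrACA; congr (_ + _).
by rewrite -big_split; apply: eq_bigr => t _; exact: mulrDr.
Qed.

Let deriveZ (d : F -> F) a v :
  (forall x y, d (x * y) = d x * y + x * d y) ->
  fd_derive d (a *: v) = d a *: v + a *: fd_derive d v.
Proof.
move=> dM; apply/funext => s; rewrite /fd_derive !fctE.
rewrite -[a *: v s]/(a * v s) dM -addrA; congr (_ + _).
rewrite -[RHS]/(a * _) mulrDr; congr (_ + _).
by rewrite mulr_sumr; apply: eq_bigr => t _; rewrite mulrCA.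
Qed.

Let deriveC v : fd_derive (@dx F) (fd_derive (@dy F) v) =
  fd_derive (@dy F) (fd_derive (@dx F) v).
Proof.
apply/funext => s; rewrite /fd_derive !raddfD /= dxdyC -!addrA; congr (_ + _).
rewrite !raddf_sum /=.
under eq_bigr => t _ do rewrite dxM.
under [X in _ + X]eq_bigr => t _ do rewrite mulrDr.
under [X in _ = X + _]eq_bigr => t _ do rewrite dyM.
under [X in _ = _ + X]eq_bigr => t _ do rewrite mulrDr.
rewrite !big_split /= addrACA; congr (_ + _ + (_ + _)).
  by apply: eq_bigr => t _; rewrite dxdyC.
under eq_bigr => t _ do rewrite mulr_sumr.
under [RHS]eq_bigr => t _ do rewrite mulr_sumr.
rewrite exchange_big /=; apply: eq_bigr => t _; apply: eq_bigr => u _.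
by rewrite mulrCA addrAC.
Qed.

Lemma fd_act_mul p q H : fd_act (p * q) H = fd_act p (fd_act q H).
Proof.
apply: opact_mul => *.
- exact: (deriveD (@dx F)).
- exact: (deriveD (@dy F)).
- exact: (deriveZ _ _ (@dxM F)).
- exact: (deriveZ _ _ (@dyM F)).
- exact: deriveC.
Qed.

End Series.

(* Main.v *)
(* If J and J0 are equivalent, the dimension of J / (J cap J0) in order <= z   *)
(* stays bounded, so for p in J some nontrivial combination of the d_x^i p     *)
(* (and of the d_y^i p) lies in J0. If H solves J0 and p H <> 0, then the      *)
(* d_x^i p H (or the d_y^i p H, if d_x f_1 = 0) have distinct top exponents, a *)
(* contradiction; so H solves J.                                               *)
(*                                                                             *)
(* Conversely, J cap J0 contains some w <> 0, which the shear                  *)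
(* d_y := d_y + m d_x makes monic in d_x; then the leading coefficient of the  *)
(* Hilbert-Kolchin polynomial is the least d_x-degree of the nonzero elements. *)
(* Suppose that p1 and p3 attain it for J and for J + J0. Pseudo-division      *)
(* gives a p1 = u p3 with 0 <> a in F[d_y]. If u has positive d_x-degree, a    *)
(* Newton-Puiseux construction produces a symbol G with d_y f_1 <> 0 and a     *)
(* series H' <> 0 with u H' = 0. Operators act surjectively on series, say     *)
(* H' = p3 H. Then a p1 H = 0, and a is injective, so H solves J but not       *)
(* J + J0. Hence if J and J0 have the same solutions, the least degrees agree, *)
(* and they are attained in J cap J0 as well.                                  *)
(*                                                                             *)
(* The equations in F met on the way are linear, or algebraic. They are solved *)
(* in the fraction field of Hurwitz series over a finitely generated subfield, *)
(* respectively in an algebraic extension, and brought to F by universality.   *)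

From HB Require Import structures.
Require Import Defs.
From mathcomp Require Import all_boot all_order all_algebra qfpoly.
From mathcomp Require Import boolp functions.
From mathcomp Require Import zify ring lra.

Set Implicit Arguments.
Unset Strict Implicit.
Unset Printing Implicit Defensive.

Import Order.TTheory GRing.Theory Num.Theory.
Local Open Scope ring_scope.

(** * Operators and their weighted symbols *)

(** The link between operators and series is that [G] behaves like an exponential. Applying [p] to a
    series amounts to conjugating [p] by the exponential of the sum of the f_j lambda^(s_j), where
    lambda shifts the exponent of [G] ([fd_act_twist]). The action on series is therefore
    triangular, governed by the top coefficient of the conjugated operator ([fd_act_solve]): every
    nonzero operator is surjective on series, and it has a kernel as soon as this top coefficient
    involves a derivation.

    Equivalence gives equal solutions by linear algebra. The Hilbert-Kolchin polynomials of [J] and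
    of the intersection [L] differ by a constant, so for [p] in [J] enough of the d^i p are linearly
    dependent modulo [L] ([hilbert_kolchin_relative_bound], [relative_dim_relation]). On a series
    the powers of a derivation that does not kill f_1 produce distinct leading exponents, so such a
    relation cannot annihilate a nonzero p H ([sum_dx_act_neq0], [sum_dy_act_neq0]).

    For the converse, once a shear has made some common element monic in d_x, the leading
    coefficient of the polynomial is the least d_x-degree of nonzero elements of the ideal. The crux
    is that this degree does not drop from [J] to J + J0 ([min_xdeg_eq]). Otherwise there is a
    quotient operator [u], with a p1 = u p3, whose principal symbol involves d_x ([normal_factors]);
    the Newton polygon method finds a symbol [G] for which [u] has a kernel ([newton_puiseux]), and
    this yields a solution of [J] that does not solve J + J0. When all the least degrees agree,
    [hilbert_kolchin_sub] computes the polynomials.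

    The Newton polygon requires roots of polynomials and solutions of first order equations in [F],
    and the triangular systems require solutions of arbitrary linear equations. Universality
    provides both ([universal_closed], [universal_linear]). *)

Lemma measure_recursion (T U : Type) (mu : T -> nat) (u0 : U)
    (step : T -> (T -> U) -> U) :
    (forall x g h, (forall y, (mu y < mu x)%N -> g y = h y) ->
       step x g = step x h) ->
  exists h, forall x, h x = step x h.
Proof.
(* [g k] is the k-th approximation: its value at [x] is final as soon as [k] exceeds [mu x], so the
   placeholder [u0] does not matter there. *)
move=> stepP; pose g := fix g k := if k is k'.+1 then fun x => step x (g k') else fun=> u0.
have stab k l x : (mu x < k)%N -> (mu x < l)%N -> g k x = g l x.
  elim: k l x => // k IH [//|l] x xk xl /=; apply: stepP => y yx.
  by apply: IH; apply: leq_trans yx _.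
exists (fun x => g (mu x).+1 x) => x /=; apply: stepP => y yx.
exact: (stab (mu x) (mu y).+1).
Qed.

Section Operators.
Variable F : diffFieldType.
Implicit Types (a b : F) (p q : diffop F).

Lemma opcoefN p i j : opcoef (- p) i j = - opcoef p i j.
Proof. by rewrite /opcoef !coefN. Qed.
Lemma opcoefB p q i j : opcoef (p - q) i j = opcoef p i j - opcoef q i j.
Proof. by rewrite opcoefD opcoefN. Qed.
Lemma opcoef_sum I (r : seq I) (P : pred I) (f : I -> diffop F) i j :
  opcoef (\sum_(k <- r | P k) f k) i j = \sum_(k <- r | P k) opcoef (f k) i j.
Proof.
by apply: (big_morph (fun p => opcoef p i j)) => [p q|]; rewrite (opcoefD, opcoef0).
Qed.

Lemma opcoef1 i j : opcoef (1 : diffop F) i j = ((i == 0) && (j == 0))%N%:R.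
Proof.
rewrite (_ : 1 = opdx F ^+ 0 * opdy F ^+ 0) ?opcoef_monomial //.
by rewrite !expr0 mulr1.
Qed.

Lemma opcoef_dx p i j : opcoef (opdx F * p) i j =
  dx (opcoef p i j) + (if i is i'.+1 then opcoef p i' j else 0).
Proof. by rewrite opdx_mul opcoef_mulx. Qed.
Lemma opcoef_dy p i j : opcoef (opdy F * p) i j =
  dy (opcoef p i j) + (if j is j'.+1 then opcoef p i j' else 0).
Proof. by rewrite opdy_mul opcoef_muly. Qed.

Lemma diffopE p : p = \sum_(i < size (p : {poly {poly F}}))
    \sum_(j < size (p : {poly {poly F}})`_i)
      opcoef p i j *: (opdx F ^+ i * opdy F ^+ j).
Proof.
rewrite -{1}[p]mulr1 {1}/GRing.mul /= /opmul /opact.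
apply: eq_bigr => i _; apply: eq_bigr => j _; congr (_ *: _).
have -> : iter j (@opmuly F) 1 = opdy F ^+ j.
  by elim: (nat_of_ord j) => //= l IH; rewrite exprS IH opdy_mul.
move: (nat_of_ord j) => l.
by elim: (nat_of_ord i) => /= [|k IH]; rewrite ?expr0 ?mul1r // exprS -mulrA -IH opdx_mul.
Qed.

(** Constructions defined through [opact] respect sums, scalars and left multiplication by [opdx]
    and [opdy]. This induction reaches every operator by those steps while tracking the order; the
    last hypothesis pads summands of smaller order. *)
Lemma order_ind (Q : nat -> diffop F -> Prop) :
    Q 0%N 1 ->
    (forall n p q, Q n p -> Q n q -> Q n (p + q)) ->
    (forall n a p, Q n p -> Q n (a *: p)) ->
    (forall n p, Q n p -> Q n.+1 (opdx F * p)) ->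
    (forall n p, Q n p -> Q n.+1 (opdy F * p)) ->
    (forall n p, Q n p -> Q n.+1 p) ->
  forall n p, order_le p n -> Q n p.
Proof.
move=> Q1 QD QZ Qx Qy Qm n p pn.
have Qle m l r : (m <= l)%N -> Q m r -> Q l r.
  by move=> /subnK <- Qr; elim: (l - m)%N => //= k; rewrite addSn; exact: Qm.
have Q0 : Q n 0 by apply: (Qle 0%N) => //; rewrite -(scale0r 1); exact: QZ.
rewrite (diffopE p); apply: (big_ind (Q n)) => // [p' q'|i _]; first exact: QD.
apply: (big_ind (Q n)) => // [p' q'|j _]; first exact: QD.
case: (leqP (i + j) n) => [ij|ij]; last by rewrite pn ?scale0r.
apply: QZ; apply: (Qle (i + j)%N) => //.
move: (nat_of_ord j) => l; elim: (nat_of_ord i) => [|k IH]; last first.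
  by rewrite exprS -mulrA addSn; exact: Qx.
rewrite expr0 mul1r add0n; elim: l => [|k IH]; first by rewrite expr0.
by rewrite exprS; exact: Qy.
Qed.

Lemma order_le_exists p : exists n, order_le p n.
Proof.
pose r : {poly {poly F}} := p.
exists (size r + \max_(i < size r) size (r`_i)%R)%N => i j ij; rewrite /opcoef -/r.
case: (ltnP i (size r)) => [ir|ri]; last by rewrite (nth_default 0 ri) coef0.
apply: nth_default; set M := (\max_(k < _) _)%N in ij.
apply: leq_trans (leq_bigmax (F := fun k : 'I_(size r) => size (r`_k)%R) (Ordinal ir)) _.
rewrite -/M; lia.
Qed.

Lemma diffop_ind (Q : diffop F -> Prop) :
    Q 1 -> (forall p q, Q p -> Q q -> Q (p + q)) -> (forall a p, Q p -> Q (a *: p)) ->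
    (forall p, Q p -> Q (opdx F * p)) -> (forall p, Q p -> Q (opdy F * p)) ->
  forall p, Q p.
Proof.
move=> Q1 QD QZ Qx Qy p; have [n pn] := order_le_exists p.
by apply: (order_ind (Q := fun=> Q)) pn.
Qed.

Lemma order_leW p m n : (m <= n)%N -> order_le p m -> order_le p n.
Proof. by move=> mn pm i j ij; apply: pm; lia. Qed.
Lemma order_leD p q n : order_le p n -> order_le q n -> order_le (p + q) n.
Proof. by move=> pn qn i j ij; rewrite opcoefD pn ?qn ?addr0. Qed.
Lemma order_leZ a p n : order_le p n -> order_le (a *: p) n.
Proof. by move=> pn i j ij; rewrite opcoefZ pn ?mulr0. Qed.
Lemma order_le1 n : order_le (1 : diffop F) n.
Proof. by move=> i j ij; rewrite opcoef1; case: eqP => [i0|//]; case: eqP => [j0|//]; lia. Qed.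
Lemma order_le0 n : order_le (0 : diffop F) n.
Proof. by move=> i j ij; rewrite opcoef0. Qed.
Lemma order_le_dx p n : order_le p n -> order_le (opdx F * p) n.+1.
Proof.
move=> pn i j ij; rewrite opcoef_dx pn; last lia.
by rewrite raddf0 add0r; case: i ij => // i ij; apply: pn; lia.
Qed.
Lemma order_le_dy p n : order_le p n -> order_le (opdy F * p) n.+1.
Proof.
move=> pn i j ij; rewrite opcoef_dy pn; last lia.
by rewrite raddf0 add0r; case: j ij => // j ij; apply: pn; lia.
Qed.

(* The part of weight n, when d_x has weight w and d_y weight v, as a           *)
(* commutative polynomial in the symbols X of d_x and Y of d_y.                *)
Definition wform (w v n : nat) p : {poly {poly F}} :=
  \poly_(i < size (p : {poly {poly F}}))
    \poly_(j < size (p : {poly {poly F}})`_i)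
      (if (w * i + v * j == n)%N then opcoef p i j else 0).

Definition weight_le (w v : nat) p n :=
  forall i j, (n < w * i + v * j)%N -> opcoef p i j = 0.

Lemma coef_wform w v n p i j :
  (wform w v n p)`_i`_j = if (w * i + v * j == n)%N then opcoef p i j else 0.
Proof.
rewrite /wform coef_poly; case: ltnP => [_|li]; last first.
  by rewrite coef0 /opcoef (nth_default 0 li) coef0 if_same.
rewrite coef_poly; case: ltnP => // lj.
by rewrite /opcoef (nth_default 0 lj) if_same.
Qed.

Lemma order_le_weight p n : order_le p n <-> weight_le 1 1 p n.
Proof. by split=> pn i j ij; apply: pn; lia. Qed.

Lemma wformD w v n p q : wform w v n (p + q) = wform w v n p + wform w v n q.
Proof.
apply/polyP => i; apply/polyP => j; rewrite !coefD !coef_wform opcoefD.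
by case: eqP; rewrite ?addr0.
Qed.
Lemma wformZ w v n a p : wform w v n (a *: p) = a%:P%:P * wform w v n p.
Proof.
apply/polyP => i; apply/polyP => j; rewrite !coefCM !coef_wform opcoefZ.
by case: eqP; rewrite ?mulr0.
Qed.
Lemma wform0 w v n : wform w v n 0 = 0.
Proof. by apply/polyP => i; apply/polyP => j; rewrite coef_wform opcoef0 if_same !coef0. Qed.
Lemma wform_sum w v n I (r : seq I) (f : I -> diffop F) :
  wform w v n (\sum_(k <- r) f k) = \sum_(k <- r) wform w v n (f k).
Proof. by apply: (big_morph (wform w v n)) => [p q|]; rewrite (wformD, wform0). Qed.

Lemma wform_small w v m n p : weight_le w v p m -> (m < n)%N -> wform w v n p = 0.
Proof.
move=> pm mn; apply/polyP => i; apply/polyP => j; rewrite coef_wform !coef0.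
by case: eqP => // e; apply: pm; rewrite e.
Qed.

Lemma wform_dx w v n p : (0 < w)%N -> weight_le w v p n ->
  weight_le w v (opdx F * p) (n + w) /\
  wform w v (n + w) (opdx F * p) = 'X * wform w v n p.
Proof.
move=> w0 pn; split=> [i j ij|].
  rewrite opcoef_dx pn ?raddf0 ?add0r; last lia.
  by case: i ij => // i ij; apply: pn; nia.
apply/polyP => i; apply/polyP => j; rewrite coef_wform coefXM opcoef_dx.
case: i => [|i] /=; rewrite ?coef0 ?coef_wform ?addr0.
  by case: eqP => // e; rewrite pn ?raddf0 //; lia.
rewrite mulnS; case: eqP => e; last by rewrite (_ : (w * i + v * j == n)%N = false) //; apply/eqP; lia.
rewrite (_ : (w * i + v * j == n)%N); last by apply/eqP; lia.
rewrite pn ?raddf0 ?add0r // mulnS; lia.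
Qed.

Lemma wform_dy w v n p : (0 < v)%N -> weight_le w v p n ->
  weight_le w v (opdy F * p) (n + v) /\
  wform w v (n + v) (opdy F * p) = 'X%:P * wform w v n p.
Proof.
move=> w0 pn; split=> [i j ij|].
  rewrite opcoef_dy pn ?raddf0 ?add0r; last lia.
  by case: j ij => // j ij; apply: pn; nia.
apply/polyP => i; apply/polyP => j; rewrite coef_wform coefCM coefXM opcoef_dy.
case: j => [|j] /=; rewrite ?coef0 ?coef_wform ?addr0.
  by case: eqP => // e; rewrite pn ?raddf0 //; lia.
rewrite mulnS; case: eqP => e; last by rewrite (_ : (w * i + v * j == n)%N = false) //; apply/eqP; lia.
rewrite (_ : (w * i + v * j == n)%N); last by apply/eqP; lia.
rewrite pn ?raddf0 ?add0r // mulnS; lia.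
Qed.

Lemma wform_monomial w v n k l p : (0 < w)%N -> (0 < v)%N -> weight_le w v p n ->
  weight_le w v (opdx F ^+ k * opdy F ^+ l * p) (w * k + v * l + n) /\
  wform w v (w * k + v * l + n) (opdx F ^+ k * opdy F ^+ l * p) =
    'X ^+ k * 'X%:P ^+ l * wform w v n p.
Proof.
move=> w0 v0 pn; rewrite -addnA.
have [yn yE] : weight_le w v (opdy F ^+ l * p) (v * l + n) /\
    wform w v (v * l + n) (opdy F ^+ l * p) = 'X%:P ^+ l * wform w v n p.
  elim: l => [|l [IHn IH]]; first by rewrite muln0 !expr0 !mul1r.
  have [A B] := wform_dy v0 IHn.
  by rewrite !exprS -!mulrA -IH -B (_ : v * l.+1 + n = v * l + n + v)%N //; lia.
rewrite -!mulrA -yE; move: yn; set m := (_ + n)%N; set r := _ * p => rm.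
elim: k => [|k [IHn IH]]; first by rewrite muln0 !expr0 !mul1r.
have [A B] := wform_dx w0 IHn.
by rewrite !exprS -!mulrA -IH -B (_ : w * k.+1 + m = w * k + m + w)%N //; lia.
Qed.

(** Moving a derivation past a function creates a term that lacks this derivation, hence of smaller
    weight as both weights are positive. So the top parts multiply like commutative polynomials. *)
Lemma wformM w v n m p q : (0 < w)%N -> (0 < v)%N ->
    weight_le w v p n -> weight_le w v q m ->
  weight_le w v (p * q) (n + m) /\
  wform w v (n + m) (p * q) = wform w v n p * wform w v m q.
Proof.
move=> w0 v0 pn qm.
have pqE : p * q = \sum_(i < size (p : {poly {poly F}}))
    \sum_(j < size (p : {poly {poly F}})`_i)
      opcoef p i j *: (opdx F ^+ i * opdy F ^+ j * q).
  rewrite {1}(diffopE p) mulr_suml; apply: eq_bigr => i _.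
  by rewrite mulr_suml; apply: eq_bigr => j _; rewrite -scalerAl.
split.
  move=> i j ij; rewrite pqE opcoef_sum big1 // => k _.
  rewrite opcoef_sum big1 // => l _; rewrite opcoefZ.
  case: (leqP (w * k + v * l) n) => [kl|kl]; last by rewrite pn ?mul0r.
  have [le _] := wform_monomial k l w0 v0 qm; rewrite le ?mulr0 //; lia.
rewrite pqE wform_sum [X in _ = X * _]/wform poly_def mulr_suml; apply: eq_bigr => i _.
rewrite wform_sum poly_def scaler_suml mulr_suml; apply: eq_bigr => j _.
rewrite wformZ; have [le E] := wform_monomial i j w0 v0 qm.
rewrite -!mul_polyC polyCM rmorphXn /=.
case: eqP => e; first by rewrite -e E; ring.
case: (leqP (w * i + v * j) n) => kl; last by rewrite pn //= !rmorph0 !mul0r.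
rewrite (wform_small le); last first.
  by rewrite ltn_add2r ltn_neqAle kl andbT; apply/eqP.
by rewrite mulr0 !rmorph0 !mul0r.
Qed.

Lemma wform_eq0 w v n p : weight_le w v p n.+1 -> wform w v n.+1 p = 0 -> weight_le w v p n.
Proof.
move=> pn /polyP p0 i j ij; have := p0 i => /polyP/(_ j).
rewrite coef_wform !coef0; case: eqP => // e _; apply: pn; lia.
Qed.

Lemma weight_exists w v p : p != 0 ->
  exists n, weight_le w v p n /\ wform w v n p != 0.
Proof.
move=> p0; have [n0 pn0] : exists n, weight_le w v p n.
  have [n pn] := order_le_exists p; exists ((w + v) * n)%N => i j ij.
  by apply: pn; nia.
elim: n0 pn0 => [|n IH] pn.
  exists 0%N; split=> //; apply/eqP => /polyP f0; case/eqP: p0; apply: opP => i j.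
  have := f0 i => /polyP/(_ j); rewrite coef_wform !coef0 opcoef0.
  by case: eqP => // e _; apply: pn; lia.
case: (eqVneq (wform w v n.+1 p) 0) => [/(wform_eq0 pn)/IH //|f0].
by exists n.+1.
Qed.

(** Principal symbols multiply inside the integral domain F[X, Y]. *)
Lemma opmul_neq0 p q : p != 0 -> q != 0 -> p * q != 0.
Proof.
move=> p0 q0; have [n [pn fp]] := weight_exists 1 1 p0.
have [m [qm fq]] := weight_exists 1 1 q0.
have [_ E] := wformM (ltn0Sn 0) (ltn0Sn 0) pn qm.
by apply/eqP => pq; have := mulf_neq0 fp fq; rewrite -E pq wform0 eqxx.
Qed.

End Operators.

(* The hypotheses under which opact makes an F-vector space a module over the  *)
(* ring of operators.                                                          *)
Record diff_action (F : diffFieldType) (V : lmodType F) (X Y : V -> V) : Prop :=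
  DiffAction {
  actXD : forall u v, X (u + v) = X u + X v;
  actYD : forall u v, Y (u + v) = Y u + Y v;
  actXZ : forall a v, X (a *: v) = dx a *: v + a *: X v;
  actYZ : forall a v, Y (a *: v) = dy a *: v + a *: Y v;
  actXY : forall v, X (Y v) = Y (X v) }.

Section Actions.
Variables (F : diffFieldType) (V : lmodType F) (X Y : V -> V).
Hypothesis A : diff_action X Y.

Lemma actD p q v : opact X Y (p + q) v = opact X Y p v + opact X Y q v.
Proof. exact: opactDl. Qed.
Lemma actZ a p v : opact X Y (a *: p) v = a *: opact X Y p v.
Proof. exact: opactZl. Qed.
Lemma act1 v : opact X Y 1 v = v.
Proof. exact: opact_one. Qed.
Lemma act_dx p v : opact X Y (opdx F * p) v = X (opact X Y p v).
Proof. by case: A => *; rewrite opdx_mul opact_mulx. Qed.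
Lemma act_dy p v : opact X Y (opdy F * p) v = Y (opact X Y p v).
Proof. by case: A => *; rewrite opdy_mul opact_muly. Qed.
Lemma actDr p u v : opact X Y p (u + v) = opact X Y p u + opact X Y p v.
Proof. by case: A => *; exact: opactDr. Qed.
Lemma act0 v : opact X Y 0 v = 0.
Proof. exact: opact0. Qed.
Lemma act0r p : opact X Y p 0 = 0.
Proof. by apply: (addrI (opact X Y p 0)); rewrite -actDr !addr0. Qed.
Lemma act_sum I (r : seq I) (P : pred I) (f : I -> diffop F) v :
  opact X Y (\sum_(i <- r | P i) f i) v = \sum_(i <- r | P i) opact X Y (f i) v.
Proof. by apply: (big_morph (fun p => opact X Y p v)) => [p q|]; rewrite (actD, act0). Qed.
End Actions.

Lemma field_action (F : diffFieldType) :
  @diff_action F F^o (@dx F) (@dy F).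
Proof.
split; [exact: dxD|exact: dyD|exact: dxM|exact: dyM|exact: dxdyC].
Qed.

Lemma mul_action (F : diffFieldType) :
  @diff_action F (diffop F) (fun v => opdx F * v) (fun v => opdy F * v).
Proof.
split=> [u v|u v|a v|a v|v]; rewrite ?mulrDr ?mulrA ?opdxdyC //.
- by rewrite -(mulr_algl a v) mulrA opdx_comm mulrDl addrC -!scalerAl mul1r.
- by rewrite -(mulr_algl a v) mulrA opdy_comm mulrDl addrC -!scalerAl mul1r.
Qed.

(** * Conjugation by exponentials *)

Section Twist.
Variable F : diffFieldType.
Implicit Types (a b f : F) (p : diffop F) (phi : seq (rat * F)) (s t : rat).

(** A function of [t] stands for a series in lambda with operator coefficients; this is left
    multiplication by the conjugated derivation E^-1 D E, which is D plus the sum of the (d f_j)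
    lambda^(s_j). *)
Definition twist_derive (d : F -> F) (D : diffop F) phi (v : rat -> diffop F) :
    rat -> diffop F :=
  fun t => D * v t + \sum_(e <- phi) d e.2 *: v (t - e.1).

(* With phi = [:: (s_1, f_1), ...] and E = exp(\sum_j f_j lambda^(s_j)), the    *)
(* coefficient of lambda^t in the operator E^-1 p E.                           *)
Definition twist phi p : rat -> diffop F :=
  opact (twist_derive (@dx F) (opdx F) phi) (twist_derive (@dy F) (opdy F) phi) p
    (fun t => if t == 0 then 1 else 0).

Let derD (d : F -> F) D phi u v :
  twist_derive d D phi (u + v) = twist_derive d D phi u + twist_derive d D phi v.
Proof.
apply/funext => t; rewrite /twist_derive !fctE mulrDr addrACA; congr (_ + _).
by rewrite -big_split; apply: eq_bigr => e _; rewrite scalerDr.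
Qed.

Let derZ (d : F -> F) D phi a v :
  (forall p, D * (a *: p) = d a *: p + a *: (D * p)) ->
  twist_derive d D phi (a *: v) = d a *: v + a *: twist_derive d D phi v.
Proof.
move=> Da; apply/funext => t; rewrite /twist_derive !fctE Da -addrA; congr (_ + _).
rewrite scalerDr; congr (_ + _); rewrite scaler_sumr; apply: eq_bigr => e _.
by rewrite !scalerA mulrC.
Qed.

Lemma twist_action phi : diff_action (twist_derive (@dx F) (opdx F) phi)
   (twist_derive (@dy F) (opdy F) phi).
Proof.
have [_ _ xZ yZ _] := mul_action F.
split=> [u v|u v|a v|a v|v]; [exact: derD|exact: derD|exact: derZ|exact: derZ|].
apply/funext => t; rewrite /twist_derive !mulrDr !mulrA opdxdyC -!addrA; congr (_ + _).
rewrite !mulr_sumr.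
under eq_bigr => e _ do rewrite xZ.
under [X in _ + X]eq_bigr => e _ do rewrite scalerDr.
under [X in _ = X + _]eq_bigr => e _ do rewrite yZ.
under [X in _ = _ + X]eq_bigr => e _ do rewrite scalerDr.
rewrite !big_split /= addrACA; congr (_ + _ + (_ + _)).
  by apply: eq_bigr => e _; rewrite dxdyC.
under eq_bigr => e _ do rewrite scaler_sumr.
under [RHS]eq_bigr => e _ do rewrite scaler_sumr.
rewrite exchange_big /=; apply: eq_bigr => e _; apply: eq_bigr => e' _.
by rewrite !scalerA mulrC addrAC.
Qed.

Lemma twist1 phi t : twist phi 1 t = if t == 0 then 1 else 0.
Proof. by rewrite /twist act1. Qed.
Lemma twistD phi p q t : twist phi (p + q) t = twist phi p t + twist phi q t.
Proof. by rewrite /twist actD. Qed.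
Lemma twistZ phi a p t : twist phi (a *: p) t = a *: twist phi p t.
Proof. by rewrite /twist actZ. Qed.
Lemma twist_dx phi p t : twist phi (opdx F * p) t =
  opdx F * twist phi p t + \sum_(e <- phi) dx e.2 *: twist phi p (t - e.1).
Proof. by rewrite /twist (act_dx (twist_action phi)). Qed.
Lemma twist_dy phi p t : twist phi (opdy F * p) t =
  opdy F * twist phi p t + \sum_(e <- phi) dy e.2 *: twist phi p (t - e.1).
Proof. by rewrite /twist (act_dy (twist_action phi)). Qed.
Lemma twist0 phi t : twist phi 0 t = 0.
Proof. by rewrite -(scale0r (1 : diffop F)) twistZ !scale0r. Qed.

Lemma twist_nil p t : twist [::] p t = if t == 0 then p else 0.
Proof.
elim/diffop_ind: p t => [|p q IHp IHq|a p IH|p IH|p IH] t.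
- by rewrite twist1.
- by rewrite twistD IHp IHq; case: eqP; rewrite ?addr0.
- by rewrite twistZ IH; case: eqP; rewrite ?scaler0.
- by rewrite twist_dx big_nil addr0 IH; case: eqP; rewrite ?mulr0.
- by rewrite twist_dy big_nil addr0 IH; case: eqP; rewrite ?mulr0.
Qed.

Lemma sum_neq0 (T : eqType) (V : nmodType) (r : seq T) (f : T -> V) :
  \sum_(e <- r) f e != 0 -> exists2 e, e \in r & f e != 0.
Proof.
elim: r => [|e r IH]; rewrite ?big_nil ?eqxx // big_cons.
case: (eqVneq (f e) 0) => [->|fe _]; last by exists e; rewrite ?mem_head.
by rewrite add0r => /IH[e' e'r fe']; exists e'; rewrite ?inE ?e'r ?orbT.
Qed.

Definition exponents_in (q : nat) phi :=
  forall e, e \in phi -> exists2 k : nat, (0 < k <= q)%N & e.1 = k%:R / q%:R.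

(** Each derivation contributes 0 or one of the exponents k/q with 0 < k <= q. That only finitely
    many exponents occur is what makes top exponents and least slopes exist. *)
Lemma twist_supp q phi p n t : (0 < q)%N -> exponents_in q phi -> order_le p n ->
  twist phi p t != 0 -> exists2 k : nat, (k <= n * q)%N & t = k%:R / q%:R.
Proof.
move=> q0 Ephi; move: n p; set Q := fun n p => forall t,
  twist phi p t != 0 -> exists2 k : nat, (k <= n * q)%N & t = k%:R / q%:R.
suff: forall n p, order_le p n -> Q n p by move=> H n p /H; apply.
have der n (p p' : diffop F) d D : (forall t, twist phi p' t = D * twist phi p t +
    \sum_(e <- phi) d e.2 *: twist phi p (t - e.1)) -> Q n p -> Q n.+1 p'.
  move=> E Qp u; rewrite E => nz.
  case: (eqVneq (twist phi p u) 0) nz => [->|/Qp[k kn ->] _]; last first.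
    by exists k => //; rewrite mulSn; lia.
  rewrite mulr0 add0r => /sum_neq0[e ephi]; rewrite scaler_eq0 negb_or => /andP[_].
  case/Qp=> k kn /eqP; rewrite subr_eq => /eqP ->.
  have [l /andP[l0 lq] ->] := Ephi e ephi; exists (k + l)%N; first by rewrite mulSn; lia.
  by rewrite natrD mulrDl.
apply: order_ind => [u|n p p' Qp Qp' u|n a p Qp u|n p Qp|n p Qp|n p Qp u].
- rewrite twist1; case: (eqVneq u 0) => [->|_]; last by rewrite eqxx.
  by exists 0%N; rewrite ?mul0r.
- rewrite twistD; case: (eqVneq (twist phi p u) 0) => [->|/Qp //].
  by rewrite add0r; exact: Qp'.
- by rewrite twistZ scaler_eq0 negb_or => /andP[_]; exact: Qp.
- by apply: der Qp => u; exact: twist_dx.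
- by apply: der Qp => u; exact: twist_dy.
- by case/Qp=> k kn ->; exists k => //; rewrite mulSn; lia.
Qed.

Lemma order_le_sum (I : eqType) (r : seq I) (f : I -> diffop F) n :
  (forall i, i \in r -> order_le (f i) n) -> order_le (\sum_(i <- r) f i) n.
Proof.
move=> fn; rewrite big_seq; apply: (big_ind (fun p => order_le p n)) => //.
- exact: order_le0.
- by move=> *; exact: order_leD.
Qed.

Lemma twist_order phi p n t : order_le p n -> order_le (twist phi p t) n.
Proof.
move: n p t; suff: forall n p, order_le p n -> forall t, order_le (twist phi p t) n.
  by move=> H n p t /H; apply.
apply: order_ind => [u|n p p' Qp Qp' u|n a p Qp u|n p Qp u|n p Qp u|n p Qp u].
- by rewrite twist1; case: eqP => _; [exact: order_le1|exact: order_le0].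
- by rewrite twistD; exact: order_leD.
- by rewrite twistZ; exact: order_leZ.
- rewrite twist_dx; apply: order_leD; first exact: order_le_dx.
  by apply: order_le_sum => e _; apply: order_leZ; apply: order_leW (Qp _).
- rewrite twist_dy; apply: order_leD; first exact: order_le_dy.
  by apply: order_le_sum => e _; apply: order_leZ; apply: order_leW (Qp _).
- by apply: order_leW (Qp _).
Qed.

Lemma twist_neg phi p t : (forall e, e \in phi -> 0 < e.1) -> t < 0 -> twist phi p t = 0.
Proof.
move=> phi0; elim/diffop_ind: p t => [|p q IHp IHq|a p IH|p IH|p IH] t t0.
- by rewrite twist1; case: eqP t0 => // ->; rewrite ltxx.
- by rewrite twistD IHp ?IHq ?addr0.
- by rewrite twistZ IH ?scaler0.
- rewrite twist_dx IH // mulr0 add0r big_seq big1 // => e /phi0 e0.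
  rewrite IH ?scaler0 //; lra.
- rewrite twist_dy IH // mulr0 add0r big_seq big1 // => e /phi0 e0.
  rewrite IH ?scaler0 //; lra.
Qed.

Lemma twist_at0 phi p : (forall e, e \in phi -> 0 < e.1) -> twist phi p 0 = p.
Proof.
move=> phi0; elim/diffop_ind: p => [|p q IHp IHq|a p IH|p IH|p IH].
- by rewrite twist1 eqxx.
- by rewrite twistD IHp IHq.
- by rewrite twistZ IH.
- rewrite twist_dx IH big_seq big1 ?addr0 // => e /phi0 e0.
  rewrite twist_neg ?scaler0 //; lra.
- rewrite twist_dy IH big_seq big1 ?addr0 // => e /phi0 e0.
  rewrite twist_neg ?scaler0 //; lra.
Qed.

(* The k-th coefficient, which is ad^k / k! for the commutator with f.         *)
Definition taylor f p (k : nat) : diffop F := twist [:: (1, f)] p k%:R.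

Let single f (e : rat * F) : e \in [:: (1, f)] -> 0 < e.1.
Proof. by rewrite inE => /eqP ->. Qed.

Lemma taylor0 f p : taylor f p 0 = p.
Proof. by rewrite /taylor twist_at0 //; exact: single. Qed.
Lemma taylorD f p q k : taylor f (p + q) k = taylor f p k + taylor f q k.
Proof. exact: twistD. Qed.
Lemma taylorZ f a p k : taylor f (a *: p) k = a *: taylor f p k.
Proof. exact: twistZ. Qed.
Lemma taylor_zero f k : taylor f 0 k = 0.
Proof. exact: twist0. Qed.
Lemma taylor_sum f k I (r : seq I) (g : I -> diffop F) :
  taylor f (\sum_(i <- r) g i) k = \sum_(i <- r) taylor f (g i) k.
Proof.
by apply: (big_morph (fun p => taylor f p k)) => [p q|]; rewrite (taylorD, taylor_zero).
Qed.
Lemma taylor1 f k : taylor f 1 k = if k is 0 then 1 else 0.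
Proof. by rewrite /taylor twist1 pnatr_eq0; case: k. Qed.
Lemma taylor_dx f p k : taylor f (opdx F * p) k =
  opdx F * taylor f p k + (if k is k'.+1 then dx f *: taylor f p k' else 0).
Proof.
rewrite /taylor twist_dx big_seq1 /=; congr (_ + _).
case: k => [|k]; first by rewrite twist_neg ?scaler0 //; exact: single.
by rewrite -natr1 addrK.
Qed.
Lemma taylor_dy f p k : taylor f (opdy F * p) k =
  opdy F * taylor f p k + (if k is k'.+1 then dy f *: taylor f p k' else 0).
Proof.
rewrite /taylor twist_dy big_seq1 /=; congr (_ + _).
case: k => [|k]; first by rewrite twist_neg ?scaler0 //; exact: single.
by rewrite -natr1 addrK.
Qed.

Lemma taylor_big f p n k : order_le p n -> (n < k)%N -> taylor f p k = 0.
Proof.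
move=> pn nk; apply/eqP; apply: contraTT nk => nz; rewrite -leqNgt.
have [|l ln] := twist_supp (q := 1) (phi := [:: (1, f)]) (ltn0Sn 0) _ pn nz.
  by move=> e; rewrite inE => /eqP ->; exists 1%N; rewrite ?divr1.
by rewrite divr1 => /eqP; rewrite eqr_nat => /eqP ->; rewrite muln1 in ln.
Qed.

(** Exponentials of functions commute, so the conjugation by exp(f lambda^s) may be done last; its
    k-th Taylor coefficient comes with lambda^(s k). *)
Lemma twist_rcons phi s f p n t : order_le p n ->
  twist (rcons phi (s, f)) p t = \sum_(k < n.+1) taylor f (twist phi p (t - s * k%:R)) k.
Proof.
move: n p t; suff: forall n p, order_le p n -> order_le p n /\ forall t,
    twist (rcons phi (s, f)) p t = \sum_(k < n.+1) taylor f (twist phi p (t - s * k%:R)) k.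
  by move=> H n p t /H[_]; apply.
have der n (p p' : diffop F) (d : F -> F) D : order_le p n -> order_le p' n.+1 ->
  (forall phi t, twist phi p' t = D * twist phi p t +
      \sum_(e <- phi) d e.2 *: twist phi p (t - e.1)) ->
  (forall r k, taylor f (D * r) k = D * taylor f r k +
     (if k is k'.+1 then d f *: taylor f r k' else 0)) ->
  (forall t, twist (rcons phi (s, f)) p t =
     \sum_(k < n.+1) taylor f (twist phi p (t - s * k%:R)) k) ->
  forall t, twist (rcons phi (s, f)) p' t =
     \sum_(k < n.+2) taylor f (twist phi p' (t - s * k%:R)) k.
  move=> pn p'n Ep ED IH t; rewrite Ep -cats1 big_cat big_seq1 /= !cats1.
  under [RHS]eq_bigr => k _ do rewrite Ep taylorD ED taylor_sum.
  rewrite !big_split /=.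
  have top r m : order_le r n -> taylor f (twist phi r m) n.+1 = 0.
    by move=> rn; apply: (taylor_big _ (twist_order _ _ rn) (ltnSn n)).
  rewrite [X in _ = X + _ + _]big_ord_recr /= top // mulr0 addr0.
  rewrite IH mulr_sumr -[RHS]addrA; congr (_ + _); rewrite addrC; congr (_ + _).
    rewrite [RHS]big_ord_recl /= add0r IH scaler_sumr; apply: eq_bigr => k _.
    rewrite /bump /= add1n; congr (_ *: taylor _ (twist _ _ _) _).
    by rewrite -natr1; ring.
  rewrite [RHS]exchange_big /=; apply: eq_bigr => e _.
  rewrite IH [RHS]big_ord_recr /= taylorZ top // scaler0 addr0.
  rewrite scaler_sumr; apply: eq_bigr => k _; rewrite taylorZ.
  by congr (_ *: taylor _ (twist _ _ _) _); ring.
apply: order_ind => [|n p p' [pn Qp] [pn' Qp']|n a p [pn Qp]|n p [pn Qp]|n p [pn Qp]|n p [pn Qp]].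
- split=> [|t]; first exact: order_le1.
  by rewrite big_ord1 taylor0 mulr0 subr0 !twist1.
- split=> [|t]; first exact: order_leD.
  by rewrite twistD Qp Qp' -big_split; apply: eq_bigr => k _; rewrite twistD taylorD.
- split=> [|t]; first exact: order_leZ.
  by rewrite twistZ Qp scaler_sumr; apply: eq_bigr => k _; rewrite twistZ taylorZ.
- split=> [|t]; first exact: order_le_dx.
  apply: (der n p _ (@dx F) (opdx F)) => //; first exact: order_le_dx.
    by move=> *; exact: twist_dx.
  exact: taylor_dx.
- split=> [|t]; first exact: order_le_dy.
  apply: (der n p _ (@dy F) (opdy F)) => //; first exact: order_le_dy.
    by move=> *; exact: twist_dy.
  exact: taylor_dy.
- split=> [|t]; first exact: order_leW pn.
  by rewrite Qp [RHS]big_ord_recr /= (taylor_big _ (twist_order _ _ pn) (ltnSn n)) ?addr0.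
Qed.

(* Differentiating E^-1 p E in lambda gives its commutator with the derivative *)
(* of \sum_j f_j lambda^(s_j).                                                 *)
Lemma twist_euler (rho : {additive rat -> F}) phi p t :
    (forall k, dx (rho k) = 0) -> (forall k, dy (rho k) = 0) ->
  rho t *: twist phi p t = \sum_(e <- phi) rho e.1 *: taylor e.2 (twist phi p (t - e.1)) 1.
Proof.
move=> dxrho dyrho.
have der (r0 p' : diffop F) (d : F -> F) D :
  (forall t, twist phi p' t = D * twist phi r0 t +
      \sum_(e <- phi) d e.2 *: twist phi r0 (t - e.1)) ->
  (forall a r, D * (a *: r) = d a *: r + a *: (D * r)) ->
  (forall k, d (rho k) = 0) ->
  (forall f r, taylor f (D * r) 1 = D * taylor f r 1 + d f *: taylor f r 0) ->
  (forall t, rho t *: twist phi r0 t =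
     \sum_(e <- phi) rho e.1 *: taylor e.2 (twist phi r0 (t - e.1)) 1) ->
  forall t, rho t *: twist phi p' t =
     \sum_(e <- phi) rho e.1 *: taylor e.2 (twist phi p' (t - e.1)) 1.
  move=> Ep DZ drho ED IH u; rewrite Ep scalerDr.
  have -> : rho u *: (D * twist phi r0 u) = D * (rho u *: twist phi r0 u).
    by rewrite DZ drho scale0r add0r.
  rewrite IH mulr_sumr scaler_sumr.
  under [RHS]eq_bigr => e _ do rewrite Ep taylorD ED taylor0 taylor_sum !scalerDr.
  rewrite !big_split /= -addrA; congr (_ + _).
    by apply: eq_bigr => e _; rewrite DZ drho scale0r add0r.
  (* Additivity of [rho] splits [u] into [e.1] and [u - e.1]: this is the Leibniz rule for lambda
     d/dlambda. *)
  have -> : \sum_(e <- phi) rho u *: (d e.2 *: twist phi r0 (u - e.1)) =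
    \sum_(e <- phi) rho e.1 *: (d e.2 *: twist phi r0 (u - e.1)) +
    \sum_(e <- phi) d e.2 *: (rho (u - e.1) *: twist phi r0 (u - e.1)).
    rewrite -big_split; apply: eq_bigr => e _ /=.
    by rewrite !scalerA -scalerDl raddfB /=; congr (_ *: _); ring.
  congr (_ + _).
  under [LHS]eq_bigr => e _ do rewrite IH scaler_sumr.
  rewrite exchange_big /=; apply: eq_bigr => e _; rewrite scaler_sumr.
  apply: eq_bigr => e' _; rewrite taylorZ !scalerA mulrC; congr (_ *: taylor _ (twist _ _ _) _).
  by ring.
elim/diffop_ind: p t => [|p q IHp IHq|a p IH|p IH|p IH] t.
- rewrite twist1; case: (eqVneq t 0) => [->|t0].
    rewrite raddf0 scale0r big1 // => e _; rewrite twist1; case: eqP => _.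
      by rewrite taylor1 scaler0.
    by rewrite taylor_zero scaler0.
  rewrite scaler0 big1 // => e _; rewrite twist1; case: eqP => _.
    by rewrite taylor1 scaler0.
  by rewrite taylor_zero scaler0.
- rewrite twistD scalerDr IHp IHq -big_split; apply: eq_bigr => e _ /=.
  by rewrite twistD taylorD scalerDr.
- rewrite twistZ scalerA mulrC -scalerA IH scaler_sumr; apply: eq_bigr => e _ /=.
  by rewrite twistZ taylorZ !scalerA mulrC.
- apply: (der p _ (@dx F) (opdx F)) => //.
  + exact: twist_dx.
  + by case: (mul_action F).
  + by move=> f r; rewrite taylor_dx.
- apply: (der p _ (@dy F) (opdy F)) => //.
  + exact: twist_dy.
  + by case: (mul_action F).
  + by move=> f r; rewrite taylor_dy.
Qed.


(** The embedding of the rationals into [F]. Integers have derivative 0, hence so do their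
    quotients. It turns the exponents in [twist_euler] into scalars. *)
Lemma rat_additive : [pchar F] =i pred0 -> exists rho : {additive rat -> F},
  [/\ rho 1 = 1, forall k, dx (rho k) = 0 & forall k, dy (rho k) = 0].
Proof.
move=> /pcharf0P char0.
have nz (k : int) : k != 0 -> k%:~R != 0 :> F.
  case: k => k k0; first by rewrite -[_%:~R]/(k%:R) char0.
  by rewrite NegzE rmorphN oppr_eq0 /= -[_%:~R]/(k.+1%:R) char0.
have dnz (r : rat) : (denq r)%:~R != 0 :> F by apply: nz; exact: denq_neq0.
pose rho (r : rat) : F := (numq r)%:~R / (denq r)%:~R.
have rhoE (r : rat) (m n : int) : n != 0 -> r = m%:~R / n%:~R -> rho r = m%:~R / n%:~R.
  move=> n0 E; apply/eqP; rewrite /rho eqr_div ?nz // -!rmorphM /=; apply/eqP; congr (_ %:~R).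
  apply: (@intr_inj rat); rewrite !rmorphM /=; apply/eqP.
  by rewrite -eqr_div ?intr_eq0 ?denq_neq0 // divq_num_den E.
have rhoB : zmod_morphism rho.
  move=> r1 r2; rewrite (rhoE (r1 - r2) (numq r1 * denq r2 - numq r2 * denq r1) (denq r1 * denq r2)).
  - by rewrite /rho !rmorphB !rmorphM /=; field; rewrite !dnz.
  - by rewrite mulf_neq0 ?denq_neq0.
  - rewrite -{1}(divq_num_den r1) -{1}(divq_num_den r2) !rmorphB !rmorphM /=; field.
    by rewrite !intr_eq0 !denq_neq0.
have der (d : {additive F -> F}) : (forall a b, d (a * b) = d a * b + a * d b) ->
    forall k, d (rho k) = 0.
  move=> dM k; have d1 : d 1 = 0.
    by apply: (addrI (d 1)); rewrite addr0 -{3}[1]mulr1 dM mulr1 mul1r.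
  have dz (z : int) : d z%:~R = 0 by rewrite raddfMz d1 mul0rz.
  have: d ((denq k)%:~R * rho k) = 0 by rewrite /rho mulrC divfK.
  rewrite dM dz mul0r add0r => /eqP; rewrite mulf_eq0 (negPf (dnz k)) /=.
  by move/eqP.
pose mx := GRing.isZmodMorphism.Build rat F rho rhoB.
pose R : {additive rat -> F} := HB.pack rho mx.
exists R; split; rewrite /=.
- by rewrite /rho divr1.
- by apply: (der (@dx F)); exact: dxM.
- by apply: (der (@dy F)); exact: dyM.
Qed.
End Twist.

(** * Taylor's formula for symbols, and Newton polygons *)

Section Shift.
Variable F : diffFieldType.
Implicit Types (a b f : F) (p : diffop F) (phi : seq (rat * F)) (s t : rat).
Implicit Types (r : {poly {poly F}}) (v : rat -> diffop F).

(** Each commutator with [f] lowers the order by one. *)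
Lemma taylor_coef f p d k i j :
  order_le p d -> (d < i + j + k)%N -> opcoef (taylor f p k) i j = 0.
Proof.
move: d p k i j; suff: forall d p, order_le p d -> forall k i j,
    (d < i + j + k)%N -> opcoef (taylor f p k) i j = 0.
  by move=> H d p k i j /H; apply.
apply: order_ind => [k i j|n p p' Qp Qp' k i j ij|n a p Qp k i j ij|n p Qp k i j ij|n p Qp k i j ij|n p Qp k i j ij].
- rewrite taylor1; case: k => [|k] ij; last by rewrite opcoef0.
  by apply: (@order_le1 _ 0%N); lia.
- by rewrite taylorD opcoefD Qp ?Qp' ?addr0.
- by rewrite taylorZ opcoefZ Qp ?mulr0.
- rewrite taylor_dx opcoefD opcoef_dx Qp ?raddf0 ?add0r; last lia.
  rewrite (_ : (if i is i'.+1 then _ else _) = 0) ?add0r; last first.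
    by case: i ij => // i ij; apply: Qp; lia.
  by case: k ij => [|k] ij; rewrite ?opcoef0 // opcoefZ Qp ?mulr0 //; lia.
- rewrite taylor_dy opcoefD opcoef_dy Qp ?raddf0 ?add0r; last lia.
  rewrite (_ : (if j is j'.+1 then _ else _) = 0) ?add0r; last first.
    by case: j ij => // j ij; apply: Qp; lia.
  by case: k ij => [|k] ij; rewrite ?opcoef0 // opcoefZ Qp ?mulr0 //; lia.
- by apply: Qp; lia.
Qed.

Lemma taylor_coef_lt f p m k i j :
    (forall i' j', (m <= i' + j')%N -> opcoef p i' j' = 0) -> (m <= i + j + k)%N ->
  opcoef (taylor f p k) i j = 0.
Proof.
case: m => [|m] pm ij; last by apply: (@taylor_coef f p m) => // i' j'; exact: pm.
have -> : p = 0 by apply: opP => i' j'; rewrite pm ?opcoef0.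
by rewrite taylor_zero opcoef0.
Qed.

(** On principal symbols, the commutator with [f] is the directional derivative f_x d/dX + f_y
    d/dY. *)
Lemma taylor1_coef f p d i j : order_le p d -> (i + j).+1 = d ->
  opcoef (taylor f p 1) i j = dx f * i.+1%:R * opcoef p i.+1 j +
                             dy f * j.+1%:R * opcoef p i j.+1.
Proof.
move: d p i j; suff: forall d p, order_le p d -> order_le p d /\ forall i j,
    (i + j).+1 = d -> opcoef (taylor f p 1) i j = dx f * i.+1%:R * opcoef p i.+1 j +
                             dy f * j.+1%:R * opcoef p i j.+1.
  by move=> H d p i j /H[_]; apply.
apply: order_ind => [|n p p' [pn Qp] [pn' Qp']|n a p [pn Qp]|n p [pn Qp]|n p [pn Qp]|n p [pn Qp]].
- split=> [|i j]; first exact: order_le1.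
  lia.
- split=> [|i j ij]; first exact: order_leD.
  by rewrite taylorD !opcoefD Qp ?Qp' //; ring.
- split=> [|i j ij]; first exact: order_leZ.
  by rewrite taylorZ !opcoefZ Qp //; ring.
- split=> [|i j [ij]]; first exact: order_le_dx.
  rewrite taylor_dx taylor0 opcoefD opcoefZ !opcoef_dx (taylor_coef _ pn); last lia.
  rewrite (pn i.+1 j) ?(pn i j.+1) ?raddf0 ?add0r; try lia.
  case: i ij => [|i] ij; first by rewrite add0r; ring.
  by rewrite Qp; [rewrite -?natr1; ring|lia].
- split=> [|i j [ij]]; first exact: order_le_dy.
  rewrite taylor_dy taylor0 opcoefD opcoefZ !opcoef_dy (taylor_coef _ pn); last lia.
  rewrite (pn i.+1 j) ?(pn i j.+1) ?raddf0 ?add0r; try lia.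
  case: j ij => [|j] ij; first by rewrite add0r; ring.
  by rewrite Qp; [rewrite -?natr1; ring|lia].
- split=> [|i j [ij]]; first exact: order_leW pn.
  by rewrite (taylor_coef _ pn) ?pn ?mulr0 ?addr0 //; lia.
Qed.

Definition shift2 a b r : {poly {poly F}} :=
  (map_poly (fun c => c \Po ('X + b%:P)) r) \Po ('X + a%:P%:P).

Lemma shift2D a b r r' : shift2 a b (r + r') = shift2 a b r + shift2 a b r'.
Proof. by rewrite /shift2 rmorphD raddfD. Qed.
Lemma shift2M a b r r' : shift2 a b (r * r') = shift2 a b r * shift2 a b r'.
Proof. by rewrite /shift2 rmorphM rmorphM. Qed.
Lemma shift2C a b c : shift2 a b c%:P%:P = c%:P%:P.
Proof. by rewrite /shift2 map_polyC /= !comp_polyC. Qed.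
Lemma shift2X a b : shift2 a b 'X = 'X + a%:P%:P.
Proof. by rewrite /shift2 map_polyX comp_polyX. Qed.
Lemma shift2Y a b : shift2 a b 'X%:P = 'X%:P + b%:P%:P.
Proof. by rewrite /shift2 map_polyC /= comp_polyX comp_polyC polyCD. Qed.
Lemma shift2_sum a b I (P : pred I) (l : seq I) (g : I -> {poly {poly F}}) :
  shift2 a b (\sum_(i <- l | P i) g i) = \sum_(i <- l | P i) shift2 a b (g i).
Proof.
apply: (big_morph (shift2 a b)) => [r r'|]; first exact: shift2D.
by rewrite -[0 in LHS]polyC0 -polyC0 shift2C !polyC0.
Qed.
Lemma shift2_exp a b r n : shift2 a b (r ^+ n) = shift2 a b r ^+ n.
Proof.
elim: n => [|n IH]; last by rewrite !exprS shift2M IH.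
by rewrite !expr0 -[1 in LHS]polyC1 -polyC1 shift2C !polyC1.
Qed.

Notation sym := (wform 1 1).

Lemma coef_sym d p i j : (sym d p)`_i`_j = if (i + j == d)%N then opcoef p i j else 0.
Proof. by rewrite coef_wform !mul1n. Qed.

(** Taylor's formula: translating the symbol of [p] by the gradient of [f] gives, in degree d - k,
    the part of order d - k of the k-th Taylor coefficient, which is its top part. *)
Lemma coef_shift_sym f p d i j : order_le p d ->
  (shift2 (dx f) (dy f) (sym d p))`_i`_j =
  if (i + j <= d)%N then opcoef (taylor f p (d - (i + j))) i j else 0.
Proof.
move: d p i j; suff: forall d p, order_le p d -> order_le p d /\ forall i j,
  (shift2 (dx f) (dy f) (sym d p))`_i`_j =
    if (i + j <= d)%N then opcoef (taylor f p (d - (i + j))) i j else 0.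
  by move=> H d p i j /H[_]; apply.
apply: order_ind => [|n p p' [pn Qp] [pn' Qp']|n a p [pn Qp]|n p [pn Qp]|n p [pn Qp]|n p [pn Qp]].
- split=> [|i j]; first exact: order_le1.
  rewrite (_ : sym 0 1 = 1%:P%:P); last first.
    apply/polyP => k; apply/polyP => l; rewrite coef_sym opcoef1 !coefC.
    by case: k => [|k] /=; rewrite ?coefC ?coef0 ?mulr1n; case: l.
  rewrite shift2C taylor1 sub0n coefC.
  by case: i j => [|i] [|j] /=; rewrite ?coefC ?coef0 ?opcoef1 ?addn0 ?addSn.
- split=> [|i j]; first exact: order_leD.
  rewrite wformD shift2D coefD coefD Qp Qp' taylorD opcoefD.
  by case: ifP; rewrite ?addr0.
- split=> [|i j]; first exact: order_leZ.
  rewrite wformZ shift2M shift2C !coefCM Qp taylorZ opcoefZ.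
  by case: ifP; rewrite ?mulr0.
- split=> [|i j]; first exact: order_le_dx.
  have /(wform_dx (ltn0Sn 0))[_] := (order_le_weight p n).1 pn.
  rewrite addn1 => ->; rewrite shift2M shift2X mulrDl coefD coefD coefXM coefCM coefCM.
  rewrite taylor_dx opcoefD opcoef_dx (Qp i j).
  case: (leqP (i + j) n.+1) => ij; last first.
    rewrite (_ : (i + j <= n)%N = false) ?mulr0 ?addr0; last by apply/negbTE; lia.
    by case: i ij => [|i] ij /=; rewrite ?coef0 // Qp ifN //; lia.
  rewrite (@taylor_coef f p n (n.+1 - (i + j)) i j) ?raddf0 ?add0r //; last lia.
  congr (_ + _).
    case: i ij => [|i] ij /=; rewrite ?coef0 // Qp ifT; last lia.
    by congr (opcoef (taylor _ _ _) _ _); lia.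
  case: (leqP (i + j) n) => ij'; first by rewrite subSn // opcoefZ.
  by rewrite (_ : n.+1 - (i + j) = 0)%N ?opcoef0 ?mulr0 //; lia.
- split=> [|i j]; first exact: order_le_dy.
  have /(wform_dy (ltn0Sn 0))[_] := (order_le_weight p n).1 pn.
  rewrite addn1 => ->; rewrite shift2M shift2Y mulrDl coefD coefD coefCM coefXM coefCM coefCM.
  rewrite taylor_dy opcoefD opcoef_dy (Qp i j).
  case: (leqP (i + j) n.+1) => ij; last first.
    rewrite (_ : (i + j <= n)%N = false) ?mulr0 ?addr0; last by apply/negbTE; lia.
    by case: j ij => [|j] ij //=; rewrite Qp ifN //; lia.
  rewrite (@taylor_coef f p n (n.+1 - (i + j)) i j) ?raddf0 ?add0r //; last lia.
  congr (_ + _).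
    case: j ij => [|j] ij //=; rewrite Qp ifT; last lia.
    by congr (opcoef (taylor _ _ _) _ _); lia.
  case: (leqP (i + j) n) => ij'; first by rewrite subSn // opcoefZ.
  by rewrite (_ : n.+1 - (i + j) = 0)%N ?opcoef0 ?mulr0 //; lia.
- split=> [|i j]; first exact: order_leW pn.
  rewrite (_ : sym n.+1 p = 0); last first.
    by apply: wform_small (ltnSn n); apply/order_le_weight.
  rewrite -polyC0 -polyC0 shift2C !polyC0 !coef0.
  by case: leqP => // ij; rewrite (taylor_coef _ pn) //; lia.
Qed.

(* Newton polygon data: all terms lambda^t d_x^i d_y^j of v lie on or below    *)
(* the line t + s (i + j) = t0, and initial_form collects those on it.         *)
Definition below_line v s t0 :=
  forall t i j, opcoef (v t) i j != 0 -> t + s * (i + j)%:R <= t0.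

Definition initial_form n v s t0 : {poly {poly F}} :=
  \sum_(d < n.+1) sym d (v (t0 - s * d%:R)).

Lemma coef_initial_form n v s t0 i j : (forall t, order_le (v t) n) ->
  (initial_form n v s t0)`_i`_j = opcoef (v (t0 - s * (i + j)%:R)) i j.
Proof.
move=> vn; rewrite /initial_form coef_sum coef_sum.
case: (leqP (i + j) n) => ij; last first.
  rewrite big1 ?vn // => d _; rewrite coef_sym; case: eqP => // e.
  by have := ltn_ord d; lia.
rewrite (bigD1 (Ordinal (ij : (i + j < n.+1)%N))) //= big1 ?addr0; last first.
  move=> d /eqP dij; rewrite coef_sym; case: eqP => // e; case: dij.
  exact: val_inj.
by rewrite coef_sym eqxx.
Qed.

Lemma below_line_order v s t0 d : 0 < s -> below_line v s t0 ->
  order_le (v (t0 - s * d%:R)) d.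
Proof.
move=> s0 vl i j ij; apply/eqP; apply: contraTT ij => /vl le.
have : s * (i + j)%:R <= s * d%:R by lra.
by rewrite ler_pM2l // ler_nat -leqNgt.
Qed.

Section TwistStep.
Variables (phi : seq (rat * F)) (u : diffop F) (n : nat) (s t0 : rat) (f : F).
Hypotheses (un : order_le u n) (s0 : 0 < s) (ul : below_line (twist phi u) s t0).

(** Every factor lambda^s gained costs one order, so points move along lines of slope [s] or fall
    below them. *)
Lemma below_line_rcons : below_line (twist (rcons phi (s, f)) u) s t0.
Proof.
move=> t i j; apply: contraNT; rewrite -ltNge => lt; apply/eqP.
rewrite (twist_rcons _ _ _ _ un) opcoef_sum big1 // => k _.
apply: (@taylor_coef_lt _ _ (i + j + k)) => // i' j' ij.
apply/eqP; apply: contraTT ij => /ul; rewrite -ltnNge => le.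
have : s * (i' + j')%:R < s * (i + j + k)%:R by rewrite [X in _ < _ * X]natrD; lra.
by rewrite ltr_pM2l // ltr_nat.
Qed.

(** On the line only the top parts of the Taylor coefficients survive, and by [coef_shift_sym] they
    add up to a translate of the initial form. *)
Lemma initial_form_rcons :
  initial_form n (twist (rcons phi (s, f)) u) s t0 =
  shift2 (dx f) (dy f) (initial_form n (twist phi u) s t0).
Proof.
apply/polyP => i; apply/polyP => j.
rewrite coef_initial_form; last by move=> t; exact: twist_order.
rewrite /initial_form shift2_sum coef_sum coef_sum.
under [RHS]eq_bigr => d _ do rewrite (coef_shift_sym f _ _ (@below_line_order _ _ _ d s0 ul)).
rewrite (twist_rcons _ _ _ _ un) opcoef_sum.
rewrite -(big_mkord xpredT (fun k => opcoef (taylor f (twist phi u (t0 - s * (i + j)%:R - s * k%:R)) k) i j)).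
rewrite -(big_mkord xpredT (fun d => if (i + j <= d)%N then
   opcoef (taylor f (twist phi u (t0 - s * d%:R)) (d - (i + j))) i j else 0)).
case: (leqP (i + j) n) => ij; last first.
  rewrite !big_nat big1; last first.
    by move=> k kn; rewrite (taylor_coef _ (twist_order _ _ un)) //; lia.
  by rewrite big1 // => d dn; rewrite ifN //; lia.
rewrite [RHS](big_cat_nat (n := i + j)) //=; last lia.
rewrite [X in _ = X + _]big_nat [X in _ = X + _]big1 ?add0r; last first.
  by move=> d dn; rewrite ifN //; lia.
have shift m (g : nat -> F) :
    \sum_(m <= d < n.+1) g d = \sum_(0 <= k < n.+1 - m) g (k + m)%N.
  by rewrite -{1}[m]add0n big_addn.
rewrite (shift (i + j)%N).
rewrite (big_cat_nat (n := (n.+1 - (i + j))%N)) //=; last lia.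
rewrite [X in _ + X]big_nat [X in _ + X]big1 ?addr0; last first.
  by move=> k kn; rewrite (taylor_coef _ (twist_order _ _ un)) //; lia.
apply: eq_bigr => k _; rewrite leq_addl addnK; congr (opcoef (taylor _ (twist _ _ _) _) _ _).
by rewrite natrD; ring.
Qed.
End TwistStep.

End Shift.

Section LinearForm.
Variable R : comNzRingType.
Implicit Types (e : {poly R}) (kappa c : R).

Definition lin_form kappa : {poly {poly R}} := 'X - (kappa%:P * 'X)%:P.

(** The bivariate polynomial e(X - kappa Y). *)
Definition at_lin_form kappa e : {poly {poly R}} :=
  (map_poly (fun c => c%:P%:P) e).[lin_form kappa].

Lemma coef_lin_form_exp kappa d i j :
  (lin_form kappa ^+ d)`_i`_j =
  if (i + j == d)%N then (- kappa) ^+ j *+ 'C(d, j) else 0.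
Proof.
rewrite /lin_form exprDn coef_sum coef_sum.
have E (k : 'I_d.+1) : ('X ^+ (d - k) * (- (kappa%:P * 'X)%:P) ^+ k *+ 'C(d, k))`_i`_j =
    if (i == d - k)%N && (j == k)%N then (- kappa) ^+ k *+ 'C(d, k) else 0 :> R.
  rewrite !coefMn -polyCN -rmorphXn /= coefMC coefXn -mulNr exprMn -rmorphN -rmorphXn /=.
  case: (i == _) => /=; last by rewrite mul0r coef0 mul0rn.
  by rewrite mul1r coefCM coefXn; case: (j == _); rewrite ?mulr1 ?mulr0 ?mul0rn.
under eq_bigr => k _ do rewrite E.
case: eqP => ij.
  have jd : (j < d.+1)%N by lia.
  rewrite (bigD1 (Ordinal jd)) //= big1 ?addr0.
    by rewrite eqxx (_ : _ == _) //; lia.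
  by move=> k /eqP kj; case: andP => // -[_ /eqP jk]; case: kj; apply: val_inj.
rewrite big1 // => k _; case: andP => // -[/eqP ik /eqP jk]; case: ij.
by have := ltn_ord k; lia.
Qed.

Lemma coef_at_lin_form kappa e i j : (at_lin_form kappa e)`_i`_j =
  e`_(i + j) * (- kappa) ^+ j *+ 'C(i + j, j).
Proof.
have inj : injective (fun c : R => c%:P%:P) by move=> c c' /polyC_inj/polyC_inj.
rewrite /at_lin_form horner_coef size_map_inj_poly ?polyC0 // coef_sum coef_sum.
under eq_bigr => d _ do rewrite coef_map_id0 ?polyC0 // coefCM coefCM coef_lin_form_exp.
case: (ltnP (i + j) (size e)) => ij.
  rewrite (bigD1 (Ordinal ij)) //= eqxx mulrnAr big1 ?addr0 // => d /eqP dij.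
  by case: eqP => [E|_]; rewrite ?mulr0 //; case: dij; apply: val_inj.
rewrite nth_default // mul0r mul0rn big1 // => d _; case: eqP => [E|]; rewrite ?mulr0 //.
by have := ltn_ord d; lia.
Qed.

End LinearForm.

(** A translation by (a, b) moves X - kappa Y by the scalar a - kappa b, which reduces the work on
    an edge to one variable. *)
Lemma shift2_lin_form (F : diffFieldType) (a b kappa : F) e :
  shift2 a b (at_lin_form kappa e) = at_lin_form kappa (e \Po ('X + (a - kappa * b)%:P)).
Proof.
have lin : shift2 a b (lin_form kappa) = lin_form kappa + (a - kappa * b)%:P%:P.
  have -> : lin_form kappa = 'X + (- kappa)%:P%:P * 'X%:P.
    by rewrite /lin_form !polyCN mulNr -!polyCM.
  rewrite shift2D shift2X shift2M shift2C shift2Y !(polyCB, polyCM, polyCN).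
  by ring.
rewrite /at_lin_form.
have -> : (fun c : F => c%:P%:P) = (polyC \o polyC : {rmorphism F -> {poly {poly F}}}) by [].
rewrite map_comp_poly horner_comp rmorphD /= map_polyX map_polyC /= hornerD hornerX hornerC.
rewrite !horner_coef shift2_sum -lin; apply: eq_bigr => i _.
by rewrite shift2M shift2_exp coef_map /= shift2C.
Qed.

(** * The Newton-Puiseux construction *)

Section NewtonPuiseux.
Variables (F : diffFieldType) (char0 : [pchar F] =i pred0).
Variables (u : diffop F) (n : nat) (un : order_le u n).
Implicit Types (phi tail : seq (rat * F)) (s t : rat).

Let nat_neq0 (k : nat) : k.+1%:R != 0 :> F.
Proof. by rewrite ((pcharf0P F).1 char0). Qed.

(* Then the top coefficient of a series H with u H = 0 satisfies a linear      *)
(* differential equation of positive order, hence can be chosen nonzero.       *)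
Definition nonscalar_top phi := exists t0,
  (forall t, t0 < t -> twist phi u t = 0) /\
  exists i j, (0 < i + j)%N /\ opcoef (twist phi u t0) i j != 0.

(* The pure power d_x^m lies on the edge of slope s, and no term of order less *)
(* than m does.                                                                *)
Definition newton_state phi s t0 m :=
  [/\ below_line (twist phi u) s t0,
      opcoef (twist phi u (t0 - s * m%:R)) m 0 != 0
    & forall i j, (i + j < m)%N -> opcoef (twist phi u (t0 - s * (i + j)%:R)) i j = 0].

Lemma top_exponent q phi t : (0 < q)%N -> exponents_in q phi -> twist phi u t != 0 ->
  exists k : nat, twist phi u (k%:R / q%:R) != 0 /\
    forall t', k%:R / q%:R < t' -> twist phi u t' = 0.
Proof.
move=> q0 Ephi vt; pose P k := twist phi u (k%:R / q%:R) != 0.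
have exP : exists k, P k.
  by have [k _ E] := twist_supp q0 Ephi un vt; exists k; rewrite /P -E.
have bP k : P k -> (k <= n * q)%N.
  move=> Pk; have [l ln /eqP] := twist_supp q0 Ephi un Pk.
  by rewrite eqr_div ?pnatr_eq0 -?lt0n // -!natrM eqr_nat eqn_pmul2r // => /eqP ->.
case: (ex_maxnP exP bP) => k Pk max; exists k; split=> // t' lt.
apply/eqP; apply: contraTT lt => nz; have [l _ E] := twist_supp q0 Ephi un nz.
rewrite E -leNgt ler_pM2r ?invr_gt0 ?ltr0n // ler_nat; apply: max.
by rewrite /P -E.
Qed.

(** The edge that leaves the point of order 0 at height [t1]. Its slope is the minimum of (t1 -
    t)/(i + j) over the finitely many points of positive order: minimality keeps all points on or
    below the line, and a minimizer lies on it. *)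
Lemma min_slope q phi t1 t i j : (0 < q)%N -> exponents_in q phi ->
    (forall t', t1 < t' -> twist phi u t' = 0) ->
    (0 < i + j)%N -> opcoef (twist phi u t) i j != 0 ->
  exists s, [/\ below_line (twist phi u) s t1, s * (i + j)%:R <= t1 - t &
    exists i' j', (0 < i' + j')%N /\
      opcoef (twist phi u (t1 - s * (i' + j')%:R)) i' j' != 0].
Proof.
move=> q0 Ephi max ij0 c0; pose v := twist phi u.
have supp t' i' j' : opcoef (v t') i' j' != 0 ->
    exists k : 'I_(n * q).+1, exists a b : 'I_n.+1, [/\ t' = k%:R / q%:R, i' = a & j' = b].
  move=> c; have vt : v t' != 0 by apply: contraNneq c => ->; rewrite opcoef0.
  have [k kn E] := twist_supp q0 Ephi un vt.
  have ij : (i' + j' <= n)%N.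
    by rewrite leqNgt; apply: contra c => lt; rewrite (twist_order _ _ un).
  have kb : (k < (n * q).+1)%N by [].
  have ib : (i' < n.+1)%N by lia.
  have jb : (j' < n.+1)%N by lia.
  by exists (Ordinal kb), (Ordinal ib), (Ordinal jb).
pose I := ('I_(n * q).+1 * ('I_n.+1 * 'I_n.+1))%type.
pose P (x : I) := (0 < x.2.1 + x.2.2)%N && (opcoef (v ((x.1 : nat)%:R / q%:R)) x.2.1 x.2.2 != 0).
pose M (x : I) : rat := (t1 - (x.1 : nat)%:R / q%:R) / (x.2.1 + x.2.2)%:R.
have [k0 [a0 [b0 [tE iE jE]]]] := supp _ _ _ c0.
have P0 : P (k0, (a0, b0)) by rewrite /P /= -iE -jE ij0 -tE.
case: (arg_minP M P0) => -[k [a b]] /andP[/= ab cab] min.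
pose s := M (k, (a, b)); have abq : (a + b)%:R != 0 :> rat by rewrite pnatr_eq0 -lt0n.
have below t' i' j' : opcoef (v t') i' j' != 0 -> t' + s * (i' + j')%:R <= t1.
  move=> c; have [k1 [a1 [b1 [tE' iE' jE']]]] := supp _ _ _ c.
  rewrite tE' in c *; case: (posnP (i' + j')) => [->|ij'].
    rewrite mulr0 addr0 leNgt; apply: contra c => lt.
    by rewrite /v max // opcoef0.
  have /min : P (k1, (a1, b1)) by rewrite /P /= -iE' -jE' ij'.
  rewrite -/s /M /= -iE' -jE' ler_pdivlMr ?ltr0n // => le; lra.
exists s; split=> //.
  by have := below _ _ _ c0; lra.
exists a, b; split=> //.
by rewrite /s /M /= divfK // opprB addrC subrK.
Qed.


Variables (f1 : F) (f1y : dy f1 != 0).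
Let kappa := dx f1 / dy f1.

(** Compare coefficients in [twist_euler] at exponent 1 above the point of order i + j + 1 on the
    edge. Since [s] and the exponents in [tail] are below 1, all contributions except the commutator
    with [f1] come from above the line and vanish. So f_x d/dX + f_y d/dY, with f = [f1], kills the
    initial form. *)
Lemma edge_relation tail s t0 i j :
    (forall e, e \in tail -> e.1 < 1) -> 0 < s < 1 ->
    below_line (twist ((1, f1) :: tail) u) s t0 ->
    let c i j := opcoef (twist ((1, f1) :: tail) u (t0 - s * (i + j)%:R)) i j in
  j.+1%:R * c i j.+1 = - kappa * i.+1%:R * c i.+1 j.
Proof.
move=> tail1 /andP[s0 s1] vl c; pose v := twist ((1, f1) :: tail) u.
have [rho [rho1 rhox rhoy]] := rat_additive char0.
pose d := (i + j).+1; pose t := t0 - s * d%:R.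
have vanish t' i' j' : t0 < t' + s * (i' + j')%:R -> opcoef (v t') i' j' = 0.
  by move=> lt; apply/eqP; apply: contraTT lt => /vl; rewrite -leNgt.
have := congr1 (fun p => opcoef p i j) (twist_euler ((1, f1) :: tail) u (t + 1) rhox rhoy).
rewrite /= opcoefZ vanish ?mulr0; last first.
  by rewrite /t /d -natr1; lra.
rewrite big_cons /= rho1 scale1r opcoefD opcoef_sum big_seq big1 ?addr0; last first.
  move=> e /tail1 e1; rewrite opcoefZ (@taylor_coef_lt _ _ _ d) ?mulr0 ?addn1 //.
  move=> i' j' ij; apply: vanish; rewrite /t.
  have : s * d%:R <= s * (i' + j')%:R by rewrite ler_pM2l // ler_nat.
  lra.
rewrite addrK (@taylor1_coef _ _ _ d) //; last first.
  exact: (@below_line_order _ _ _ _ d s0 vl).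
rewrite /c addnS addSn -/d -/t -/v /kappa => /eqP.
rewrite eq_sym addrC addr_eq0 => /eqP E.
apply: (mulfI f1y); rewrite mulrA E; field.
exact: f1y.
Qed.

(** A form killed by that directional derivative depends on X - kappa Y only, so its pure powers of
    X determine it. *)
Lemma edge_form tail s t0 :
    (forall e, e \in tail -> e.1 < 1) -> 0 < s < 1 ->
    below_line (twist ((1, f1) :: tail) u) s t0 ->
  initial_form n (twist ((1, f1) :: tail) u) s t0 =
  at_lin_form kappa
    (\poly_(d < n.+1) opcoef (twist ((1, f1) :: tail) u (t0 - s * d%:R)) d 0).
Proof.
move=> tail1 s01 vl; apply/polyP => i; apply/polyP => j.
rewrite coef_initial_form => [|t]; last exact: twist_order.
rewrite coef_at_lin_form coef_poly.
pose c i j := opcoef (twist ((1, f1) :: tail) u (t0 - s * (i + j)%:R)) i j.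
have cE : c i j = c (i + j)%N 0%N * (- kappa) ^+ j *+ 'C(i + j, j).
  elim: j i => [|j IH] i; first by rewrite addn0 expr0 mulr1 bin0.
  apply: (mulfI (nat_neq0 j)); rewrite (edge_relation _ _ tail1 s01 vl) -/(c _ _) IH.
  rewrite addSnnS -[_ *+ 'C(_, j)]mulr_natr -[_ *+ 'C(_, j.+1)]mulr_natr exprS.
  have := mul_bin_left (i + j.+1) j; rewrite -addSnnS addnK addSnnS => /(congr1 (fun k => k%:R : F)).
  rewrite !natrM => E.
  transitivity (c (i + j.+1)%N 0%N * (- kappa) ^+ j * (- kappa) * (i.+1%:R * 'C(i + j.+1, j)%:R)); first by ring.
  by rewrite -E; ring.
rewrite -/(c i j) cE /c addn0; case: ltnP => // nij.
by rewrite (twist_order _ _ un) // addn0.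
Qed.

Hypothesis closedF : forall e : {poly F}, (1 < size e)%N -> exists x, root e x.
Hypothesis transport : forall c : F, exists f, dx f - kappa * dy f = c.

(** If the top coefficient is a mere function, its point of order 0 lies strictly below the old
    line, so a flatter edge leaves it. The polynomial [e] of this edge has a nonzero constant term
    and degree at most [m]. The transport equation realizes a root c of [e] by a function [f]; the
    twist by [f] translates [e] by c, and the new [m] is the multiplicity of c. *)
Lemma newton_step q tail s t0 m : (0 < q)%N -> exponents_in q ((1, f1) :: tail) ->
    (forall e, e \in tail -> e.1 < 1) -> 0 < s <= 1 -> (0 < m)%N ->
    newton_state ((1, f1) :: tail) s t0 m ->
  nonscalar_top ((1, f1) :: tail) \/
  exists s' f t1 m', [/\ 0 < s' < s, (0 < m' <= m)%N,
    newton_state (rcons ((1, f1) :: tail) (s', f)) s' t1 m' &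
    (m' = m -> exists k : nat, s' = k%:R / q%:R)].
Proof.
set phi := (1, f1) :: tail => q0 Ephi tail1 /andP[s0 s1] m0 [vl vm v0].
pose v := twist phi u.
have vt0 : v (t0 - s * m%:R) != 0 by apply: contraNneq vm; rewrite -/v => ->; rewrite opcoef0.
have [K [vK max]] := top_exponent q0 Ephi vt0; set t1 := K%:R / q%:R in vK max.
case: (pselect (exists i j, (0 < i + j)%N /\ opcoef (v t1) i j != 0)) => [top|notop].
  by left; exists t1.
right.
have c0 : opcoef (v t1) 0 0 != 0.
  apply: contra_neq vK => c0; apply: opP => i j; rewrite opcoef0.
  case: (posnP (i + j)) => [|ij]; last first.
    by apply/eqP; apply/negPn/negP => nz; apply: notop; exists i, j.
  by move=> /eqP; rewrite addn_eq0 => /andP[/eqP -> /eqP ->].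
have t10 : t1 < t0.
  have := vl _ _ _ c0; rewrite mulr0 addr0 lt_neqAle => ->; rewrite andbT.
  by apply: contraNneq c0 => E; have := v0 0%N 0%N m0; rewrite mulr0 subr0 -E => ->.
have m0' : (0 < m + 0)%N by rewrite addn0.
have [s' [vl' sm [a [b [ab cab]]]]] := min_slope q0 Ephi max m0' vm.
rewrite addn0 in sm.
have mR : 0 < m%:R :> rat by rewrite ltr0n.
have s's : s' < s by rewrite -(ltr_pM2r mR); lra.
have s'0 : 0 < s'.
  have abR : 0 < (a + b)%:R :> rat by rewrite ltr0n.
  have : s' * (a + b)%:R != 0.
    by apply/eqP => E; case: notop; exists a, b; split=> //; move: cab; rewrite E subr0.
  rewrite mulf_eq0 negb_or => /andP[s'n _]; rewrite lt_neqAle eq_sym s'n /= leNgt.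
  apply/negP => s'neg; case/eqP: cab; rewrite max ?opcoef0 //.
  have : s' * (a + b)%:R < 0 by rewrite pmulr_llt0.
  lra.
have s'1 : 0 < s' < 1 by rewrite s'0; lra.
pose e : {poly F} := \poly_(d < n.+1) opcoef (v (t1 - s' * d%:R)) d 0.
have eE d : e`_d = opcoef (v (t1 - s' * d%:R)) d 0.
  by rewrite coef_poly; case: ltnP => // nd; rewrite (twist_order _ _ un) // addn0.
have form := edge_form tail1 s'1 vl'; rewrite -/phi -/v -/e in form.
clearbody e.
have e0 : e`_0 != 0 by rewrite eE mulr0 subr0.
have eab : e`_(a + b) != 0.
  apply: contraNneq cab => E.
  have := congr1 (fun r : {poly {poly F}} => r`_a`_b) form.
  rewrite /= coef_initial_form => [->|t]; last exact: twist_order.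
  by rewrite coef_at_lin_form E mul0r mul0rn.
(* Beyond order [m] the new line runs strictly above the old one, which bounds all points. *)
have edge d : e`_d != 0 -> (d <= m)%N.
  rewrite eE => /vl; rewrite addn0 => le; rewrite leqNgt; apply/negP => md.
  have : m%:R + 1 <= d%:R :> rat by rewrite natr1 ler_nat.
  nra.
have size_e : (1 < size e)%N.
  by apply: leq_ltn_trans ab _; rewrite ltnNge; apply: contra eab => le; rewrite nth_default.
have size_em : (size e <= m.+1)%N.
  rewrite leqNgt; apply/negP => lt.
  have /edge : e`_(size e).-1 != 0.
    by rewrite -lead_coefE lead_coef_eq0 -size_poly_gt0 (leq_trans _ lt).
  by rewrite leqNgt -ltnS prednK ?(leq_trans _ lt) // lt.
have [c /rootP ec] := closedF size_e.
have c_neq0 : c != 0.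
  by apply: contraNneq e0 => E; move: ec; rewrite E horner_coef0 => ->.
have [f fc] := transport c.
pose e' := e \Po ('X + c%:P).
have e'E : e' = e \Po ('X + c%:P) by [].
clearbody e'.
have size_e' : size e' = size e by rewrite e'E size_comp_poly2 // size_XaddC.
have e'0 : e'`_0 = 0 by rewrite -horner_coef0 e'E horner_comp !hornerE.
have e'nz : exists k, e'`_k != 0.
  exists (size e').-1; rewrite -lead_coefE lead_coef_eq0 -size_poly_gt0.
  by rewrite size_e' (ltn_trans _ size_e).
case: (ex_minnP e'nz) => m' e'm' minm'.
have m'0 : (0 < m')%N by rewrite lt0n; apply: contraNneq e'm' => ->; rewrite e'0.
have m'm : (m' <= m)%N.
  by rewrite -ltnS; apply: leq_trans size_em; rewrite -size_e' ltnNge; apply: contra e'm' => le; rewrite nth_default.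
have c'E i j : opcoef (twist (rcons phi (s', f)) u (t1 - s' * (i + j)%:R)) i j =
    e'`_(i + j) * (- kappa) ^+ j *+ 'C(i + j, j).
  have := congr1 (fun r : {poly {poly F}} => r`_i`_j) (initial_form_rcons f un s'0 vl').
  rewrite /= coef_initial_form => [->|t]; last exact: twist_order.
  by rewrite form shift2_lin_form fc -e'E coef_at_lin_form.
exists s', f, t1, m'; split.
- by rewrite s'0.
- by rewrite m'0.
- split.
  + exact: (@below_line_rcons _ _ _ _ _ _ _ un s'0 vl').
  + by have := c'E m' 0%N; rewrite addn0 expr0 mulr1 bin0 mulr1n => ->.
  + move=> i j ij; rewrite c'E (_ : e'`_(i + j) = 0) ?mul0r ?mul0rn //.
    by apply/eqP; apply/negPn/negP => /minm'; rewrite leqNgt ij.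
(* If [m] does not drop, [e] is a multiple of (X - c)^m with c nonzero, and its linear coefficient
   is nonzero in characteristic 0. The edge then carries a point of order 1, whose exponent t1 - s'
   is a multiple of 1/q, and hence so is s'. *)
move=> m'E; have e1 : e`_1 != 0.
  have e'X : e' = e'`_m *: 'X^m.
    apply/polyP => k; rewrite coefZ coefXn; case: eqP => [->|/eqP km]; first by rewrite mulr1.
    rewrite mulr0; case: (ltnP k m) => [lt|ge].
      by apply/eqP; apply/negPn/negP => /minm'; rewrite leqNgt m'E lt.
    by rewrite nth_default // size_e' (leq_trans size_em) // ltn_neqAle eq_sym km.
  have eX : e = e'`_m *: ('X - c%:P) ^+ m.
    have <- : e' \Po ('X - c%:P) = e.
      by rewrite e'E -comp_polyA comp_polyD comp_polyX comp_polyC subrK comp_polyXr.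
    by rewrite e'X coefZ coefXn eqxx mulr1 comp_polyZ rmorphXn /= comp_polyX.
  have -> : e`_1 = (e^`()).[0] by rewrite horner_coef0 coef_deriv mulr1n.
  rewrite eX derivZ deriv_exp derivXsubC !hornerE !mulf_neq0 // -?m'E //.
    by case: (m') m'0 => // k _; rewrite hornerMn !hornerE -mulr_natl mulf_neq0 ?nat_neq0 // expf_neq0 // ?sub0r oppr_eq0.
have [k kn E] : exists2 k : nat, (k <= n * q)%N & t1 - s' = k%:R / q%:R.
  apply: (twist_supp q0 Ephi un); move: e1; rewrite eE mulr1.
  by apply: contraNneq => E; rewrite /v E opcoef0.
exists (K - k)%N.
have qR : 0 < q%:R :> rat by rewrite ltr0n.
have kK : (k <= K)%N.
  by rewrite -(ler_nat rat) -(ler_pM2r (x := q%:R^-1)) ?invr_gt0 // -E -/t1; lra.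
by rewrite natrB // mulrBl -E -/t1; ring.
Qed.

End NewtonPuiseux.

(** Both sides homogenize the polynomial e(X + alpha). *)
Lemma homogeneous_shift (R : comNzRingType) (e : {poly R}) (alpha z y : R) n :
  (size e <= n.+1)%N ->
  \sum_(i < n.+1) e`_i * (z + alpha * y) ^+ i * y ^+ (n - i) =
  \sum_(i < n.+1) (e \Po ('X + alpha%:P))`_i * z ^+ i * y ^+ (n - i).
Proof.
move=> en; have compE (i : nat) : (e \Po ('X + alpha%:P))`_i =
    \sum_(k < n.+1) e`_k * (alpha ^+ (k - i) *+ 'C(k, i)).
  rewrite comp_polyE (big_ord_widen_cond n.+1 xpredT (fun k => e`_k *: ('X + alpha%:P) ^+ k)) //.
  rewrite coef_sum (big_mkcond (fun k : 'I_n.+1 => (k < size e)%N)) /=; apply: eq_bigr => k _.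
  case: ltnP => ke; last by rewrite nth_default // mul0r.
  rewrite coefZ addrC exprDn coef_sum; congr (_ * _).
  have E (j : nat) : ((alpha%:P ^+ (k - j) * 'X^j) *+ 'C(k, j))`_i =
      if i == j then alpha ^+ (k - j) *+ 'C(k, j) else 0 :> R.
    by rewrite coefMn -rmorphXn /= coefCM coefXn; case: eqP; rewrite ?mulr1 ?mulr0 ?mul0rn.
  under eq_bigr => j _ do rewrite E.
  case: (ltnP i k.+1) => ik.
    rewrite (bigD1 (Ordinal ik)) //= eqxx big1 ?addr0 // => j /eqP ji.
    by case: eqP => // ij; case: ji; apply: val_inj.
  rewrite bin_small // mulr0n big1 // => j _; case: eqP => // ij.
  by have := ltn_ord j; rewrite -ij ltnNge (leq_trans _ ik).
under [RHS]eq_bigr => i _ do rewrite compE !mulr_suml.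
rewrite exchange_big /=; apply: eq_bigr => k _.
rewrite addrC exprDn mulr_sumr mulr_suml.
rewrite (big_ord_widen n.+1 (fun i => e`_k * ((alpha * y) ^+ (k - i) * z ^+ i *+ 'C(k, i)) * y ^+ (n - k))) //.
rewrite big_mkcond /=; apply: eq_bigr => i _; case: ltnP => ik; last first.
  by rewrite bin_small // mulr0n mulr0 !mul0r.
have -> : (n - i = (k - i) + (n - k))%N by have := ltn_ord k; lia.
by rewrite exprD exprMn -mulr_natr -[alpha ^+ _ *+ _]mulr_natr; ring.
Qed.

Section Existence.
Variables (F : diffFieldType) (char0 : [pchar F] =i pred0).
Hypothesis closedF : forall e : {poly F}, (1 < size e)%N -> exists x, root e x.
Hypothesis transport : forall kappa c : F, exists f, dx f - kappa * dy f = c.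
Hypothesis characteristic : forall alpha : F, exists f, dx f = alpha * dy f /\ dy f != 0.
Variables (u : diffop F) (n : nat) (un : order_le u n).

(** Termination is by lexicographic induction on [m] and on the numerator [k] of the slope: as long
    as [m] stays, so does the denominator [q], and the slopes decrease among multiples of 1/q. *)
Lemma newton_iterate (f1 : F) m k q tail s t0 : dy f1 != 0 ->
    (0 < q)%N -> exponents_in q ((1, f1) :: tail) ->
    path >%R 1 (unzip1 tail) -> all (fun s : rat => 0 < s) (unzip1 tail) ->
    s = last 1 (unzip1 tail) -> s = k%:R / q%:R -> 0 < s <= 1 -> (0 < m)%N ->
    newton_state u ((1, f1) :: tail) s t0 m ->
  exists G : fd_symbol F, fd_head G = f1 /\ nonscalar_top u (fd_terms G).
Proof.
move=> f1y; have [m' mm'] := ubnP m; elim: m' m mm' k q tail s t0 => // m' IHm m mm' k.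
have [k' kk'] := ubnP k; elim: k' k kk' => // k' IHk k kk'.
move=> q tail s t0 q0 Ephi pathT posT sE sk s01 m0 state.
have tail1 e : e \in tail -> e.1 < 1.
  move=> eT; have := order_path_min (rev_trans lt_trans) pathT => /allP.
  by apply; apply: map_f.
case: (newton_step char0 un f1y closedF (transport _) q0 Ephi tail1 s01 m0 state) => [top|].
  have f1n : (dx f1, dy f1) <> (0, 0) by case=> _ /eqP; exact/negP.
  by exists (FdSymbol f1n pathT posT).
move=> [s' [f [t1 [m1 [/andP[s'0 s's] /andP[m10 m1m] state' lat]]]]].
have pathT' : path >%R 1 (unzip1 (rcons tail (s', f))).
  by rewrite /unzip1 map_rcons rcons_path pathT -sE.
have posT' : all (fun s : rat => 0 < s) (unzip1 (rcons tail (s', f))).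
  by rewrite /unzip1 map_rcons all_rcons /= s'0.
have sE' : s' = last 1 (unzip1 (rcons tail (s', f))).
  by rewrite /unzip1 map_rcons last_rcons.
have s'1 : s' < 1 by case/andP: s01 => _; exact: lt_le_trans.
have s'01 : 0 < s' <= 1 by rewrite s'0 ltW.
(* When [m] drops, the new slope may need another denominator, so [q] is multiplied by it. *)
case: (ltnP m1 m) => [lt|ge].
  pose d := `|denq s'|%N; pose a := `|numq s'|%N.
  have s'E : s' = a%:R / d%:R.
    rewrite /a /d -[in LHS](divq_num_den s') !natr_absz !ger0_norm ?denq_ge0 //.
    by rewrite numq_ge0 ltW.
  have d0 : (0 < d)%N by rewrite absz_gt0 denq_neq0.
  have q0R : q%:R != 0 :> rat by rewrite pnatr_eq0 -lt0n.
  have d0R : d%:R != 0 :> rat by rewrite pnatr_eq0 -lt0n.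
  have a0 : (0 < a)%N.
    by rewrite lt0n; apply: contraTneq s'0 => E; rewrite s'E E mul0r ltxx.
  have ad : (a <= d)%N.
    by move: (ltW s'1); rewrite s'E ler_pdivrMr ?ltr0n // mul1r ler_nat.
  have Ephi' : exponents_in (q * d) ((1, f1) :: rcons tail (s', f)).
    move=> e; rewrite -rcons_cons mem_rcons inE => /orP[/eqP ->|/Ephi[l lq ->]] /=; last first.
      exists (l * d)%N; first by case/andP: lq => l0 lq; rewrite muln_gt0 l0 d0 leq_mul2r lq orbT.
      by rewrite !natrM invfM mulrACA divff // mulr1.
    exists (q * a)%N; last by rewrite s'E !natrM invfM mulrACA divff // mul1r.
    by rewrite muln_gt0 q0 a0 leq_mul2l ad orbT.
  have s'E' : s' = (q * a)%N%:R / (q * d)%N%:R by rewrite !natrM invfM mulrACA divff // mul1r.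
  apply: (IHm m1 _ (q * a)%N (q * d)%N (rcons tail (s', f)) s' t1) => //.
  - by rewrite -ltnS; apply: leq_trans lt _.
  - by rewrite muln_gt0 q0.
have m1E : m1 = m by apply/eqP; rewrite eqn_leq m1m.
have [k1 s'E] := lat m1E.
have qR : 0 < q%:R :> rat by rewrite ltr0n.
have k1k : (k1 < k)%N by move: s's; rewrite s'E sk ltr_pM2r ?invr_gt0 // ltr_nat.
apply: (IHk k1 _ q (rcons tail (s', f)) s' t1) => //.
- by apply: leq_trans k1k _.
- move=> e; rewrite -rcons_cons mem_rcons inE => /orP[/eqP ->|/Ephi //] /=.
  exists k1 => //; apply/andP; split.
    by move: s'0; rewrite s'E; case: (k1) => //; rewrite mul0r ltxx.
  move: s'1; rewrite s'E ltr_pdivrMr // mul1r ltr_nat; exact: ltnW.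
- by rewrite -m1E.
Qed.

(** The principal symbol of [u] contains a monomial with X, hence has a factor X - alpha Y. For f_1
    with d_x f_1 = alpha d_y f_1, the twist fixes X - alpha Y and turns Y into Y + d_y f_1; this
    starts the polygon with slope 1 and [m] the multiplicity of alpha. *)
Lemma newton_puiseux i : (0 < i <= n)%N -> opcoef u i (n - i) != 0 ->
  exists G : fd_symbol F, dy (fd_head G) != 0 /\ nonscalar_top u (fd_terms G).
Proof.
move=> /andP[i0 iN] ui.
pose e : {poly F} := \poly_(k < n.+1) opcoef u k (n - k).
have en : (size e <= n.+1)%N by exact: size_poly.
have ei : e`_i != 0 by rewrite coef_poly ltnS iN.
have size_e : (1 < size e)%N.
  by apply: leq_ltn_trans i0 _; rewrite ltnNge; apply: contra ei => le; rewrite nth_default.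
have [alpha /rootP ealpha] := closedF size_e.
have [f1 [f1x f1y]] := characteristic alpha.
pose e' := e \Po ('X + alpha%:P).
have e'0 : e'`_0 = 0 by rewrite -horner_coef0 horner_comp !hornerE.
have size_e' : size e' = size e by rewrite size_comp_poly2 // size_XaddC.
have e'nz : exists k, e'`_k != 0.
  exists (size e').-1; rewrite -lead_coefE lead_coef_eq0 -size_poly_gt0.
  by rewrite size_e' (ltn_trans _ size_e).
case: (ex_minnP e'nz) => m e'm minm.
have m0 : (0 < m)%N by rewrite lt0n; apply: contraNneq e'm => ->; rewrite e'0.
have mn : (m <= n)%N.
  rewrite -ltnS; apply: leq_trans en; rewrite -size_e' ltnNge.
  by apply: contra e'm => le; rewrite nth_default.
have below0 : below_line (twist [::] u) 1 n%:R.
  move=> t k l; rewrite twist_nil; case: (eqVneq t 0) => [->|_]; last by rewrite opcoef0 eqxx.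
  rewrite add0r mul1r ler_nat leqNgt => nz; apply: contra nz => lt.
  by rewrite un.
have form0 : initial_form n (twist [::] u) 1 n%:R =
    \sum_(k < n.+1) (e'`_k)%:P%:P * (lin_form alpha) ^+ k * 'X%:P ^+ (n - k).
  pose E : {poly {poly {poly F}}} := map_poly (fun c => c%:P%:P) e.
  have inj : injective (fun c : F => c%:P%:P) by move=> c c' /polyC_inj/polyC_inj.
  have sE : (size E <= n.+1)%N by rewrite size_map_inj_poly ?polyC0 // size_poly.
  have := homogeneous_shift alpha%:P%:P (lin_form alpha) 'X%:P sE.
  rewrite (_ : E \Po _ = map_poly (fun c => c%:P%:P) e'); last first.
    have mE : (fun c : F => c%:P%:P) = (polyC \o polyC : {rmorphism F -> {poly {poly F}}}) by [].
    by rewrite /E mE map_comp_poly rmorphD /= map_polyX map_polyC.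
  rewrite (_ : lin_form alpha + alpha%:P%:P * 'X%:P = 'X); last first.
    by rewrite /lin_form polyCM subrK.
  have cE (p : {poly F}) k : (map_poly (fun c => c%:P%:P) p)`_k = (p`_k)%:P%:P :> {poly {poly F}}.
    by rewrite coef_map_id0 ?polyC0.
  under [in X in X = _]eq_bigr => k _ do rewrite cE.
  under [in X in _ = X]eq_bigr => k _ do rewrite cE.
  move=> <-; apply/polyP => k; apply/polyP => l.
  rewrite coef_initial_form => [|t]; last exact: twist_order.
  rewrite coef_sum coef_sum twist_nil mul1r subr_eq0 eqr_nat.
  have tE (j : 'I_n.+1) : ((e`_j)%:P%:P * 'X ^+ j * 'X%:P ^+ (n - j))`_k`_l =
      if (k == j) && (l == n - j)%N then e`_j else 0 :> F.
    rewrite -mulrA coefCM coefCM -rmorphXn coefMC coefXn /=.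
    case: eqP => /= _; last by rewrite mul0r coef0 mulr0.
    by rewrite mul1r coefXn; case: eqP; rewrite ?mulr1 ?mulr0.
  under eq_bigr => j _ do rewrite tE.
  case: eqP => kl; last first.
    rewrite opcoef0 big1 // => j _; case: andP => // -[/eqP kj /eqP lj]; case: kl.
    by have := ltn_ord j; lia.
  have kn : (k < n.+1)%N by lia.
  rewrite (bigD1 (Ordinal kn)) //= eqxx (_ : l == _)%N; last by apply/eqP; lia.
  rewrite big1 ?addr0 => [|j /eqP jk].
    by rewrite coef_poly kn; congr (opcoef _ _ _); lia.
  by case: andP => // -[/eqP kj _]; case: jk; apply: val_inj.
have form1 k l : opcoef (twist [:: (1, f1)] u (n%:R - 1 * (k + l)%:R)) k l =
    \sum_(j < n.+1) e'`_j * ((lin_form alpha ^+ j)`_k * ('X + (dy f1)%:P) ^+ (n - j))`_l.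
  have := congr1 (fun r : {poly {poly F}} => r`_k`_l) (initial_form_rcons f1 un ltr01 below0).
  rewrite /= coef_initial_form => [->|t]; last exact: twist_order.
  rewrite form0 shift2_sum coef_sum coef_sum; apply: eq_bigr => j _.
  have lin : shift2 (dx f1) (dy f1) (lin_form alpha) = lin_form alpha.
    have E (c : F) : at_lin_form alpha ('X + c%:P) = lin_form alpha + c%:P%:P.
      have mE : (fun c : F => c%:P%:P) = (polyC \o polyC : {rmorphism F -> {poly {poly F}}}) by [].
      by rewrite /at_lin_form mE rmorphD /= map_polyX map_polyC hornerD hornerX hornerC.
    have := shift2_lin_form (dx f1) (dy f1) alpha ('X + 0%:P).
    rewrite E polyC0 polyC0 addr0 => ->.
    by rewrite f1x subrr polyC0 !addr0 comp_polyXr -['X]addr0 -polyC0 E !polyC0 addr0.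
  rewrite !shift2M !shift2_exp shift2C lin shift2Y -mulrA coefCM coefCM -polyCD -rmorphXn coefMC.
  done.
(* No power of X - alpha Y below the m-th occurs, and the constant (d_y f_1)^(n - m) is nonzero; so
   order [m] is the least one on the edge, with X^m present. *)
have state : newton_state u [:: (1, f1)] 1 n%:R m.
  split.
  - exact: (@below_line_rcons _ [::] _ _ _ _ f1 un ltr01 below0).
  - have := form1 m 0%N; rewrite addn0 => ->.
    rewrite (bigD1 (Ordinal (mn : (m < n.+1)%N))) //= big1 ?addr0.
      rewrite coef0M coef_lin_form_exp addn0 eqxx expr0 bin0 mul1r.
      by rewrite -horner_coef0 !hornerE mulf_neq0 // expf_neq0.
    move=> j /eqP jm; rewrite coef0M coef_lin_form_exp addn0.
    by case: eqP => [E|_]; rewrite ?mul0r ?mulr0 //; case: jm; apply: val_inj.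
  - move=> k l kl; rewrite form1 big1 // => j _.
    case: (ltnP j m) => [jm|mj].
      by rewrite (_ : e'`_j = 0) ?mul0r //; apply/eqP; apply/negPn/negP => /minm; rewrite leqNgt jm.
    rewrite coefM big1 ?mulr0 // => i' _; rewrite coef_lin_form_exp.
    case: eqP => [E|_]; last by rewrite mul0r.
    by have := leq_trans kl mj; rewrite -E ltn_add2l ltnNge -ltnS ltn_ord.
have [] := @newton_iterate f1 m 1 1 [::] 1 n%:R f1y isT _ isT isT erefl _ _ m0 state => //.
- by move=> e0; rewrite inE => /eqP ->; exists 1%N; rewrite ?divr1.
- by move=> G [GE top]; exists G; rewrite GE.
Qed.
End Existence.

(** * Action on fractional-derivatives series *)

Section SeriesAction.
Variables (F : diffFieldType) (G : fd_symbol F).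
Implicit Types (p r : diffop F) (H : rat -> F^o) (s t : rat).

Lemma fd_action : diff_action (fd_derive G (@dx F)) (fd_derive G (@dy F)).
Proof.
have derD (d : {additive F -> F}) u v :
    fd_derive G d (u + v) = fd_derive G d u + fd_derive G d v.
  apply/funext => s; rewrite /fd_derive !fctE raddfD addrACA; congr (_ + _).
  by rewrite -big_split; apply: eq_bigr => t _; exact: mulrDr.
have derZ (d : F -> F) a v : (forall x y, d (x * y) = d x * y + x * d y) ->
    fd_derive G d (a *: v) = d a *: v + a *: fd_derive G d v.
  move=> dM; apply/funext => s; rewrite /fd_derive !fctE.
  rewrite -[a *: v s]/(a * v s) dM -addrA; congr (_ + _).
  rewrite -[RHS]/(a * _) mulrDr; congr (_ + _).
  by rewrite mulr_sumr; apply: eq_bigr => t _; rewrite mulrCA.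
split=> [u v|u v|a v|a v|v].
- exact: (derD (@dx F)).
- exact: (derD (@dy F)).
- by apply: derZ; exact: dxM.
- by apply: derZ; exact: dyM.
apply/funext => s; rewrite /fd_derive !raddfD /= dxdyC -!addrA; congr (_ + _).
rewrite !raddf_sum /=.
under eq_bigr => t _ do rewrite dxM.
under [X in _ + X]eq_bigr => t _ do rewrite mulrDr.
under [X in _ = X + _]eq_bigr => t _ do rewrite dyM.
under [X in _ = _ + X]eq_bigr => t _ do rewrite mulrDr.
rewrite !big_split /= addrACA; congr (_ + _ + (_ + _)).
  by apply: eq_bigr => t _; rewrite dxdyC.
under eq_bigr => t _ do rewrite mulr_sumr.
under [RHS]eq_bigr => t _ do rewrite mulr_sumr.
rewrite exchange_big /=; apply: eq_bigr => t _; apply: eq_bigr => u _.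
by rewrite mulrCA addrAC.
Qed.

Definition field_act p (h : F) : F := opact (V := F^o) (@dx F) (@dy F) p h.

Lemma field_actD p r h : field_act (p + r) h = field_act p h + field_act r h.
Proof. exact: (@actD F F^o). Qed.
Lemma field_actZ a p h : field_act (a *: p) h = a * field_act p h.
Proof. exact: (@actZ F F^o). Qed.
Lemma field_act_dx p h : field_act (opdx F * p) h = dx (field_act p h).
Proof. exact: (act_dx (field_action F)). Qed.
Lemma field_act_dy p h : field_act (opdy F * p) h = dy (field_act p h).
Proof. exact: (act_dy (field_action F)). Qed.
Lemma field_act1 h : field_act 1 h = h.
Proof. exact: (@act1 F F^o). Qed.
Lemma field_act0 h : field_act 0 h = 0.
Proof. exact: (@act0 F F^o). Qed.
Lemma field_act0r p : field_act p 0 = 0.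
Proof. exact: (act0r (field_action F)). Qed.
Lemma field_act_sum I (l : seq I) (g : I -> diffop F) h :
  field_act (\sum_(i <- l) g i) h = \sum_(i <- l) field_act (g i) h.
Proof. exact: (@act_sum F F^o). Qed.

Lemma fd_actD p r H s : fd_act G (p + r) H s = fd_act G p H s + fd_act G r H s.
Proof. by rewrite /fd_act actD. Qed.
Lemma fd_actZ a p H s : fd_act G (a *: p) H s = a * fd_act G p H s.
Proof. by rewrite /fd_act actZ. Qed.
Lemma fd_act_dx p H s : fd_act G (opdx F * p) H s =
  dx (fd_act G p H s) + \sum_(e <- fd_terms G) dx e.2 * fd_act G p H (s - e.1).
Proof. by rewrite /fd_act (act_dx fd_action). Qed.
Lemma fd_act_dy p H s : fd_act G (opdy F * p) H s =
  dy (fd_act G p H s) + \sum_(e <- fd_terms G) dy e.2 * fd_act G p H (s - e.1).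
Proof. by rewrite /fd_act (act_dy fd_action). Qed.
Lemma fd_act1 H : fd_act G 1 H = H.
Proof. exact: act1. Qed.
Lemma fd_act0r p : fd_act G p 0 = 0.
Proof. exact: (act0r fd_action). Qed.

(** The rule for dG^(s) is the derivative of an exponential in which lambda shifts exponents, so the
    coefficients of the conjugated operator act on the coefficients of [H] as in a convolution. *)
Lemma fd_act_twist q p n H s : (0 < q)%N -> exponents_in q (fd_terms G) -> order_le p n ->
  fd_act G p H s = \sum_(0 <= k < (n * q).+1)
    field_act (twist (fd_terms G) p (k%:R / q%:R)) (H (s - k%:R / q%:R)).
Proof.
move=> q0 Eq; have q0R : q%:R != 0 :> rat by rewrite pnatr_eq0 -lt0n.
have pos e : e \in fd_terms G -> 0 < e.1.
  by case/Eq=> k /andP[k0 _] ->; rewrite divr_gt0 ?ltr0n.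
move: n p s; suff: forall n p, order_le p n -> order_le p n /\
   forall s, fd_act G p H s = \sum_(0 <= k < (n * q).+1)
    field_act (twist (fd_terms G) p (k%:R / q%:R)) (H (s - k%:R / q%:R)).
  by move=> E n p s /E[_]; apply.
have vanish n p k h : order_le p n -> (n * q < k)%N ->
    field_act (twist (fd_terms G) p (k%:R / q%:R)) h = 0.
  move=> pn nk; rewrite (_ : twist _ _ _ = 0) ?field_act0 //.
  apply/eqP; apply: contraTT nk => /(twist_supp q0 Eq pn)[l ln /eqP].
  rewrite -leqNgt eqr_div // -!natrM eqr_nat eqn_pmul2r // => /eqP -> //.
have shift n p l u : order_le p n -> (l <= q)%N ->
   \sum_(0 <= k < (n * q).+1)
     field_act (twist (fd_terms G) p (k%:R / q%:R)) (H (u - l%:R / q%:R - k%:R / q%:R)) =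
   \sum_(0 <= k < (n.+1 * q).+1)
     field_act (twist (fd_terms G) p (k%:R / q%:R - l%:R / q%:R)) (H (u - k%:R / q%:R)).
  move=> pn lq; rewrite [RHS](big_cat_nat (n := l)) //=; last by rewrite mulSn; lia.
  rewrite [X in _ = X + _]big_nat [X in _ = X + _]big1 ?add0r; last first.
    move=> k /andP[_ kl]; rewrite twist_neg ?field_act0 // -mulrBl pmulr_llt0 ?invr_gt0 ?ltr0n //.
    by rewrite subr_lt0 ltr_nat.
  have E (g : nat -> F) m : \sum_(l <= d < m) g d = \sum_(0 <= k < m - l) g (k + l)%N.
    by rewrite -{1}[l]add0n big_addn.
  rewrite E [RHS](big_cat_nat (n := (n * q).+1)) //=; last by rewrite mulSn; lia.
  rewrite [X in _ = _ + X]big_nat [X in _ = _ + X]big1 ?addr0; last first.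
    move=> k /andP[nk _]; rewrite -mulrBl natrD addrK; exact: (vanish n).
  apply: eq_big_nat => k _; rewrite natrD; congr (field_act (twist _ _ _) (H _)); by field.
have widen n p u : order_le p n ->
   \sum_(0 <= k < (n * q).+1) field_act (twist (fd_terms G) p (k%:R / q%:R)) (H (u - k%:R / q%:R))
   = \sum_(0 <= k < (n.+1 * q).+1) field_act (twist (fd_terms G) p (k%:R / q%:R)) (H (u - k%:R / q%:R)).
  by move=> pn; have := @shift n p 0%N u pn (leq0n _); rewrite !mul0r !subr0 => ->;
     apply: eq_bigr => k _; rewrite subr0.
have der n p p' (d : {additive F -> F}) D : order_le p n ->
  (forall r h, field_act (D * r) h = d (field_act r h)) ->
  (forall u, fd_act G p' H u = d (fd_act G p H u) +
     \sum_(e <- fd_terms G) d e.2 * fd_act G p H (u - e.1)) ->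
  (forall t, twist (fd_terms G) p' t = D * twist (fd_terms G) p t +
      \sum_(e <- fd_terms G) d e.2 *: twist (fd_terms G) p (t - e.1)) ->
  (forall s, fd_act G p H s = \sum_(0 <= k < (n * q).+1)
    field_act (twist (fd_terms G) p (k%:R / q%:R)) (H (s - k%:R / q%:R))) ->
  forall s, fd_act G p' H s = \sum_(0 <= k < (n.+1 * q).+1)
    field_act (twist (fd_terms G) p' (k%:R / q%:R)) (H (s - k%:R / q%:R)).
  move=> pn ED Ea Et IH u; rewrite Ea.
  under [RHS]eq_bigr => k _ do rewrite Et field_actD ED field_act_sum.
  rewrite big_split /=; congr (_ + _); first by rewrite IH (widen n) // raddf_sum.
  rewrite exchange_big /= big_seq [RHS]big_seq; apply: eq_bigr => e eG.
  have [l /andP[l0 lq] eE] := Eq e eG; rewrite IH eE (shift n) // mulr_sumr.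
  by apply: eq_bigr => k _; rewrite field_actZ.
apply: order_ind => [|n p p' [pn Qp] [pn' Qp']|n a p [pn Qp]|n p [pn Qp]|n p [pn Qp]|n p [pn Qp]].
- split=> [|u]; first exact: order_le1.
  by rewrite mul0n big_nat1 mul0r twist1 eqxx field_act1 subr0 fd_act1.
- split=> [|u]; first exact: order_leD.
  rewrite fd_actD Qp Qp' -big_split.
  by apply: eq_bigr => k _; rewrite twistD field_actD.
- split=> [|u]; first exact: order_leZ.
  rewrite fd_actZ Qp mulr_sumr.
  by apply: eq_bigr => k _; rewrite twistZ field_actZ.
- split=> [|u]; first exact: order_le_dx.
  apply: (der n p _ (@dx F) (opdx F)) => //; first exact: field_act_dx.
    exact: fd_act_dx.
  exact: twist_dx.
- split=> [|u]; first exact: order_le_dy.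
  apply: (der n p _ (@dy F) (opdy F)) => //; first exact: field_act_dy.
    exact: fd_act_dy.
  exact: twist_dy.
- by split=> [|u]; [exact: order_leW pn|rewrite Qp (widen n)].
Qed.

Lemma fd_denominator_gt0 : (0 < fd_denominator G)%N.
Proof.
rewrite /fd_denominator; apply: (big_ind (fun m => 0 < m)%N) => // [m k m0 k0|t _].
  by rewrite lcmn_gt0 m0.
by rewrite absz_gt0 denq_neq0.
Qed.

Lemma fd_exponents_lt1 e : e \in fd_tail G -> 0 < e.1 < 1.
Proof.
move=> eT; have e1 : e.1 \in unzip1 (fd_tail G) by apply: map_f.
rewrite (allP (fd_exponents_gt0 G)) //=.
by have /allP := order_path_min (rev_trans lt_trans) (fd_exponents_decreasing G); apply.
Qed.

Lemma fd_exponents_in : exponents_in (fd_denominator G) (fd_terms G).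
Proof.
have q0 := fd_denominator_gt0.
move=> e; rewrite inE => /orP[/eqP ->|eT].
  exists (fd_denominator G); first by rewrite q0 leqnn.
  by rewrite divff // pnatr_eq0 -lt0n.
have /andP[e0 e1] := fd_exponents_lt1 eT.
have /dvdnP[k qE] : (`|denq e.1| %| fd_denominator G)%N.
  rewrite /fd_denominator; elim: (fd_tail G) eT => //= a l IH.
  rewrite inE big_cons => /orP[/eqP <-|/IH le]; first exact: dvdn_lcml.
  exact: dvdn_trans le (dvdn_lcmr _ _).
have k0 : (0 < k)%N by move: q0; rewrite qE muln_gt0 => /andP[].
have eE : e.1 = (k * `|numq e.1|)%N%:R / (fd_denominator G)%:R.
  rewrite qE !natrM invfM mulrACA divff ?mul1r ?pnatr_eq0 -?lt0n //.
  rewrite -[LHS](divq_num_den e.1) !natr_absz !ger0_norm ?denq_ge0 //.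
  by rewrite numq_ge0 ltW.
exists (k * `|numq e.1|)%N => //.
have qR : 0 < (fd_denominator G)%:R :> rat by rewrite ltr0n.
apply/andP; split.
  by rewrite lt0n; apply: contraTneq e0 => E; rewrite eE E mul0r ltxx.
by move: e1; rewrite {1}eE ltr_pdivrMr // mul1r ltr_nat => /ltnW.
Qed.

End SeriesAction.

Section SeriesSolve.
Variables (F : diffFieldType) (G : fd_symbol F).
Implicit Types (p r : diffop F) (H : rat -> F^o) (s t : rat).
Let q := fd_denominator G.

Definition series_of s0 (h : nat -> F) H :=
  (forall i : nat, H (s0 - i%:R / q%:R) = h i) /\
  (forall s, (forall i : nat, s <> s0 - i%:R / q%:R) -> H s = 0).

Let q0R : 0 < q%:R :> rat. Proof. by rewrite ltr0n fd_denominator_gt0. Qed.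
Let qn0 : q%:R != 0 :> rat. Proof. by rewrite gt_eqF. Qed.

Lemma series_exists s0 h : exists H, series_of s0 h H.
Proof.
pose H s : F^o := if pselect (exists i : nat, s = s0 - i%:R / q%:R) is left E
  then h (projT1 (cid E)) else 0.
exists H; split=> [i|s ns]; rewrite /H; case: pselect => // E.
- case: (cid E) => j /= /(addrI s0)/oppr_inj/(mulIf (invr_neq0 qn0))/eqP.
  by rewrite eqr_nat => /eqP ->.
- by case: E; exists i.
- by exfalso; case: E => i /ns.
Qed.

(** Let K/q be the top exponent of the conjugated operator. The i-th coefficient of p H is the top
    operator applied to h_i plus terms in earlier h_j, so the h_i are found recursively, starting
    from any [h0] that satisfies the first equation. *)
Lemma fd_act_solve p K s0 h0 (g : nat -> F) H' :
    (forall t, K%:R / q%:R < t -> twist (fd_terms G) p t = 0) ->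
    (forall a, exists h, field_act (twist (fd_terms G) p (K%:R / q%:R)) h = a) ->
    field_act (twist (fd_terms G) p (K%:R / q%:R)) h0 = g 0 ->
    series_of (s0 + K%:R / q%:R) g H' ->
  exists h, h 0 = h0 /\ forall H, series_of s0 h H -> fd_act G p H = H'.
Proof.
move=> max surj h0P [H'i H'0]; pose v (k : nat) := twist (fd_terms G) p (k%:R / q%:R).
have [sigma sigmaP] := choice surj.
have [n [pn Kn]] : exists n, order_le p n /\ (K <= n * q)%N.
  have [n pn] := order_le_exists p; exists (n + K)%N; split; first by apply: order_leW pn; exact: leq_addr.
  by have := fd_denominator_gt0 G; rewrite -/q; nia.
(* [sigma] is a right inverse of the top operator. The summand for [k] involves index i - (K - k),
   and is dropped where this would be negative. *)
pose step i (h : nat -> F) := if i == 0%N then h0 else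
  sigma (g i - \sum_(0 <= k < K) if (K - k <= i)%N then field_act (v k) (h (i - (K - k))%N) else 0).
have [|h hP] := @measure_recursion nat F id 0 step.
  move=> i h h' hh'; rewrite /step; case: eqP => // i0; congr (sigma (_ - _)).
  apply: eq_big_nat => k kK; case: ifP => // ki; rewrite hh' //; lia.
exists h; split=> [|H [Hi H0]]; first by rewrite hP.
have hE i : field_act (v K) (h i) +
    \sum_(0 <= k < K) (if (K - k <= i)%N then field_act (v k) (h (i - (K - k))%N) else 0) = g i.
  rewrite hP /step; case: eqP => [->|_]; last by rewrite sigmaP subrK.
  by rewrite h0P big_nat big1 ?addr0 // => k kK; rewrite ifF //; lia.
apply/funext => s; rewrite (@fd_act_twist _ _ _ _ n _ _ (fd_denominator_gt0 G) (@fd_exponents_in F G)) //.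
rewrite (big_cat_nat (n := K.+1)) //= [X in _ + X]big_nat [X in _ + X]big1 ?addr0; last first.
  move=> k /andP[kK _]; rewrite max ?field_act0 //.
  by rewrite ltr_pM2r ?invr_gt0 // ltr_nat.
case: (pselect (exists i : nat, s = s0 + K%:R / q%:R - i%:R / q%:R)) => [[i sE]|ns].
  rewrite sE H'i -hE big_nat_recr //= addrC; congr (_ + _).
    by rewrite -Hi; congr (field_act _ (H _)); ring.
  apply: eq_big_nat => k kK; case: ifP => ki.
    rewrite -Hi -/q; congr (field_act _ (H _)).
    rewrite !natrB //; last lia.
    by field.
  rewrite H0 ?field_act0r // => j /eqP; rewrite -subr_eq0 => /eqP E.
  have : (K + j)%N%:R = (i + k)%N%:R :> rat.
    apply: (mulIf (invr_neq0 qn0)); apply/eqP; rewrite -subr_eq0 -[X in _ == X]E !natrD.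
    by apply/eqP; ring.
  by move/eqP; rewrite eqr_nat => /eqP; lia.
rewrite H'0 => [|i E]; last by apply: ns; exists i.
rewrite big_nat big1 // => k kK; rewrite H0 ?field_act0r // => i E; apply: ns.
exists (i + (K - k))%N; rewrite natrD natrB; last lia.
have -> : s = (s - k%:R / q%:R) + k%:R / q%:R by rewrite subrK.
by rewrite E; ring.
Qed.

Lemma is_fd_seriesP H : is_fd_series G H <->
  exists s0 h, s0 * q%:R \is a Num.int /\ series_of s0 h H.
Proof.
split=> [[s0 [h [s0q Hi H0]]]|[s0 [h [s0q [Hi H0]]]]]; exists s0, h; first by split.
by split.
Qed.

Hypothesis field_surj : forall r (a : F), r != 0 -> exists h, field_act r h = a.

Let top p : p != 0 -> exists K : nat, twist (fd_terms G) p (K%:R / q%:R) != 0 /\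
  forall t, K%:R / q%:R < t -> twist (fd_terms G) p t = 0.
Proof.
move=> p0; have [n pn] := order_le_exists p.
apply: (@top_exponent F p n pn q (fd_terms G) 0).
- exact: fd_denominator_gt0.
- exact: fd_exponents_in.
- rewrite twist_at0 // => e; rewrite inE => /orP[/eqP -> //|/fd_exponents_lt1 /andP[]//].
Qed.

Lemma fd_act_surj p H' : p != 0 -> is_fd_series G H' ->
  exists H, is_fd_series G H /\ fd_act G p H = H'.
Proof.
move=> p0 /is_fd_seriesP[s1 [g [s1q H'P]]].
have [K [vK max]] := top p0.
have surj a : exists h, field_act (twist (fd_terms G) p (K%:R / q%:R)) h = a.
  exact: field_surj.
have [h0 h0P] := surj (g 0%N).
have sE : s1 = s1 - K%:R / q%:R + K%:R / q%:R by rewrite subrK.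
rewrite sE in H'P.
have [h [_ hP]] := fd_act_solve max surj h0P H'P.
have [H HP] := series_exists (s1 - K%:R / q%:R) h.
exists H; split; last exact: hP.
apply/is_fd_seriesP; exists (s1 - K%:R / q%:R), h; split=> //.
by rewrite mulrBl divfK // rpredB // rpred_nat.
Qed.

Hypothesis field_kernel : forall r i j, opcoef r i j != 0 -> (0 < i + j)%N ->
  exists2 h : F, h != 0 & field_act r h = 0.

(** The top operator involves a derivation, so it kills some nonzero h_0; the triangular system
    supplies the rest. *)
Lemma fd_act_kernel p : nonscalar_top p (fd_terms G) ->
  exists H, [/\ is_fd_series G H, H <> 0 & fd_act G p H = 0].
Proof.
move=> [t0 [max [i [j [ij cij]]]]].
have vt0 : twist (fd_terms G) p t0 != 0 by apply: contraNneq cij => ->; rewrite opcoef0.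
have [n pn] := order_le_exists p.
have [K _ t0E] := twist_supp (fd_denominator_gt0 G) (@fd_exponents_in F G) pn vt0.
rewrite -/q in t0E; rewrite t0E in max cij vt0.
have surj a : exists h, field_act (twist (fd_terms G) p (K%:R / q%:R)) h = a.
  exact: field_surj.
have [h0 h00 h0P] := field_kernel cij ij.
have zeroS : series_of (0 + K%:R / q%:R) (fun=> 0) (fun=> 0) by [].
have [h [hE hP]] := fd_act_solve max surj h0P zeroS.
have [H HP] := series_exists 0 h; exists H; split; last exact: hP.
- by apply/is_fd_seriesP; exists 0, h; rewrite mul0r rpred0.
- move=> HE; case: HP => /(_ 0%N); rewrite mul0r subr0 hE HE => /eqP.
  by rewrite eq_sym (negPf h00).
Qed.

End SeriesSolve.

Section LeadingExponent.
Variables (F : diffFieldType) (G : fd_symbol F).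
Implicit Types (p r : diffop F) (H : rat -> F^o) (s t : rat).

(** The exponents that occur in p H have the form s_0 + n - i/q with [i] natural, so a largest one
    exists. *)
Lemma fd_act_top p H : is_fd_series G H -> fd_act G p H <> 0 ->
  exists s, fd_act G p H s != 0 /\ forall t, s < t -> fd_act G p H t = 0.
Proof.
have q0 := fd_denominator_gt0 G; set q := fd_denominator G in q0 *.
have qR : 0 < q%:R :> rat by rewrite ltr0n.
have qn : q%:R != 0 :> rat by rewrite gt_eqF.
move=> /is_fd_seriesP[s0 [h [_ [_ H0]]]] nz; set H' := fd_act G p H in nz *.
have [n pn] := order_le_exists p.
have supp s : H' s != 0 -> exists i : nat, s = s0 + n%:R - i%:R / q%:R.
  rewrite /H' (@fd_act_twist _ _ _ _ _ _ _ q0 (@fd_exponents_in F G) pn) => /sum_neq0[k].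
  rewrite mem_iota subn0 add0n ltnS => kn nzk.
  case: (pselect (exists i : nat, s - k%:R / q%:R = s0 - i%:R / q%:R)) => [[i E]|nE].
    exists (i + (n * q - k))%N; rewrite natrD natrB; last by case/andP: kn.
    have -> : s = (s - k%:R / q%:R) + k%:R / q%:R by rewrite subrK.
    by rewrite E natrM; field.
  case/eqP: nzk; rewrite H0 ?field_act0r // => i E; apply: nE; by exists i.
have exi : exists i : nat, H' (s0 + n%:R - i%:R / q%:R) != 0.
  case: (pselect (exists s, H' s != 0)) => [[s nzs]|no].
    by have [i E] := supp s nzs; exists i; rewrite -E.
  case: nz; apply/funext => s; apply/eqP; apply/negPn/negP => nzs; apply: no.
  by exists s.
case: (ex_minnP exi) => i nzi min; exists (s0 + n%:R - i%:R / q%:R); split=> // t lt.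
apply/eqP; apply/negPn/negP => nzt; have [j E] := supp t nzt.
move: lt nzt; rewrite E ltrD2l ltrN2 ltr_pM2r ?invr_gt0 // ltr_nat => ji /min.
by rewrite leqNgt ji.
Qed.

(** Exponent 1, that of f_1, exceeds all the others, so one derivation moves the leading exponent up
    by 1 and multiplies its coefficient by d f_1. *)
Let iter_top (d : {additive F -> F}) (D : diffop F) s H k :
    (forall p H s, fd_act G (D * p) H s =
       d (fd_act G p H s) + \sum_(e <- fd_terms G) d e.2 * fd_act G p H (s - e.1)) ->
    (forall t, s < t -> H t = 0) ->
  fd_act G (D ^+ k) H (s + k%:R) = d (fd_head G) ^+ k * H s /\
  forall t, s + k%:R < t -> fd_act G (D ^+ k) H t = 0.
Proof.
move=> Dd top; elim: k => [|k [IHs IHt]].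
  by rewrite !expr0 mul1r addr0 fd_act1; split=> // t; rewrite ?addr0 fd_act1; exact: top.
rewrite !exprS -natr1; split=> [|t lt]; rewrite Dd big_cons /=.
  rewrite IHt ?raddf0 ?add0r; last by lra.
  rewrite addrA addrK IHs mulrA big_seq big1 ?addr0 // => e /fd_exponents_lt1/andP[_ e1].
  by rewrite IHt ?mulr0 //; lra.
rewrite IHt ?raddf0 ?add0r; last by lra.
rewrite IHt ?mulr0 ?add0r; last by lra.
rewrite big_seq big1 // => e /fd_exponents_lt1/andP[_ e1].
by rewrite IHt ?mulr0 //; lra.
Qed.

(** Only the largest [i] with c_i nonzero reaches exponent s + i. *)
Let sum_act_neq0 (d : {additive F -> F}) (D : diffop F) s H N (c : nat -> F) :
    (forall p H s, fd_act G (D * p) H s =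
       d (fd_act G p H s) + \sum_(e <- fd_terms G) d e.2 * fd_act G p H (s - e.1)) ->
    d (fd_head G) != 0 -> H s != 0 -> (forall t, s < t -> H t = 0) ->
    (exists2 i, (i < N)%N & c i != 0) ->
  fd_act G (\sum_(i < N) c i *: D ^+ i) H <> 0.
Proof.
move=> Dd d0 Hs top [i0 i0N ci0].
have [] := @ex_maxnP (fun i => (i < N)%N && (c i != 0)) N.
- by exists i0; rewrite i0N.
- by move=> i /andP[/ltnW].
move=> i /andP[iN ci] max.
have sumE t : fd_act G (\sum_(i < N) c i *: D ^+ i) H t = \sum_(i < N) c i * fd_act G (D ^+ i) H t.
  have E : fd_act G 0 H t = 0 by rewrite /fd_act act0.
  rewrite (big_morph (fun p => fd_act G p H t) (fun p r => fd_actD G p r H t) E).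
  by apply: eq_bigr => k _; rewrite fd_actZ.
move=> /(congr1 (fun f => f (s + i%:R))); rewrite sumE (bigD1 (Ordinal iN)) //=.
rewrite (iter_top i Dd top).1 big1 ?addr0; last first.
  move=> k /eqP ki; case: (ltnP i k) => ik.
    rewrite (_ : c k = 0) ?mul0r //; apply/eqP; apply/negPn/negP => ck.
    by have := max k; rewrite ltn_ord ck leqNgt ik => /(_ isT).
  have lt : (k < i)%N by rewrite ltn_neqAle ik andbT; apply/eqP => E; apply: ki; apply: val_inj.
  by rewrite (iter_top k Dd top).2 ?mulr0 // ltrD2l ltr_nat.
by move/eqP; rewrite !mulf_eq0 (negPf ci) (negPf Hs) expf_eq0 (negPf d0) andbF.
Qed.

Lemma sum_dx_act_neq0 p H N (c : nat -> F) :
    dx (fd_head G) != 0 -> is_fd_series G H -> fd_act G p H <> 0 ->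
    (exists2 i, (i < N)%N & c i != 0) ->
  fd_act G (\sum_(i < N) c i *: opdx F ^+ i) (fd_act G p H) <> 0.
Proof.
move=> d0 HG nz; have [s [Hs top]] := fd_act_top HG nz.
apply: (sum_act_neq0 (d := @dx F)) Hs top => //; exact: fd_act_dx.
Qed.

Lemma sum_dy_act_neq0 p H N (c : nat -> F) :
    dy (fd_head G) != 0 -> is_fd_series G H -> fd_act G p H <> 0 ->
    (exists2 i, (i < N)%N & c i != 0) ->
  fd_act G (\sum_(i < N) c i *: opdy F ^+ i) (fd_act G p H) <> 0.
Proof.
move=> d0 HG nz; have [s [Hs top]] := fd_act_top HG nz.
apply: (sum_act_neq0 (d := @dy F)) Hs top => //; exact: fd_act_dy.
Qed.

End LeadingExponent.

(** * Linear equations over a universal field *)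

Section GeneratedSubfield.
Variables (L : diffFieldType) (S : L -> Prop).

(** The intersection of all differential subfields containing [S], made a boolean predicate so that
    the subtype constructions endow it with a field structure. *)
Definition generated : {pred L} := fun x =>
  `[< forall P, diff_subfield P -> (forall a, S a -> P a) -> P x >].

Lemma generatedP x : reflect (forall P, diff_subfield P -> (forall a, S a -> P a) -> P x)
  (x \in generated).
Proof. exact: asboolP. Qed.

Lemma generated_closed : GRing.divring_closed generated.
Proof.
split.
- by apply/generatedP => P [].
- move=> x y /generatedP xP /generatedP yP; apply/generatedP => P PP SP.
  by have [_ PB _ _ _] := PP; apply: PB; [exact: xP|exact: yP].
- move=> x y /generatedP xP /generatedP yP; apply/generatedP => P PP SP.
  by have [_ _ Pd _ _] := PP; apply: Pd; [exact: xP|exact: yP].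
Qed.

HB.instance Definition _ := GRing.isDivringClosed.Build L generated generated_closed.

Lemma generated_dx x : x \in generated -> dx x \in generated.
Proof.
move=> /generatedP xP; apply/generatedP => P PP SP.
by have [_ _ _ Pd _] := PP; apply: Pd; exact: xP.
Qed.
Lemma generated_dy x : x \in generated -> dy x \in generated.
Proof.
move=> /generatedP xP; apply/generatedP => P PP SP.
by have [_ _ _ _ Pd] := PP; apply: Pd; exact: xP.
Qed.
Lemma generated_sub x : S x -> x \in generated.
Proof. by move=> Sx; apply/generatedP => P _; exact. Qed.

Record gen_field := GenField { gen_val : L; gen_valP : gen_val \in generated }.

HB.instance Definition _ := [isSub for gen_val].
HB.instance Definition _ := [Choice of gen_field by <:].
HB.instance Definition _ := [SubChoice_isSubIntegralDomain of gen_field by <:].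
HB.instance Definition _ :=
  [SubIntegralDomain_isSubField of gen_field by <:].

Definition gen_dx (x : gen_field) : gen_field := GenField (generated_dx (gen_valP x)).
Definition gen_dy (x : gen_field) : gen_field := GenField (generated_dy (gen_valP x)).

Let gen_dxD a b : gen_dx (a + b) = gen_dx a + gen_dx b.
Proof. by apply: val_inj; exact: dxD. Qed.
Let gen_dyD a b : gen_dy (a + b) = gen_dy a + gen_dy b.
Proof. by apply: val_inj; exact: dyD. Qed.
Let gen_dxM a b : gen_dx (a * b) = gen_dx a * b + a * gen_dx b.
Proof. by apply: val_inj; exact: dxM. Qed.
Let gen_dyM a b : gen_dy (a * b) = gen_dy a * b + a * gen_dy b.
Proof. by apply: val_inj; exact: dyM. Qed.
Let gen_dC a : gen_dx (gen_dy a) = gen_dy (gen_dx a).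
Proof. by apply: val_inj; exact: dxdyC. Qed.

HB.instance Definition _ := Field_hasTwoDerivations.Build gen_field
  gen_dxD gen_dyD gen_dxM gen_dyM gen_dC.

Lemma gen_val_morphism : diff_morphism (\val : {rmorphism gen_field -> L}).
Proof. by split. Qed.

Lemma gen_generates : diff_generates (fun x : gen_field => S (gen_val x)).
Proof.
move=> P [P1 PB Pd Px Py] SP a.
pose Q x := exists2 b : gen_field, x = gen_val b & P b.
suff [b /val_inj ->] : Q (gen_val a) by [].
have := gen_valP a => /generatedP; apply.
  split.
  - by exists 1.
  - by move=> x y [b -> Pb] [c -> Pc]; exists (b - c) => //; exact: PB.
  - by move=> x y [b -> Pb] [c -> Pc]; exists (b / c); [rewrite -[RHS]/(val (b / c)) fmorph_div|exact: Pd].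
  - by move=> x [b -> Pb]; exists (dx b) => //; exact: Px.
  - by move=> x [b -> Pb]; exists (dy b) => //; exact: Py.
by move=> x Sx; exists (GenField (generated_sub Sx)) => //; exact: SP.
Qed.

End GeneratedSubfield.

(* Hurwitz series: f i j is the value at 0 of the derivative d_x^i d_y^j f, so *)
(* that the derivations are shifts. The product is determined by the Leibniz   *)
(* rule and its value at 0.                                                    *)
Definition hurwitz (E : diffFieldType) (char0 : [pchar E] =i pred0) : Type :=
  nat -> nat -> E.

Section Hurwitz.
Variables (E : diffFieldType) (char0 : [pchar E] =i pred0).
Local Notation H := (hurwitz char0).
Implicit Types f g h : H.

HB.instance Definition _ := Choice.copy H (nat -> nat -> E).
HB.instance Definition _ := GRing.Zmodule.copy H (nat -> nat -> E).

Definition hshx f : H := fun i j => f i.+1 j.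
Definition hshy f : H := fun i j => f i j.+1.

Fixpoint hmul0 (j : nat) f g : E :=
  if j is j'.+1 then hmul0 j' (hshy f) g + hmul0 j' f (hshy g) else f 0%N 0%N * g 0%N 0%N.
Fixpoint hmul_rec (i j : nat) f g : E :=
  if i is i'.+1 then hmul_rec i' j (hshx f) g + hmul_rec i' j f (hshx g) else hmul0 j f g.
Definition hmul f g : H := fun i j => hmul_rec i j f g.
Definition hone : H := fun i j => if (i == 0%N) && (j == 0%N) then 1 else 0.

Lemma hurwitzP f g : (forall i j, f i j = g i j) -> f = g.
Proof. by move=> E'; apply/funext => i; apply/funext => j. Qed.

Lemma hshxD f g : hshx (f + g) = hshx f + hshx g. Proof. by []. Qed.
Lemma hshyD f g : hshy (f + g) = hshy f + hshy g. Proof. by []. Qed.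
Lemma haddE f g i j : (f + g) i j = f i j + g i j. Proof. by []. Qed.

Lemma hmul00 f g : hmul f g 0 0 = f 0 0 * g 0 0. Proof. by []. Qed.
Lemma hshx_mul f g : hshx (hmul f g) = hmul (hshx f) g + hmul f (hshx g).
Proof. by []. Qed.
Lemma hshy_mul f g : hshy (hmul f g) = hmul (hshy f) g + hmul f (hshy g).
Proof.
apply: hurwitzP => i j; rewrite /hshy /hmul haddE.
elim: i f g => //= i IH f g.
by rewrite !IH addrACA.
Qed.

Lemma hmulDl : left_distributive hmul +%R.
Proof.
move=> f g h; apply: hurwitzP => i j; rewrite /hmul haddE.
elim: i f g h => [|i IH] f g h /=; last by rewrite hshxD !IH addrACA.
elim: j f g h => [|j IH] f g h /=; last by rewrite hshyD !IH addrACA.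
exact: mulrDl.
Qed.

Lemma hmulC : commutative hmul.
Proof.
move=> f g; apply: hurwitzP => i j; rewrite /hmul.
elim: i f g => [|i IH] f g /=; last by rewrite addrC (IH f) (IH (hshx f)).
elim: j f g => [|j IH] f g /=; last by rewrite addrC (IH f) (IH (hshy f)).
exact: mulrC.
Qed.

Lemma hmulDr : right_distributive hmul +%R.
Proof. by move=> f g h; rewrite hmulC hmulDl !(hmulC f). Qed.

Lemma hmul1 : left_id hone hmul.
Proof.
move=> f; apply: hurwitzP => i j.
have z g k l : hmul (0 : H) g k l = 0.
  have : hmul (0 + 0 : H) g k l = hmul (0 : H) g k l by rewrite addr0.
  by rewrite hmulDl haddE => e; apply: (addrI (hmul (0 : H) g k l)); rewrite e addr0.
have sx : hshx hone = 0 by apply: hurwitzP.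
have sy : hshy hone = 0.
  by apply: hurwitzP => k l; rewrite /hshy /hone andbF.
elim: i f j => [|i IH] f j.
  elim: j f => [|j IH] f; first by rewrite hmul00 /hone /= mul1r.
  by rewrite -[LHS]/(hshy (hmul hone f) 0%N j) hshy_mul haddE sy z add0r IH.
by rewrite -[LHS]/(hshx (hmul hone f) i j) hshx_mul haddE sx z add0r IH.
Qed.

Lemma hmulA : associative hmul.
Proof.
move=> f g h; apply: hurwitzP => i j.
elim: i f g h => [|i IH] f g h.
  elim: j f g h => [|j IH] f g h; first by rewrite !hmul00 mulrA.
  rewrite -[LHS]/(hshy (hmul f (hmul g h)) 0%N j) -[RHS]/(hshy (hmul (hmul f g) h) 0%N j).
  by rewrite !hshy_mul hmulDl hmulDr !haddE !IH addrA.
rewrite -[LHS]/(hshx (hmul f (hmul g h)) i j) -[RHS]/(hshx (hmul (hmul f g) h) i j).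
by rewrite !hshx_mul hmulDl hmulDr !haddE !IH addrA.
Qed.

Lemma hone_neq0 : hone != 0.
Proof.
by apply/eqP => /(congr1 (fun f : H => f 0%N 0%N)) /eqP; rewrite /hone /= oner_eq0.
Qed.

HB.instance Definition _ := GRing.Zmodule_isComNzRing.Build H
  hmulA hmulC hmul1 hmulDl hone_neq0.

Lemma hmulE f g : f * g = hmul f g. Proof. by []. Qed.

(** A lower bound for the lexicographic valuation, which serves to exclude zero divisors. *)
Definition hlead f (a1 a2 : nat) :=
  forall i j, (i < a1)%N || ((i == a1) && (j < a2)%N) -> f i j = 0.

Lemma hlead_shx f a1 a2 : hlead f a1 a2 ->
  hlead (hshx f) a1.-1 (if a1 is 0 then 0 else a2).
Proof. by case: a1 => [|a1] fa i j ij; [rewrite ltn0 andbF in ij|apply: fa; lia]. Qed.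
Lemma hlead_shy f a1 a2 : hlead f a1 a2 -> hlead (hshy f) a1 a2.-1.
Proof. by move=> fa i j ij; apply: fa; lia. Qed.

Lemma hmul_vanish f g a1 a2 b1 b2 i j : hlead f a1 a2 -> hlead g b1 b2 ->
  (i < a1 + b1)%N || ((i == a1 + b1)%N && (j < a2 + b2)%N) -> hmul f g i j = 0.
Proof.
rewrite /hmul; elim: i f g a1 a2 b1 b2 => [|i IH] f g a1 a2 b1 b2 fa gb ij /=.
  elim: j f g a2 b2 fa gb ij => [|j IHj] f g a2 b2 fa gb ij /=.
    case: (boolP ((0 < a1)%N || (0 < a2)%N)) => ha; first by rewrite fa ?mul0r //; lia.
    by rewrite gb ?mulr0 //; lia.
  rewrite (IHj _ _ a2.-1 b2 (hlead_shy fa) gb) ?(IHj _ _ a2 b2.-1 fa (hlead_shy gb)) ?addr0 //.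
  - by move: ij; case: (a2) => [|a2'] /=; lia.
  - by move: ij; case: (b2) => [|b2'] /=; lia.
rewrite (IH _ _ _ _ b1 b2 (hlead_shx fa) gb) ?add0r; last first.
  by move: ij; case: (a1) => [|a1'] /=; lia.
apply: (IH _ _ a1 a2 _ _ fa (hlead_shx gb)).
by move: ij; case: (b1) => [|b1'] /=; lia.
Qed.

(** The integer is a product of binomial coefficients. Its positivity suffices: in characteristic 0
    the leading term of a product is nonzero. *)
Lemma hmul_lead f g a1 a2 b1 b2 : hlead f a1 a2 -> hlead g b1 b2 ->
  exists c : nat, hmul f g (a1 + b1)%N (a2 + b2)%N = c.+1%:R * (f a1 a2 * g b1 b2).
Proof.
move iE : (a1 + b1)%N => i; move jE : (a2 + b2)%N => j.
elim: i f g a1 a2 b1 b2 iE jE => [|i IH] f g a1 a2 b1 b2 iE jE fa gb.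
  have [a10 b10] : a1 = 0%N /\ b1 = 0%N by lia.
  subst a1 b1; elim: j f g a2 b2 jE fa gb => [|j IHj] f g a2 b2 jE fa gb.
    have [-> ->] : a2 = 0%N /\ b2 = 0%N by lia.
    by exists 0%N; rewrite mul1r.
  rewrite /hmul /= -/(hmul _ _ 0 j) -!/(hmul_rec 0 j _ _) -!/(hmul _ _ 0%N j).
  (* The half of the Leibniz rule that differentiates a factor with a = 0 contributes nothing; as a
     + b is positive, the two halves do not both vanish. *)
  have ga (f' g' : H) a b : hlead f' 0 a -> hlead g' 0 b -> (a + b)%N = j.+1 ->
    exists c : nat, hmul (hshy f') g' 0 j = (if a is 0 then 0 else c.+1)%:R * (f' 0%N a * g' 0%N b).
    case: a => [|a] fa' gb' e.
      exists 0%N; rewrite mul0r; apply: (hmul_vanish (hlead_shy fa') gb').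
      by rewrite /=; lia.
    have [|c cE] := IHj (hshy f') g' a b _ (hlead_shy fa') gb'; first by lia.
    by exists c.
  have [c1 E1] := ga f g a2 b2 fa gb jE.
  have [c2 E2] := ga g f b2 a2 gb fa (etrans (addnC _ _) jE).
  rewrite E1 hmulC E2 [g _ _ * _]mulrC -mulrDl -natrD.
  exists ((if a2 is 0 then 0 else c1.+1) + (if b2 is 0 then 0 else c2.+1)).-1%N.
  rewrite prednK //; case: (a2) (b2) jE => [|?] [|?] //=; lia.
have ga (f' g' : H) a a' b b' : hlead f' a a' -> hlead g' b b' -> (a + b)%N = i.+1 ->
    (a' + b')%N = j ->
    exists c : nat, hmul (hshx f') g' i j = (if a is 0 then 0 else c.+1)%:R * (f' a a' * g' b b').
  case: a => [|a] fa' gb' e e'.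
    exists 0%N; rewrite mul0r; apply: (hmul_vanish (hlead_shx fa') gb').
    by rewrite /=; lia.
  have [||c cE] := IH (hshx f') g' a a' b b' _ _ (hlead_shx fa') gb'; [lia|lia|].
  by exists c.
have [c1 E1] := ga f g a1 a2 b1 b2 fa gb iE jE.
have [c2 E2] := ga g f b1 b2 a1 a2 gb fa (etrans (addnC _ _) iE) (etrans (addnC _ _) jE).
rewrite (_ : hmul f g i.+1 j = hmul (hshx f) g i j + hmul f (hshx g) i j) //.
rewrite E1 (hmulC f) E2 [g _ _ * _]mulrC -mulrDl -natrD.
exists ((if a1 is 0 then 0 else c1.+1) + (if b1 is 0 then 0 else c2.+1)).-1%N.
rewrite prednK //; case: (a1) (b1) iE => [|?] [|?] //=; lia.
Qed.

Lemma hlead_exists f : f != 0 -> exists a1 a2, hlead f a1 a2 /\ f a1 a2 != 0.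
Proof.
move=> f0; have exi : exists i, `[< exists j, f i j != 0 >].
  apply: contrapT => no; case/eqP: f0; apply: hurwitzP => i j.
  apply/eqP; apply/negPn/negP => nz; apply: no; exists i; apply/asboolP; by exists j.
case: (ex_minnP exi) => i /asboolP exj mini; case: (ex_minnP exj) => j fij minj.
exists i, j; split=> // i' j' /orP[ii|/andP[/eqP -> jj]].
  apply/eqP; apply/negPn/negP => nz.
  have /mini : `[< exists j, f i' j != 0 >] by apply/asboolP; exists j'.
  by rewrite leqNgt ii.
by apply/eqP; apply/negPn/negP => /minj; rewrite leqNgt jj.
Qed.

Lemma hmul_eq0 f g : f * g = 0 -> (f == 0) || (g == 0).
Proof.
move=> fg0; apply/norP => -[f0 g0].
have [a1 [a2 [fa fa0]]] := hlead_exists f0; have [b1 [b2 [gb gb0]]] := hlead_exists g0.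
have [c] := hmul_lead fa gb; rewrite -hmulE fg0 => /eqP; rewrite eq_sym.
by rewrite !mulf_eq0 ((pcharf0P E).1 char0) (negPf fa0) (negPf gb0).
Qed.

Definition hunit : pred H := fun f => `[< exists g, g * f = 1 >].
Definition hinv f : H := if pselect (exists g, g * f = 1) is left e then projT1 (cid e) else f.

Lemma hmulV : {in hunit, left_inverse 1 hinv *%R}.
Proof.
move=> f /asboolP e; rewrite /hinv; case: pselect => // e'.
by case: (cid e').
Qed.
Lemma hunitP f g : g * f = 1 -> hunit f.
Proof. by move=> e; apply/asboolP; exists g. Qed.
Lemma hinv_out : {in [predC hunit], hinv =1 id}.
Proof.
by move=> f /asboolP ne; rewrite /hinv; case: pselect.
Qed.
HB.instance Definition _ := GRing.ComNzRing_hasMulInverse.Build H hmulV hunitP hinv_out.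
HB.instance Definition _ := GRing.ComUnitRing_isIntegral.Build H hmul_eq0.

(** The Taylor expansion: an element goes to the table of its derivatives, which embeds [E]
    compatibly with the derivations. *)
Definition htaylor (a : E) : H := fun i j => iter i (@dx E) (iter j (@dy E) a).

Lemma htaylor_shx a : hshx (htaylor a) = htaylor (dx a).
Proof.
apply: hurwitzP => i j; rewrite /hshx /htaylor iterSr; congr iter.
by elim: j => //= j <-; rewrite dxdyC.
Qed.
Lemma htaylor_shy a : hshy (htaylor a) = htaylor (dy a).
Proof. by apply: hurwitzP => i j; rewrite /hshy /htaylor iterSr. Qed.

Lemma htaylor_zmod : zmod_morphism htaylor.
Proof.
move=> a b; apply: hurwitzP => i j; rewrite /htaylor !fctE.
have -> : iter j (@dy E) (a - b) = iter j (@dy E) a - iter j (@dy E) b.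
  by elim: j => //= j ->; rewrite raddfB.
by elim: i => //= i ->; rewrite raddfB.
Qed.
HB.instance Definition _ := GRing.isZmodMorphism.Build E H htaylor htaylor_zmod.

Lemma htaylorD a b : htaylor (a + b) = htaylor a + htaylor b.
Proof. exact: raddfD. Qed.

Lemma htaylor_monoid : monoid_morphism htaylor.
Proof.
split=> [|a b].
  have z : htaylor 0 = 0 by rewrite raddf0.
  apply: hurwitzP => i j; case: i => [|i]; last first.
    by rewrite -[LHS]/(hshx (htaylor 1) i j) htaylor_shx dx1 z.
  case: j => // j.
  by rewrite -[LHS]/(hshy (htaylor 1) 0%N j) htaylor_shy dy1 z.
apply: hurwitzP => i j; elim: i a b => [|i IH] a b; last first.
  rewrite -[LHS]/(hshx (htaylor (a * b)) i j) htaylor_shx dxM htaylorD haddE !IH.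
  by rewrite -[RHS]/(hshx (hmul _ _) i j) hshx_mul !htaylor_shx.
elim: j a b => [|j IH] a b //.
rewrite -[LHS]/(hshy (htaylor (a * b)) 0%N j) htaylor_shy dyM htaylorD haddE !IH.
by rewrite -[RHS]/(hshy (hmul _ _) 0%N j) hshy_mul !htaylor_shy.
Qed.
HB.instance Definition _ := GRing.isMonoidMorphism.Build E H htaylor htaylor_monoid.

Definition hscale (a : E) f : H := htaylor a * f.

Let hscaleA a b f : hscale a (hscale b f) = hscale (a * b) f.
Proof. by rewrite /hscale mulrA rmorphM. Qed.
Let hscale1 : left_id 1 hscale.
Proof. by move=> f; rewrite /hscale rmorph1 mul1r. Qed.
Let hscaleDr : right_distributive hscale +%R.
Proof. by move=> a f g; rewrite /hscale mulrDr. Qed.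
Let hscaleDl f : {morph hscale^~ f : a b / a + b}.
Proof. by move=> a b; rewrite /hscale raddfD mulrDl. Qed.
HB.instance Definition _ := GRing.Zmodule_isLmodule.Build E H hscaleA hscale1 hscaleDr hscaleDl.

Lemma hscaleE (a : E) f : a *: f = htaylor a * f. Proof. by []. Qed.

Lemma hurwitz_action : @diff_action E H hshx hshy.
Proof.
split=> // a f; rewrite !hscaleE !hmulE.
- by rewrite hshx_mul htaylor_shx.
- by rewrite hshy_mul htaylor_shy.
Qed.

End Hurwitz.

(** * Derivations on fraction fields *)

Lemma quotient_rule_add (K : fieldType) (a a' b b' da da' db db' : K) :
    b != 0 -> b' != 0 ->
  ((da * b' + a * db' + (da' * b + a' * db)) * (b * b') -
     (a * b' + a' * b) * (db * b' + b * db')) / (b * b') ^+ 2 =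
  (da * b - a * db) / b ^+ 2 + (da' * b' - a' * db') / b' ^+ 2.
Proof. by move=> b0 b'0; field; rewrite b0 b'0. Qed.

Lemma quotient_rule_mul (K : fieldType) (a a' b b' da da' db db' : K) :
    b != 0 -> b' != 0 ->
  ((da * a' + a * da') * (b * b') - a * a' * (db * b' + b * db')) / (b * b') ^+ 2 =
  (da * b - a * db) / b ^+ 2 * (a' / b') + a / b * ((da' * b' - a' * db') / b' ^+ 2).
Proof. by move=> b0 b'0; field; rewrite b0 b'0. Qed.

(** The mixed terms cancel. Commutation of two derivations can thus be checked on generators. *)
Lemma commutator_derivation (K : comNzRingType) (d1 d2 : K -> K) :
    (forall a b, d1 (a + b) = d1 a + d1 b) -> (forall a b, d2 (a + b) = d2 a + d2 b) ->
    (forall a b, d1 (a * b) = d1 a * b + a * d1 b) ->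
    (forall a b, d2 (a * b) = d2 a * b + a * d2 b) ->
  let c x := d1 (d2 x) - d2 (d1 x) in forall a b, c (a * b) = c a * b + a * c b.
Proof.
move=> d1D d2D d1M d2M c a b.
by rewrite /c !(d1M, d2M, d1D, d2D); ring.
Qed.

Section FractionDerivation.
Variable R : idomainType.
Local Notation "x %:F" := (FracField.tofrac x).
Implicit Types (x y : {fraction R}) (a b : R).

Lemma fractionP x : exists ab : R * R, ab.2 != 0 /\ x = ab.1%:F / ab.2%:F.
Proof.
elim/quotP: x => x _; exists (\n_x, \d_x); split; first exact: denom_ratioP.
have d0 : (\d_x)%:F != 0 by rewrite tofrac_eq0 denom_ratioP.
apply: (mulIf d0); rewrite /= divfK //; unlock FracField.tofrac.
rewrite -[LHS]FracField.pi_mul /FracField.mulf !numden_Ratio ?oner_neq0 ?mulr1 ?denom_ratioP //.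
apply/eqmodP; rewrite /= FracField.equivfE.
by rewrite !numden_Ratio ?oner_neq0 ?denom_ratioP // mulr1 mulrC.
Qed.

Definition fnum x := (projT1 (cid (fractionP x))).1.
Definition fden x := (projT1 (cid (fractionP x))).2.

Lemma fden_neq0 x : fden x != 0.
Proof. by rewrite /fden; case: (cid _) => ab []. Qed.
Lemma fnumden x : x = (fnum x)%:F / (fden x)%:F.
Proof. by rewrite /fnum /fden; case: (cid _) => ab []. Qed.

Variable d : {additive R -> R}.
Hypothesis dM : forall a b, d (a * b) = d a * b + a * d b.

Definition fder x : {fraction R} :=
  ((d (fnum x))%:F * (fden x)%:F - (fnum x)%:F * (d (fden x))%:F) / (fden x)%:F ^+ 2.

(** Differentiating n b = a m shows that the quotient rule does not depend on the fraction chosen in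
    [fder]. *)
Lemma fderE a b : b != 0 ->
  fder (a%:F / b%:F) = ((d a)%:F * b%:F - a%:F * (d b)%:F) / b%:F ^+ 2.
Proof.
move=> b0; set x := a%:F / b%:F.
have E : fnum x * b = a * fden x.
  apply/eqP; rewrite -tofrac_eq !rmorphM /=; apply/eqP.
  have m0 : (fden x)%:F != 0 by rewrite tofrac_eq0 fden_neq0.
  have b0' : b%:F != 0 by rewrite tofrac_eq0.
  have := fnumden x; rewrite {1}/x => /eqP; rewrite eqr_div // => /eqP ->.
  by rewrite mulrC.
rewrite /fder; have m0 := fden_neq0 x.
set n := fnum x in E *; set m := fden x in E m0 *.
have dE : d n * b + n * d b = d a * m + a * d m by rewrite -!dM E.
have mF : m%:F != 0 by rewrite tofrac_eq0.
have bF : b%:F != 0 by rewrite tofrac_eq0.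
have key : (d n * m - n * d m) * b ^+ 2 = (d a * b - a * d b) * m ^+ 2.
  have e1 : d n * b = d a * m + a * d m - n * d b by rewrite -dE addrK.
  have -> : (d n * m - n * d m) * b ^+ 2 = m * b * (d n * b) - (n * b) * d m * b by ring.
  rewrite e1 E.
  have -> : m * b * (d a * m + a * d m - n * d b) = m * b * (d a * m + a * d m) - m * (n * b) * d b by ring.
  by rewrite E; ring.
apply/eqP; rewrite eqr_div ?expf_neq0 // -!rmorphXn -!rmorphM -!rmorphB -!rmorphM /=.
by rewrite key.
Qed.

Lemma fder_tofrac a : fder a%:F = (d a)%:F.
Proof.
have d1 : d 1 = 0 by apply: (addrI (d 1)); rewrite addr0 -{3}[1]mulr1 dM mulr1 mul1r.
have -> : a%:F = a%:F / 1%:F by rewrite rmorph1 divr1.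
rewrite fderE ?oner_neq0 // d1 rmorph0 mulr0 subr0 rmorph1 expr1n divr1.
by rewrite mulr1.
Qed.

Lemma fder_frac x : exists a b, [/\ b%:F != 0 :> {fraction R}, x = a%:F / b%:F &
  fder x = ((d a)%:F * b%:F - a%:F * (d b)%:F) / b%:F ^+ 2].
Proof.
exists (fnum x), (fden x); split=> //; first by rewrite tofrac_eq0 fden_neq0.
exact: fnumden.
Qed.

Lemma fderD x y : fder (x + y) = fder x + fder y.
Proof.
have [a [b [b0 xE ->]]] := fder_frac x; have [a' [b' [b'0 yE ->]]] := fder_frac y.
have -> : x + y = (a * b' + a' * b)%:F / (b * b')%:F.
  by rewrite xE yE addf_div // rmorphD !rmorphM.
rewrite fderE; last by rewrite -tofrac_eq0 rmorphM mulf_neq0.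
rewrite raddfD !dM !rmorphD !rmorphM /=.
exact: quotient_rule_add.
Qed.

Lemma fderM x y : fder (x * y) = fder x * y + x * fder y.
Proof.
have [a [b [b0 xE ->]]] := fder_frac x; have [a' [b' [b'0 yE ->]]] := fder_frac y.
have -> : x * y = (a * a')%:F / (b * b')%:F.
  by rewrite xE yE mulf_div !rmorphM.
rewrite fderE; last by rewrite -tofrac_eq0 rmorphM mulf_neq0.
rewrite xE yE !dM !rmorphD !rmorphM /=.
exact: quotient_rule_mul.
Qed.

End FractionDerivation.

Definition hfrac (E : diffFieldType) (char0 : [pchar E] =i pred0) : Type :=
  {fraction (hurwitz char0)}.

Section HFrac.
Variables (E : diffFieldType) (char0 : [pchar E] =i pred0).
Local Notation H := (hurwitz char0).
Local Notation "x %:F" := (FracField.tofrac x).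

Lemma hshx_zmod : zmod_morphism (@hshx E char0). Proof. by []. Qed.
Lemma hshy_zmod : zmod_morphism (@hshy E char0). Proof. by []. Qed.
HB.instance Definition _ := GRing.isZmodMorphism.Build H H (@hshx E char0) hshx_zmod.
HB.instance Definition _ := GRing.isZmodMorphism.Build H H (@hshy E char0) hshy_zmod.

HB.instance Definition _ := GRing.Field.copy (hfrac char0) {fraction H}.

Definition hfdx : hfrac char0 -> hfrac char0 := fder (@hshx E char0).
Definition hfdy : hfrac char0 -> hfrac char0 := fder (@hshy E char0).

Let hshxM : forall a b : H, hshx (a * b) = hshx a * b + a * hshx b.
Proof. exact: hshx_mul. Qed.
Let hshyM : forall a b : H, hshy (a * b) = hshy a * b + a * hshy b.
Proof. exact: hshy_mul. Qed.
Let fxD : forall a b, hfdx (a + b) = hfdx a + hfdx b.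
Proof. exact: fderD hshxM. Qed.
Let fyD : forall a b, hfdy (a + b) = hfdy a + hfdy b.
Proof. exact: fderD hshyM. Qed.
Let fxM : forall a b, hfdx (a * b) = hfdx a * b + a * hfdx b.
Proof. exact: fderM hshxM. Qed.
Let fyM : forall a b, hfdy (a * b) = hfdy a * b + a * hfdy b.
Proof. exact: fderM hshyM. Qed.

(* [d_x, d_y] is a derivation vanishing on the numerator and the denominator.  *)
Let fC : forall a, hfdx (hfdy a) = hfdy (hfdx a).
Proof.
have cF (a : H) : hfdx (hfdy a%:F) = hfdy (hfdx a%:F).
  by rewrite /hfdx /hfdy !fder_tofrac.
move=> x; have [[a b] [/= b0 xE]] := fractionP x.
have bF : b%:F != 0 by rewrite tofrac_eq0.
have := commutator_derivation fxD fyD fxM fyM x b%:F.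
have -> : x * b%:F = a%:F by rewrite xE divfK.
rewrite !cF !subrr mulr0 addr0 => /esym/eqP.
by rewrite mulf_eq0 (negPf bF) orbF subr_eq0 => /eqP.
Qed.

HB.instance Definition _ := Field_hasTwoDerivations.Build (hfrac char0) fxD fyD fxM fyM fC.

Definition hfrac_of (f : H) : hfrac char0 := f%:F.

Lemma hfrac_of_zmod : zmod_morphism hfrac_of. Proof. exact: rmorphB. Qed.
Lemma hfrac_of_monoid : monoid_morphism hfrac_of.
Proof. by split; [exact: rmorph1|exact: rmorphM]. Qed.
HB.instance Definition _ := GRing.isZmodMorphism.Build H (hfrac char0) hfrac_of hfrac_of_zmod.
HB.instance Definition _ := GRing.isMonoidMorphism.Build H (hfrac char0) hfrac_of hfrac_of_monoid.

Lemma hfrac_of_dx f : dx (hfrac_of f) = hfrac_of (hshx f).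
Proof. exact: fder_tofrac hshxM f. Qed.
Lemma hfrac_of_dy f : dy (hfrac_of f) = hfrac_of (hshy f).
Proof. exact: fder_tofrac hshyM f. Qed.
Lemma hfrac_of_eq0 f : (hfrac_of f == 0) = (f == 0).
Proof. exact: tofrac_eq0. Qed.

End HFrac.

(** [K0] may be large, but the differential subfield generated by the image of [E] and by [y] is
    finitely generated over [E], so universality sends it to [F]. Field morphisms being injective,
    equations and inequations satisfied by [y] are carried along. *)
Lemma universal_extension (F : diffFieldType) (s : seq F) :
    kolchin_universal F ->
  let E := gen_field (fun a : F => a \in s) in
  forall (K0 : diffFieldType) (j0 : {rmorphism E -> K0}) (y : K0), diff_morphism j0 ->
  exists (K : diffFieldType) (j : E -> K) (yK : K) (v : {rmorphism K -> K0})
    (hK : {rmorphism K -> F}),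
  [/\ diff_morphism v, diff_morphism hK, v yK = y, forall e, v (j e) = j0 e
    & forall e, hK (j e) = gen_val e].
Proof.
move=> univF E K0 j0 y [j0x j0y].
pose S (x : K0) := (exists e, x = j0 e) \/ x = y.
pose K := gen_field S.
have Sj e : S (j0 e) by left; exists e.
pose j (e : E) : K := GenField (generated_sub (Sj e)).
have jB : zmod_morphism j by move=> a b; apply: val_inj; exact: rmorphB.
have jM : monoid_morphism j.
  by split=> [|a b]; apply: val_inj; [exact: rmorph1|exact: rmorphM].
pose jR : {rmorphism E -> K} := HB.pack j (GRing.isZmodMorphism.Build E K j jB)
  (GRing.isMonoidMorphism.Build E K j jM).
have jd : diff_morphism jR.
  by split=> a; apply: val_inj; [exact: j0x|exact: j0y].
have yS : S y by right.
pose yK : K := GenField (generated_sub yS).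
have fgE : diff_finitely_generated E.
  exists (pmap insub s) => P PP SP; apply: (gen_generates PP) => a sa.
  by apply: SP; rewrite mem_pmap_sub.
have fgK : diff_finitely_generated_over jR.
  exists [:: yK] => P PP SP; apply: (gen_generates PP) => a [[e ae]|ay]; apply: SP.
    by left; exists e; apply: val_inj.
  by right; rewrite inE; apply/eqP; apply: val_inj.
have [hK [hKd hKj]] := univF E _ (gen_val_morphism (fun a => a \in s)) fgE K jR jd fgK.
exists K, j, yK, (\val : {rmorphism K -> K0}), hK; split=> //.
Qed.

Lemma big_ord_support (V : nmodType) (f : nat -> V) m n :
    (forall i, (m <= i)%N -> f i = 0) -> (forall i, (n <= i)%N -> f i = 0) ->
  \sum_(i < m) f i = \sum_(i < n) f i.
Proof.
move=> fm fn; have gen k l : (k <= l)%N -> (forall i, (k <= i)%N -> f i = 0) ->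
    \sum_(i < k) f i = \sum_(i < l) f i.
  move=> kl f0; rewrite (big_ord_widen _ f kl) big_mkcond; apply: eq_bigr => i _.
  by case: ltnP => // /f0.
rewrite (gen m (maxn m n)) ?leq_maxl //.
by rewrite (gen n (maxn m n)) ?leq_maxr.
Qed.

Lemma opactE (F : diffFieldType) (V : lmodType F) (X Y : V -> V) (p : diffop F) n v :
  order_le p n -> opact X Y p v =
    \sum_(i < n.+1) \sum_(j < n.+1) opcoef p i j *: iter i X (iter j Y v).
Proof.
move=> pn; rewrite /opact.
transitivity (\sum_(i < size (p : {poly {poly F}})) \sum_(j < n.+1)
    opcoef p i j *: iter i X (iter j Y v)).
  apply: eq_bigr => i _.
  apply: (big_ord_support (f := fun j => opcoef p i j *: iter i X (iter j Y v))) => j ij.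
    by rewrite /opcoef nth_default ?scale0r.
  by rewrite pn ?scale0r // (leq_trans ij) // leq_addl.
apply: (big_ord_support (f := fun i => \sum_(j < n.+1) opcoef p i j *: iter i X (iter j Y v))) => i ni.
  by rewrite big1 // => j _; rewrite /opcoef (nth_default 0 ni) coef0 scale0r.
by rewrite big1 // => j _; rewrite pn ?scale0r // (leq_trans ni) // leq_addr.
Qed.

Definition deglex_lead (F : diffFieldType) (p : diffop F) a b := opcoef p a b != 0 /\
  forall k l, opcoef p k l != 0 -> (k + l < a + b)%N || ((k + l == a + b)%N && (k <= a)%N).

Section Deglex.
Variable F : diffFieldType.
Implicit Types p : diffop F.

Lemma deglex_lead0 p a b k l : deglex_lead p a b ->
  ~~ ((k + l < a + b)%N || ((k + l == a + b)%N && (k <= a)%N)) -> opcoef p k l = 0.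
Proof. by move=> [_ le] nle; apply/eqP; apply: contraNT nle => /le. Qed.

Lemma deglex_lead_dx p a b : deglex_lead p a b ->
  deglex_lead (opdx F * p) a.+1 b /\ opcoef (opdx F * p) a.+1 b = opcoef p a b.
Proof.
move=> pab; have [nz le] := pab.
have E : opcoef (opdx F * p) a.+1 b = opcoef p a b.
  by rewrite opcoef_dx (deglex_lead0 (k := a.+1) (l := b) pab) ?raddf0 ?add0r //; lia.
split=> //; split; first by rewrite E.
move=> k l; rewrite opcoef_dx; case: (eqVneq (opcoef p k l) 0) => [->|/le]; last by lia.
rewrite raddf0 add0r; case: k => [|k]; first by rewrite eqxx.
by move=> /le; lia.
Qed.

Lemma deglex_lead_dy p a b : deglex_lead p a b ->
  deglex_lead (opdy F * p) a b.+1 /\ opcoef (opdy F * p) a b.+1 = opcoef p a b.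
Proof.
move=> pab; have [nz le] := pab.
have E : opcoef (opdy F * p) a b.+1 = opcoef p a b.
  by rewrite opcoef_dy (deglex_lead0 (k := a) (l := b.+1) pab) ?raddf0 ?add0r //; lia.
split=> //; split; first by rewrite E.
move=> k l; rewrite opcoef_dy; case: (eqVneq (opcoef p k l) 0) => [->|/le]; last by lia.
rewrite raddf0 add0r; case: l => [|l]; first by rewrite eqxx.
by move=> /le; lia.
Qed.

Lemma deglex_lead_mul p a b m n : deglex_lead p a b ->
  deglex_lead (opdx F ^+ m * (opdy F ^+ n * p)) (m + a) (n + b) /\
  opcoef (opdx F ^+ m * (opdy F ^+ n * p)) (m + a)%N (n + b)%N = opcoef p a b.
Proof.
move=> pab; elim: m => [|m [IH E]]; last first.
  by have [A B] := deglex_lead_dx IH; rewrite exprS -mulrA addSn B.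
rewrite expr0 mul1r; elim: n => [|n [IH E]]; first by rewrite expr0 mul1r.
by have [A B] := deglex_lead_dy IH; rewrite exprS -mulrA addSn B.
Qed.

End Deglex.

(* Formal Cauchy-Kovalevskaya: the parametric derivatives are free.            *)
Lemma hurwitz_linear (E : diffFieldType) (char0 : [pchar E] =i pred0) (p : diffop E)
    a b g i0 j0 :
  deglex_lead p a b -> ~~ ((a <= i0) && (b <= j0))%N ->
  exists h : hurwitz char0,
    opact (@hshx E char0) (@hshy E char0) p h = htaylor char0 g /\ h i0 j0 != 0.
Proof.
move=> pab ij0; pose ev (q : diffop E) (h : nat * nat -> E) : E :=
  \sum_(i < size (q : {poly {poly E}})) \sum_(j < size (q : {poly {poly E}})`_i)
    opcoef q i j * h (i : nat, j : nat).
pose Q m n := opdx E ^+ m * (opdy E ^+ n * p).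
(* [Q m n] has leading monomial (m + a, n + b), so its equation determines the value there from
   smaller positions. All other values are free and set to 1, which makes the one at (i0, j0)
   nonzero. *)
pose step (x : nat * nat) (h : nat * nat -> E) : E :=
  if (a <= x.1)%N && (b <= x.2)%N then
    (htaylor char0 g (x.1 - a)%N (x.2 - b)%N -
      ev (Q (x.1 - a)%N (x.2 - b)%N) (fun y => if y == x then 0 else h y)) / opcoef p a b
  else 1.
(* An enumeration compatible with the degree-lexicographic order. *)
pose mu (x : nat * nat) := ((x.1 + x.2) * (x.1 + x.2).+1 + x.1)%N.
have [|h hP] := @measure_recursion (nat * nat)%type E mu 0 step.
  move=> [k l] h h' hh'; rewrite /step /=; case: andP => // -[ak bl].
  congr ((_ - _) / _); rewrite /ev; apply: eq_bigr => i _; apply: eq_bigr => j _.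
  case: eqP => // ne; case: (eqVneq (opcoef (Q (k - a)%N (l - b)%N) i j) 0) => [->|nz].
    by rewrite !mul0r.
  congr (_ * _); apply: hh'.
  have [[_ le] _] := deglex_lead_mul (k - a) (l - b) pab.
  have := le _ _ nz; rewrite /mu /= !subnK //.
  move: ne; move: (nat_of_ord i) (nat_of_ord j) => i' j' ne.
  case/orP => [lt|/andP[/eqP e le']].
    have : ((i' + j').+1 * (i' + j').+2 <= (k + l) * (k + l).+1)%N by apply: leq_mul; lia.
    by move: (k + l)%N lt => t lt; nia.
  rewrite e ltn_add2l ltn_neqAle le' andbT; apply/eqP => ik; apply: ne.
  by congr (_, _); lia.
pose H : hurwitz char0 := fun i j => h (i, j).
have actE q f : opact (@hshx E char0) (@hshy E char0) q f 0%N 0%N = ev q (fun x => f x.1 x.2).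
  rewrite /opact /ev.
  have add (I : Type) (r : seq I) (P : pred I) (w : I -> hurwitz char0) :
      (\sum_(i <- r | P i) w i) 0%N 0%N = \sum_(i <- r | P i) w i 0%N 0%N.
    by apply: (big_morph (fun w : hurwitz char0 => w 0%N 0%N)).
  rewrite add; apply: eq_bigr => i _; rewrite add; apply: eq_bigr => j _.
  rewrite hscaleE hmulE hmul00 /=; congr (_ * _).
  have sh k l f' : iter k (@hshx E char0) (iter l (@hshy E char0) f') 0%N 0%N = f' k l.
    elim: k l f' => [|k IH] l f'; last first.
      rewrite iterSr (_ : hshx (iter l _ f') = iter l (@hshy E char0) (hshx f')) ?IH //.
      by elim: l {IH} => //= l <-.
    by elim: l f' => //= l IH f'; rewrite -iterS iterSr IH.
  exact: sh.
(* A Hurwitz series is the table of its derivatives at 0, so the equation for [p] amounts to one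
   equation at 0 for each [Q m n]. *)
have val00 q f m n : opact (@hshx E char0) (@hshy E char0) q f m n =
    opact (@hshx E char0) (@hshy E char0) (opdx E ^+ m * (opdy E ^+ n * q)) f 0%N 0%N.
  have A := hurwitz_action char0.
  have Ex r k i j : opact (@hshx E char0) (@hshy E char0) (opdx E ^+ k * r) f i j =
     opact (@hshx E char0) (@hshy E char0) r f (k + i)%N j.
    elim: k i => [|k IH] i; first by rewrite expr0 mul1r.
    by rewrite exprS -mulrA (act_dx A) /hshx IH addSnnS.
  have Ey r k i j : opact (@hshx E char0) (@hshy E char0) (opdy E ^+ k * r) f i j =
     opact (@hshx E char0) (@hshy E char0) r f i (k + j)%N.
    elim: k j => [|k IH] j; first by rewrite expr0 mul1r.
    by rewrite exprS -mulrA (act_dy A) /hshy IH addSnnS.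
  by rewrite Ex Ey !addn0.
exists H; split; last first.
  by rewrite /H hP /step /= (negPf ij0) oner_neq0.
apply: hurwitzP => m n; rewrite val00 actE -/(Q m n).
have [[nz _] cE] := deglex_lead_mul m n pab.
set k := (m + a)%N in nz cE; set l := (n + b)%N in nz cE.
have hE : h (k, l) * opcoef p a b = htaylor char0 g m n -
    ev (Q m n) (fun y => if y == (k, l) then 0 else h y).
  by rewrite hP /step /= !leq_addl /= !addnK divfK // -cE.
have split : ev (Q m n) h = opcoef (Q m n) k l * h (k, l) +
    ev (Q m n) (fun y => if y == (k, l) then 0 else h y).
  have kb : (k < size (Q m n : {poly {poly E}}))%N.
    by rewrite ltnNge; apply: contra nz => le; rewrite /opcoef (nth_default 0 le) coef0.
  have lb : (l < size ((Q m n : {poly {poly E}})`_k)%R)%N.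
    by rewrite ltnNge; apply: contra nz => le; rewrite /opcoef (nth_default 0 le).
  rewrite /ev (bigD1 (Ordinal kb)) //= [in RHS](bigD1 (Ordinal kb)) //=.
  rewrite (bigD1 (Ordinal lb)) //= [in RHS](bigD1 (Ordinal lb)) //= eqxx mulr0 add0r.
  rewrite -!addrA; congr (_ + (_ + _)).
    apply: eq_bigr => j /eqP jl; case: eqP => // -[e]; case: jl; exact: val_inj.
  apply: eq_bigr => i /eqP ik; apply: eq_bigr => j _; case: eqP => // -[e _].
  by case: ik; apply: val_inj.
have -> : (fun x : nat * nat => H x.1 x.2) = h by apply/funext => -[].
by rewrite split cE mulrC hE subrK.
Qed.

Lemma morph_iter (A B : diffFieldType) (f : {rmorphism A -> B}) i j a :
  diff_morphism f ->
  f (iter i (@dx A) (iter j (@dy A) a)) = iter i (@dx B) (iter j (@dy B) (f a)).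
Proof.
move=> [fx fy]; elim: i => [|i IH] /=; last by rewrite fx IH.
by elim: j => //= j IH; rewrite fy IH.
Qed.

(** * Linear differential equations solved in the universal field *)

Section Universal.
Variables (F : diffFieldType) (char0 : [pchar F] =i pred0) (univF : kolchin_universal F).

Lemma pchar_gen_field (S : F -> Prop) : [pchar (gen_field S)] =i pred0.
Proof.
by move=> n; rewrite -char0 -(fmorph_pchar (\val : {rmorphism gen_field S -> F})).
Qed.

(** The coefficients of [p] and [g] generate a differential field to which universality applies; the
    Hurwitz series solution over it generates an extension, which is carried to [F]. *)
Lemma universal_linear (p : diffop F) a b g i0 j0 :
  deglex_lead p a b -> ~~ ((a <= i0) && (b <= j0))%N ->
  exists h : F, field_act p h = g /\ iter i0 (@dx F) (iter j0 (@dy F) h) != 0.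
Proof.
move=> [pab ple] ij0; have [n pn] := order_le_exists p.
pose s := g :: [seq opcoef p i j | i <- iota 0 n.+1, j <- iota 0 n.+1].
pose S (x : F) : Prop := x \in s.
have coef_gen i j : opcoef p i j \in generated S.
  case: (ltnP i n.+1) => [iN|]; last first.
    by move=> ni; rewrite pn ?rpred0 //; lia.
  case: (ltnP j n.+1) => [jN|]; last first.
    by move=> nj; rewrite pn ?rpred0 //; lia.
  apply: generated_sub; rewrite /S inE; apply/orP; right.
  by apply: allpairs_f; rewrite mem_iota.
have gS : S g by rewrite /S inE eqxx.
pose E := gen_field S; pose charE : [pchar E] =i pred0 := @pchar_gen_field S.
pose cE i j : E := GenField (coef_gen i j); pose gE : E := GenField (generated_sub gS).
pose pE : diffop E := \poly_(i < n.+1) \poly_(j < n.+1) cE i j.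
have pEE i j : opcoef pE i j = cE i j.
  rewrite /opcoef /pE; have z : ~~ ((i < n.+1) && (j < n.+1))%N -> cE i j = 0.
    by move=> ij; apply: val_inj; rewrite /= pn //; lia.
  rewrite coef_poly; case: ltnP => ni; last by rewrite coef0 z //; lia.
  by rewrite coef_poly; case: ltnP => nj //; rewrite z //; lia.
have pEv i j : (opcoef pE i j == 0) = (opcoef p i j == 0).
  by rewrite pEE -(fmorph_eq0 (\val : {rmorphism E -> F})).
have pEn : order_le pE n by move=> i j ij; apply/eqP; rewrite pEv pn.
have leadE : deglex_lead pE a b.
  by split=> [|k l]; rewrite pEv // => /ple.
have [h [hE hnz]] := hurwitz_linear charE gE leadE ij0.
pose j0' : {rmorphism E -> hfrac charE} := (@hfrac_of E charE \o htaylor charE).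
have j0d : diff_morphism j0'.
  split=> e /=; first by rewrite hfrac_of_dx htaylor_shx.
  by rewrite hfrac_of_dy htaylor_shy.
have [K [j [yK [v [hK [vd hKd vy vj hj]]]]]] := universal_extension univF (hfrac_of h) j0d.
exists (hK yK); split; last first.
  rewrite -morph_iter // fmorph_eq0 -(fmorph_eq0 v) morph_iter // vy.
  have it k l f : iter k (@dx (hfrac charE)) (iter l (@dy (hfrac charE)) (hfrac_of f)) =
      hfrac_of (iter k (@hshx E charE) (iter l (@hshy E charE) f)).
    elim: k => [|k IH] /=; last by rewrite IH hfrac_of_dx.
    by elim: l => //= l IH; rewrite IH hfrac_of_dy.
  rewrite it hfrac_of_eq0; apply: contra hnz => /eqP e.
  have sh k l f' : iter k (@hshx E charE) (iter l (@hshy E charE) f') 0%N 0%N = f' k l.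
    elim: k l f' => [|k IH] l f'; last first.
      rewrite iterSr (_ : hshx (iter l _ f') = iter l (@hshy E charE) (hshx f')) ?IH //.
      by elim: l {IH} => //= l <-.
    by elim: l f' => //= l IH f'; rewrite -iterS iterSr IH.
  by rewrite -(sh i0 j0 h) e.
have -> : g = hK (j gE) by rewrite hj.
rewrite /field_act (opactE _ _ _ pn).
have e : \sum_(k < n.+1) \sum_(l < n.+1) j (cE k l) * iter k (@dx K) (iter l (@dy K) yK) = j gE.
  apply: (fmorph_inj v); rewrite vj -[j0' gE]/(hfrac_of (htaylor charE gE)) -hE (opactE _ _ _ pEn).
  rewrite !rmorph_sum; apply: eq_bigr => k _; rewrite !rmorph_sum; apply: eq_bigr => l _.
  rewrite rmorphM vj morph_iter // vy pEE hscaleE rmorphM; congr (_ * _).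
  elim: (nat_of_ord k) => [|k' IH] /=; last by rewrite IH hfrac_of_dx.
  by elim: (nat_of_ord l) => //= l' IH; rewrite IH hfrac_of_dy.
rewrite -e rmorph_sum; apply: eq_bigr => k _; rewrite rmorph_sum; apply: eq_bigr => l _.
by rewrite rmorphM hj morph_iter.
Qed.

Lemma deglex_lead_exists (p : diffop F) : p != 0 -> exists a b, deglex_lead p a b.
Proof.
move=> p0; have [n pn] := order_le_exists p.
pose P (x : 'I_n.+1 * 'I_n.+1) := opcoef p x.1 x.2 != 0.
pose mu (x : 'I_n.+1 * 'I_n.+1) := ((x.1 + x.2) * n.+1 + x.1)%N.
have inb i j : opcoef p i j != 0 -> (i < n.+1)%N /\ (j < n.+1)%N.
  move=> nz; have : (i + j <= n)%N by rewrite leqNgt; apply: contra nz => lt; rewrite pn.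
  lia.
have [x0 Px0] : exists x, P x.
  apply: contrapT => no; case/eqP: p0; apply: opP => i j; rewrite opcoef0.
  apply/eqP; apply/negPn/negP => nz; have [iN jN] := inb _ _ nz.
  by apply: no; exists (Ordinal iN, Ordinal jN).
case: (arg_maxnP mu Px0) => -[a b] Pab max; exists a, b; split=> // k l nz.
have [kN lN] := inb _ _ nz; have := max (Ordinal kN, Ordinal lN) nz.
rewrite /mu /=; have := ltn_ord a; move: (nat_of_ord a) (nat_of_ord b) => a' b' aN le.
case: (ltngtP (k + l) (a' + b')) => //= [lt|e].
  have : ((a' + b').+1 * n.+1 <= (k + l) * n.+1)%N by rewrite leq_mul2r lt orbT.
  by rewrite mulSn; lia.
by move: le; rewrite e leq_add2l.
Qed.

(** An operator of order 0 is a nonzero scalar and is inverted; in positive order the equation is an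
    instance of [universal_linear]. *)
Lemma field_surj (p : diffop F) (g : F) : p != 0 -> exists h, field_act p h = g.
Proof.
move=> p0; have [a [b pab]] := deglex_lead_exists p0.
case: (posnP (a + b)) => [ab0|ab].
  have [nz le] := pab; have [a0 b0] : a = 0%N /\ b = 0%N by lia.
  have pE : p = opcoef p 0 0 *: 1.
    apply: opP => i j; rewrite opcoefZ opcoef1; case: (eqVneq (opcoef p i j) 0) => [|/le].
      by case: eqP => [->|]; case: eqP => [->|] /=; rewrite ?mulr0 // ?mulr1.
    case: i j => [|i] [|j]; rewrite ?mulr1 //; lia.
  rewrite a0 b0 in nz; move: (opcoef p 0 0) nz pE => c nz pE; exists (c^-1 * g).
  by rewrite pE field_actZ field_act1 mulVKf.
have ij0 : ~~ ((a <= 0) && (b <= 0))%N by lia.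
by have [h [hP _]] := universal_linear g pab ij0; exists h.
Qed.

(** In positive order the undifferentiated unknown is not a multiple of the leading derivative, so
    its value can be taken nonzero. *)
Lemma field_kernel (p : diffop F) i j : opcoef p i j != 0 -> (0 < i + j)%N ->
  exists2 h : F, h != 0 & field_act p h = 0.
Proof.
move=> cij ij; have p0 : p != 0 by apply: contraNneq cij => ->; rewrite opcoef0.
have [a [b pab]] := deglex_lead_exists p0.
have ij0 : ~~ ((a <= 0) && (b <= 0))%N by have [_ /(_ _ _ cij)] := pab; lia.
by have [h [hP hnz]] := universal_linear 0 pab ij0; exists h.
Qed.

Lemma field_act_vector (kappa h : F) :
  field_act (opdx F - kappa *: opdy F) h = dx h - kappa * dy h.
Proof.
rewrite -scaleNr field_actD field_actZ -[opdx F]mulr1 -[opdy F]mulr1.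
by rewrite field_act_dx field_act_dy field_act1 mulNr.
Qed.

Lemma deglex_lead_vector (kappa : F) : deglex_lead (opdx F - kappa *: opdy F) 1 0.
Proof.
have cE i j : opcoef (opdx F - kappa *: opdy F) i j =
    ((i == 1) && (j == 0))%N%:R - kappa * ((i == 0) && (j == 1))%N%:R.
  rewrite opcoefB opcoefZ -[opdx F]mulr1 -[opdy F]mulr1.
  rewrite -{1}[opdx F]expr1 -{1}[opdy F]expr1 -{1}(expr0 (opdy F)) opcoef_monomial.
  have -> : opdy F ^+ 1 * 1 = opdx F ^+ 0 * opdy F ^+ 1 by rewrite expr0 mul1r mulr1.
  by rewrite opcoef_monomial.
split; first by rewrite cE /= mulr0 subr0 oner_neq0.
move=> k l; rewrite cE; case: k l => [|[|k]] [|[|l]] //=; rewrite ?mulr0 ?subr0 ?eqxx //.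
Qed.

Lemma transport_solvable (kappa c : F) : exists f, dx f - kappa * dy f = c.
Proof.
have [f [fP _]] := universal_linear c (deglex_lead_vector kappa) (isT : ~~ ((1 <= 0) && (0 <= 0))%N).
by exists f; rewrite -field_act_vector.
Qed.

(** The leading derivative of the equation is d_x f, so d_y f is parametric and can be made
    nonzero. *)
Lemma characteristic_solvable (alpha : F) : exists f, dx f = alpha * dy f /\ dy f != 0.
Proof.
have [f [fP fy]] := universal_linear 0 (deglex_lead_vector alpha) (isT : ~~ ((1 <= 0) && (0 <= 1))%N).
exists f; split=> //; apply/eqP; rewrite -subr_eq0 -field_act_vector fP //.
Qed.

End Universal.

(** * Algebraic extensions and roots of polynomials *)

Lemma monic_irreducible_factor (K : fieldType) (p : {poly K}) : (1 < size p)%N ->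
  exists r, monic_irreducible_poly r /\ r %| p.
Proof.
move=> p1.
pose P n := `[< exists q : {poly K}, [/\ size q = n, (1 < n)%N & q %| p] >].
have exP : exists n, P n by exists (size p); apply/asboolP; exists p.
case: (ex_minnP exP) => n /asboolP[q [qn n1 qp]] min.
have q0 : q != 0 by rewrite -size_poly_gt0 qn ltnW.
have lc0 : lead_coef q != 0 by rewrite lead_coef_eq0.
exists ((lead_coef q)^-1 *: q); split; last by rewrite dvdpZl ?invr_eq0.
split; last by rewrite monicE lead_coefZ mulVf.
split; first by rewrite size_scale ?invr_eq0 // qn.
move=> q' q'1; rewrite dvdpZr ?invr_eq0 // => q'q.
have q'0 : q' != 0 by apply: contraTneq q'q => ->; rewrite dvd0p.
have eq : q' %= q.
  rewrite -dvdp_size_eqp // eqn_leq dvdp_leq //= qn; apply: min; apply/asboolP.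
  exists q'; split=> //; last exact: dvdp_trans qp.
  by rewrite ltn_neqAle eq_sym q'1 size_poly_gt0.
by apply: (eqp_trans eq); rewrite eqp_sym eqp_scale // invr_eq0.
Qed.

Section AlgebraicExtension.
Variables (E : diffFieldType) (char0 : [pchar E] =i pred0).
Variables (r : {poly E}) (irr : monic_irreducible_poly r).

Definition alg_ext : Type := {poly %/ r with irr}.
HB.instance Definition _ := GRing.Field.copy alg_ext {poly %/ r with irr}.

Definition cls (p : {poly E}) : alg_ext := in_qpoly r p.
Lemma cls_zmod : zmod_morphism cls. Proof. exact: (rmorphB (in_qpoly r)). Qed.
Lemma cls_monoid : monoid_morphism cls.
Proof. by split; [exact: (rmorph1 (in_qpoly r))|exact: (rmorphM (in_qpoly r))]. Qed.
HB.instance Definition _ := GRing.isZmodMorphism.Build {poly E} alg_ext cls cls_zmod.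
HB.instance Definition _ := GRing.isMonoidMorphism.Build {poly E} alg_ext cls cls_monoid.

Lemma clsD p q : cls (p + q) = cls p + cls q. Proof. exact: rmorphD. Qed.
Lemma clsB p q : cls (p - q) = cls p - cls q. Proof. exact: rmorphB. Qed.
Lemma clsM p q : cls (p * q) = cls p * cls q. Proof. exact: rmorphM. Qed.

Definition rep (x : alg_ext) : {poly E} := (x : {poly %/ r}).
Lemma repK : cancel rep cls.
Proof.
by move=> x; apply: val_inj; apply: in_qpoly_small; exact: size_mk_monic.
Qed.

Lemma cls_eq0 p : (cls p == 0) = (r %| p).
Proof.
have E0 : (cls p == 0) = (Pdiv.CommonRing.rmodp p (mk_monic r) == 0).
  by rewrite -val_eqE.
by rewrite E0 mk_monicE // -Pdiv.IdomainMonic.modpE ?irr // /dvdp.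
Qed.

Variable d : {additive E -> E}.
Hypothesis dM : forall a b, d (a * b) = d a * b + a * d b.

Lemma map_polyD_der p q : map_poly d (p + q) = map_poly d p + map_poly d q.
Proof. exact: raddfD. Qed.
Lemma map_polyM_der p q : map_poly d (p * q) = map_poly d p * q + p * map_poly d q.
Proof.
apply/polyP => i; rewrite coefD !coefM coef_map /= coefM raddf_sum -big_split.
by apply: eq_bigr => k _; rewrite dM !coef_map.
Qed.

Lemma coprime_deriv : coprimep r r^`().
Proof.
have [[r1 _] rm] := irr.
have size_r' : (0 < size r^`())%N.
  rewrite size_poly_gt0; apply/eqP => /polyP/(_ (size r).-2); rewrite coef_deriv coef0.
  have -> : (size r).-2.+1 = (size r).-1 by case: (size r) r1 => [|[]].
  rewrite -lead_coefE (monicP rm) => /eqP.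
  by rewrite ((pcharf0P E).1 char0); case: (size r) r1 => [|[]].
rewrite irreducible_poly_coprime; last exact: irr.1.
apply/negP => /dvdp_leq; rewrite -size_poly_gt0 => /(_ size_r').
by rewrite leqNgt lt_size_deriv // -size_poly_gt0 ltnW.
Qed.

(** [w] represents the derivative of the root theta: differentiating r(theta) = 0 gives a linear
    equation for it with coefficient r'(theta), invertible modulo [r] by separability. *)
Lemma der_correction : exists w, r %| map_poly d r + w * r^`().
Proof.
have /Bezout_eq1_coprimepP[[u v] /= uv] := coprime_deriv.
exists (- v * map_poly d r).
have -> : map_poly d r + - v * map_poly d r * r^`() = map_poly d r * (1 - v * r^`()) by ring.
by rewrite -uv addrK mulrA dvdp_mull.
Qed.

Definition correction := projT1 (cid der_correction).
Definition poly_der p := map_poly d p + correction * p^`().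
Definition ext_der (x : alg_ext) : alg_ext := cls (poly_der (rep x)).

Lemma poly_derD p q : poly_der (p + q) = poly_der p + poly_der q.
Proof. by rewrite /poly_der map_polyD_der derivD mulrDr addrACA. Qed.
Lemma poly_derM p q : poly_der (p * q) = poly_der p * q + p * poly_der q.
Proof. by rewrite /poly_der map_polyM_der derivM; ring. Qed.
(** By the choice of [correction], [poly_der] preserves the ideal of [r], so it descends to
    classes. *)
Lemma ext_der_cls p : ext_der (cls p) = cls (poly_der p).
Proof.
have : cls (p - rep (cls p)) == 0 by rewrite clsB repK subrr.
rewrite cls_eq0 => /dvdpP[k kE].
rewrite /ext_der; apply/eqP; rewrite -subr_eq0 -opprB oppr_eq0 -clsB cls_eq0.
have -> : poly_der p = poly_der (rep (cls p)) + poly_der (k * r).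
  by rewrite -poly_derD -kE addrC subrK.
rewrite addrAC subrr add0r poly_derM dvdp_add //; first exact: dvdp_mulIr.
by rewrite dvdp_mull //; rewrite /poly_der /correction; case: (cid _).
Qed.

Lemma ext_derD x y : ext_der (x + y) = ext_der x + ext_der y.
Proof. by rewrite -(repK x) -(repK y) -clsD !ext_der_cls poly_derD clsD. Qed.
Lemma ext_derM x y : ext_der (x * y) = ext_der x * y + x * ext_der y.
Proof.
by rewrite -(repK x) -(repK y) -clsM !ext_der_cls poly_derM clsD !clsM.
Qed.
Lemma ext_derC a : ext_der (cls a%:P) = cls (d a)%:P.
Proof. by rewrite ext_der_cls /poly_der map_polyC derivC mulr0 addr0. Qed.

End AlgebraicExtension.

Section AlgebraicDiffField.
Variables (E : diffFieldType) (char0 : [pchar E] =i pred0).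
Variables (r : {poly E}) (irr : monic_irreducible_poly r).

(** The type records the characteristic because the derivations on it depend on separability. *)
Definition alg_diff_ext (_ : [pchar E] =i pred0) : Type := alg_ext irr.
Local Notation K := (alg_diff_ext char0).
HB.instance Definition _ := GRing.Field.copy K (alg_ext irr).

Definition adx : K -> K := ext_der char0 (@dx E).
Definition ady : K -> K := ext_der char0 (@dy E).

Let axD : forall a b, adx (a + b) = adx a + adx b. Proof. exact: ext_derD (@dxM E). Qed.
Let ayD : forall a b, ady (a + b) = ady a + ady b. Proof. exact: ext_derD (@dyM E). Qed.
Let axM : forall a b, adx (a * b) = adx a * b + a * adx b. Proof. exact: ext_derM (@dxM E). Qed.
Let ayM : forall a b, ady (a * b) = ady a * b + a * ady b. Proof. exact: ext_derM (@dyM E). Qed.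

(* The commutator of the extended derivations vanishes on E, hence it sends    *)
(* p(theta) to p'(theta) times its value at theta; take p = r.                 *)
Let aC : forall a, adx (ady a) = ady (adx a).
Proof.
pose c x := adx (ady x) - ady (adx x).
have axC (a : E) : adx (cls irr a%:P) = cls irr (dx a)%:P by apply: ext_derC; exact: dxM.
have ayC (a : E) : ady (cls irr a%:P) = cls irr (dy a)%:P by apply: ext_derC; exact: dyM.
have cD a b : c (a + b) = c a + c b by rewrite /c ayD axD axD ayD opprD addrACA.
have cM a b : c (a * b) = c a * b + a * c b.
  exact: (commutator_derivation axD ayD axM ayM).
have cC (a : E) : c (cls irr a%:P) = 0.
  by rewrite /c ayC axC axC ayC dxdyC subrr.
have cp p : c (cls irr p) = cls irr p^`() * c (cls irr 'X).
  elim/poly_ind: p => [|p a IH].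
    have -> : cls irr 0 = cls irr (0%:P) by rewrite polyC0.
    by rewrite cC deriv0 (_ : cls irr 0 = 0) ?mul0r //; exact: rmorph0.
  by rewrite clsD clsM cD cM cC IH addr0 derivD derivM derivX derivC mulr1 addr0 clsD clsM mulrDl [in RHS]mulrAC.
have c0 : c (cls irr 'X) = 0.
  have := cp r; have -> : cls irr r = cls irr 0%:P.
    by apply/eqP; rewrite -subr_eq0 -clsB polyC0 subr0 cls_eq0.
  rewrite cC => /esym/eqP; rewrite mulf_eq0 cls_eq0 => /orP[rr'|/eqP //].
  have /coprimepP/(_ r (dvdpp r) rr') := coprime_deriv char0 irr.
  have [[r1 _] _] := irr; rewrite -size_poly_eq1 => /eqP e.
  by rewrite e in r1.
move=> x; apply/eqP; rewrite -subr_eq0 -/(c x) -(repK x).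
by rewrite cp c0 mulr0.
Qed.

HB.instance Definition _ := Field_hasTwoDerivations.Build K axD ayD axM ayM aC.

Definition alg_const (a : E) : K := cls irr a%:P.
Lemma alg_const_zmod : zmod_morphism alg_const.
Proof. by move=> a b; rewrite /alg_const polyCB clsB. Qed.
Lemma alg_const_monoid : monoid_morphism alg_const.
Proof. by split=> [|a b]; rewrite /alg_const ?polyCM ?clsM //; exact: rmorph1. Qed.
HB.instance Definition _ := GRing.isZmodMorphism.Build E K alg_const alg_const_zmod.
HB.instance Definition _ := GRing.isMonoidMorphism.Build E K alg_const alg_const_monoid.

Lemma alg_const_diff : diff_morphism (alg_const : {rmorphism E -> K}).
Proof.
split=> a; rewrite /alg_const /=.
- by rewrite -[RHS]/(adx (cls irr a%:P)) /adx ext_derC //; exact: dxM.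
- by rewrite -[RHS]/(ady (cls irr a%:P)) /ady ext_derC //; exact: dyM.
Qed.

Lemma alg_root (p : {poly E}) : r %| p ->
  (map_poly alg_const p).[(cls irr 'X : K)] = 0.
Proof.
move=> rp; have E1 (q : {poly E}) : (map_poly alg_const q).[(cls irr 'X : K)] = cls irr q :> K.
  elim/poly_ind: q => [|q a IH]; first by rewrite rmorph0 horner0; apply/esym; exact: rmorph0.
  by rewrite rmorphD rmorphM /= map_polyX map_polyC hornerMXaddC IH clsD clsM.
by rewrite E1; apply/eqP; rewrite cls_eq0.
Qed.

End AlgebraicDiffField.

Lemma universal_closed (F : diffFieldType) (char0 : [pchar F] =i pred0)
    (univF : kolchin_universal F) (e : {poly F}) :
  (1 < size e)%N -> exists x, root e x.
Proof.
move=> e1; pose S (a : F) : Prop := a \in (e : seq F).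
pose E := gen_field S; pose charE : [pchar E] =i pred0 := @pchar_gen_field F char0 S.
have coef_gen i : e`_i \in generated S.
  case: (ltnP i (size e)) => ie; last by rewrite nth_default // rpred0.
  by apply: generated_sub; rewrite /S mem_nth.
pose eE : {poly E} := \poly_(i < size e) GenField (coef_gen i).
have eEE : map_poly (\val : {rmorphism E -> F}) eE = e.
  apply/polyP => i; rewrite coef_map /= coef_poly; case: ltnP => // ie.
  by rewrite nth_default.
have eE1 : (1 < size eE)%N by rewrite -(size_map_poly (\val : {rmorphism E -> F})) eEE.
have [r [irr re]] := monic_irreducible_factor eE1.
have [K [j [yK [v [hK [_ _ vy vj hj]]]]]] :=
  universal_extension univF (cls irr 'X : alg_diff_ext irr charE) (alg_const_diff charE irr).
exists (hK yK); apply/rootP.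
have root0 : \sum_(i < size eE) j eE`_i * yK ^+ i = 0.
  apply: (fmorph_inj v); rewrite rmorph0 -(alg_root charE irr re) horner_coef.
  rewrite size_map_poly rmorph_sum; apply: eq_bigr => i _.
  by rewrite rmorphM rmorphXn vj vy coef_map.
have := congr1 hK root0; rewrite rmorph0 rmorph_sum => <-.
rewrite -eEE horner_coef size_map_poly; apply: eq_bigr => i _.
by rewrite rmorphM rmorphXn hj coef_map.
Qed.

(** * Degrees and pseudo-division *)

Lemma linear_relation (F : fieldType) (I J : finType) (v : I -> J -> F) :
  (#|J| < #|I|)%N ->
  exists c : I -> F, (exists i, c i != 0) /\ forall j, \sum_i c i * v i j = 0.
Proof.
move=> JI; pose M : 'M_(#|I|, #|J|) := \matrix_(i, j) v (enum_val i) (enum_val j).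
have kM : kermx M != 0.
  rewrite -mxrank_eq0 mxrank_ker subn_eq0 -ltnNge.
  exact: leq_ltn_trans (rank_leq_col M) JI.
have [i ri] : exists i, row i (kermx M) != 0.
  apply: contrapT => no; case/eqP: kM; apply/row_matrixP => i; rewrite row0.
  by apply/eqP; apply/negPn/negP => nz; apply: no; exists i.
pose c k := kermx M i (enum_rank k).
exists c; split.
  apply: contrapT => no; case/eqP: ri; apply/rowP => k; rewrite [RHS]mxE [LHS]mxE.
  apply/eqP; apply/negPn/negP => nz; apply: no; exists (enum_val k).
  by rewrite /c enum_valK.
move=> j; have := congr1 (fun A : 'M_(_, _) => A i (enum_rank j)) (mulmx_ker M).
rewrite [in RHS]mxE mxE => E; rewrite -[RHS]E (reindex_onto (@enum_val I predT) enum_rank) /=.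
  apply: eq_big => [k|k _]; first by rewrite enum_valK eqxx.
  by rewrite /c enum_valK [M k _]mxE enum_rankK.
by move=> k _; exact: enum_rankK.
Qed.

Section Degrees.
Variable F : diffFieldType.
Implicit Types p q a b : diffop F.

Definition weight_lead w v p n :=
  weight_le w v p n /\ exists i j, (w * i + v * j = n)%N /\ opcoef p i j != 0.

Lemma weight_lead_wform w v p n : weight_lead w v p n <-> weight_le w v p n /\ wform w v n p != 0.
Proof.
split=> -[pn h]; split=> //.
  have [i [j [ij cij]]] := h; apply: contraNneq cij => E.
  by have := coef_wform w v n p i j; rewrite E !coef0 ij eqxx => <-.
apply: contrapT => no; case/eqP: h; apply/polyP => i; apply/polyP => j.
rewrite coef_wform !coef0; case: eqP => // ij; apply/eqP; apply/negPn/negP => nz.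
by apply: no; exists i, j.
Qed.

Lemma weight_leadM w v p q n m : (0 < w)%N -> (0 < v)%N ->
  weight_lead w v p n -> weight_lead w v q m -> weight_lead w v (p * q) (n + m).
Proof.
move=> w0 v0 /weight_lead_wform[pn fp] /weight_lead_wform[qm fq]; apply/weight_lead_wform.
by have [le ->] := wformM w0 v0 pn qm; split=> //; exact: mulf_neq0.
Qed.

Lemma weight_lead_exists w v p : p != 0 -> exists n, weight_lead w v p n.
Proof. by move=> /(weight_exists w v)[n /weight_lead_wform]; exists n. Qed.

Lemma weight_lead_unique w v p n m : weight_lead w v p n -> weight_lead w v p m -> n = m.
Proof.
have aux n' m' : weight_lead w v p n' -> weight_lead w v p m' -> (m' <= n')%N.
  move=> [pn _] [_ [i [j [ij nz]]]]; rewrite leqNgt; apply: contra nz => lt.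
  by rewrite pn // ij.
by move=> pn pm; apply/eqP; rewrite eqn_leq !aux.
Qed.

Definition xdeg_lt p m := forall i j, (m <= i)%N -> opcoef p i j = 0.
Definition xdeg p k := xdeg_lt p k.+1 /\ exists j, opcoef p k j != 0.

Lemma xdeg_exists p : p != 0 -> exists k, xdeg p k.
Proof.
move=> p0; have [n pn] := order_le_exists p.
have exP : exists k, `[< xdeg_lt p k >].
  by exists n.+1; apply/asboolP => i j ni; apply: pn; lia.
case: (ex_minnP exP) => k /asboolP pk min; case: k pk min => [|k] pk min.
  by case/eqP: p0; apply: opP => i j; rewrite pk ?opcoef0.
exists k; split=> //; apply: contrapT => no.
suff : (k.+1 <= k)%N by rewrite ltnn.
apply: min; apply/asboolP => i j; rewrite leq_eqVlt => /orP[/eqP <-|]; last exact: pk.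
by apply/eqP; apply/negPn/negP => nz; apply: no; exists j.
Qed.

Lemma xdeg_unique p k l : xdeg p k -> xdeg p l -> k = l.
Proof.
have aux k' l' : xdeg p k' -> xdeg p l' -> (l' <= k')%N.
  by move=> [pk _] [_ [j nz]]; rewrite leqNgt; apply: contra nz => lt; rewrite pk.
by move=> pk pl; apply/eqP; rewrite eqn_leq !aux.
Qed.

(** When d_x outweighs every order that occurs, the weight compares monomials lexicographically;
    dividing it by [w] gives back the two exponents of the leading monomial. *)
Lemma xdeg_weight p k : xdeg p k -> exists (b l : nat), (l <= b)%N /\
  forall w, (b < w)%N -> weight_lead w 1 p (w * k + l).
Proof.
move=> [pk [j0 nz0]]; have [n pn] := order_le_exists p.
have exP : exists j, opcoef p k j != 0 by exists j0.
have bP j : opcoef p k j != 0 -> (j <= n)%N.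
  by move=> nz; rewrite leqNgt; apply: contra nz => lt; rewrite pn //; lia.
case: (ex_maxnP exP bP) => l nzl max; have ln := bP _ nzl.
exists n, l; split=> // w nw.
split=> [i j|]; last by exists k, l; rewrite mul1n.
rewrite mul1n => lt; apply/eqP; apply/negPn/negP => nz.
have ijn : (i + j <= n)%N by rewrite leqNgt; apply: contra nz => lt'; rewrite pn.
have ik : (i <= k)%N by rewrite leqNgt; apply: contra nz => lt'; rewrite pk.
case: (ltngtP i k) ik lt => // [ik _|ik _]; first by nia.
by rewrite ik in nz *; have := max _ nz; lia.
Qed.

(** Weights add; with d_x heavy enough, comparing quotients by its weight gives additivity of the
    degree. *)
Lemma xdegM p q k l : xdeg p k -> xdeg q l -> xdeg (p * q) (k + l).
Proof.
move=> pk ql; have pq0 : p * q != 0.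
  apply: opmul_neq0.
    by have [_ [j nz]] := pk; apply: contraNneq nz => ->; rewrite opcoef0.
  by have [_ [j nz]] := ql; apply: contraNneq nz => ->; rewrite opcoef0.
have [m pqm] := xdeg_exists pq0.
have [b1 [l1 [lb1 h1]]] := xdeg_weight pk; have [b2 [l2 [lb2 h2]]] := xdeg_weight ql.
have [b3 [l3 [lb3 h3]]] := xdeg_weight pqm.
pose u := (b1 + b2 + b3).+1.
have W := weight_leadM (ltn0Sn _) (ltn0Sn 0) (h1 u _) (h2 u _).
have E := weight_lead_unique (W _ _) (h3 u _).
have {E} E : (u * k + l1 + (u * l + l2) = u * m + l3)%N by apply: E; rewrite /u; lia.
suff -> : (k + l = m)%N by [].
have : (l1 + l2 < u)%N by rewrite /u; lia.
have : (l3 < u)%N by rewrite /u; lia.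
by clear W; clearbody u; nia.
Qed.

(* In terms of the leading monomial for the lexicographic order, p is normal   *)
(* when its order is attained there.                                           *)
Definition normal p k n := [/\ xdeg p k, order_le p n, (k <= n)%N & opcoef p k (n - k) != 0].

Lemma weight_lead_order p n : weight_lead 1 1 p n -> order_le p n.
Proof. by move=> [le _]; apply/order_le_weight. Qed.

(** Weight (2, 1) is the order plus the power of d_x. Equality means that one monomial attains both
    maxima, so normality is expressed by additive quantities. *)
Lemma weight2_le p k n m : xdeg p k -> weight_lead 1 1 p n -> weight_lead 2 1 p m ->
  (m <= k + n)%N.
Proof.
move=> [pk _] /weight_lead_order pn [_ [i [j [<- nz]]]].
have ijn : (i + j <= n)%N by rewrite leqNgt; apply: contra nz => lt; rewrite pn.
have ik : (i <= k)%N by rewrite leqNgt; apply: contra nz => lt; rewrite pk.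
lia.
Qed.

Lemma weight2_normal p k n : xdeg p k -> weight_lead 1 1 p n ->
  weight_lead 2 1 p (k + n) -> normal p k n.
Proof.
move=> [pk h] /weight_lead_order pn [_ [i [j [ij nz]]]].
have ijn : (i + j <= n)%N by rewrite leqNgt; apply: contra nz => lt; rewrite pn.
have ik : (i <= k)%N by rewrite leqNgt; apply: contra nz => lt; rewrite pk.
have [ik' jn kn] : [/\ i = k, j = n - k & k <= n]%N by split; lia.
by split=> //; rewrite -jn -ik'.
Qed.

Lemma normal_weight2 p k n : normal p k n -> weight_lead 1 1 p n /\ weight_lead 2 1 p (k + n).
Proof.
move=> [[pk _] pn kn nz]; split; split.
- exact/order_le_weight.
- by exists k, (n - k)%N; split=> //; lia.
- move=> i j lt; apply/eqP; apply/negPn/negP => nz'.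
  have ijn : (i + j <= n)%N by rewrite leqNgt; apply: contra nz' => lt'; rewrite pn.
  have ik : (i <= k)%N by rewrite leqNgt; apply: contra nz' => lt'; rewrite pk.
  lia.
- by exists k, (n - k)%N; split=> //; lia.
Qed.

Lemma normalM p q k n l m : normal p k n -> normal q l m -> normal (p * q) (k + l) (n + m).
Proof.
move=> pn qm; have [p1 p2] := normal_weight2 pn; have [q1 q2] := normal_weight2 qm.
have [pk _ _ _] := pn; have [ql _ _ _] := qm.
apply: weight2_normal; [exact: xdegM|exact: weight_leadM|].
by have := weight_leadM (ltn0Sn 1) (ltn0Sn 0) p2 q2; rewrite addnACA.
Qed.

(** The degree, the order and the weight (2, 1) are all additive. Equality in [weight2_le] for the
    product therefore forces equality for each factor. *)
Lemma normal_factors p q k n : normal (p * q) k n ->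
  (exists l m, normal p l m) /\ (exists l m, normal q l m).
Proof.
move=> pqn; have [[pqk1 [j0 nz]] _ _ _] := pqn.
have p0 : p != 0 by apply: contraNneq nz => ->; rewrite mul0r opcoef0.
have q0 : q != 0 by apply: contraNneq nz => ->; rewrite mulr0 opcoef0.
have [W1 W2] := normal_weight2 pqn.
have [k1 pk] := xdeg_exists p0; have [k2 qk] := xdeg_exists q0.
have [n1 p1] := weight_lead_exists 1 1 p0; have [n2 q1] := weight_lead_exists 1 1 q0.
have [m1 p2] := weight_lead_exists 2 1 p0; have [m2 q2] := weight_lead_exists 2 1 q0.
have pqk : xdeg (p * q) k by case: pqn.
have ek := xdeg_unique pqk (xdegM pk qk).
have en := weight_lead_unique W1 (weight_leadM (ltn0Sn 0) (ltn0Sn 0) p1 q1).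
have em := weight_lead_unique W2 (weight_leadM (ltn0Sn 1) (ltn0Sn 0) p2 q2).
have le1 := weight2_le pk p1 p2; have le2 := weight2_le qk q1 q2.
split; [exists k1, n1|exists k2, n2]; apply: weight2_normal => //.
  by rewrite (_ : k1 + n1 = m1)%N //; lia.
by rewrite (_ : k2 + n2 = m2)%N //; lia.
Qed.

End Degrees.

Section Division.
Variable F : diffFieldType.
Implicit Types p q a b u : diffop F.

Definition box p (A B : nat) := forall i j, (A < i)%N || (B < j)%N -> opcoef p i j = 0.

Lemma box_dx p A B : box p A B -> box (opdx F * p) A.+1 B.
Proof.
move=> pb i j ij; rewrite opcoef_dx pb ?raddf0 ?add0r; last by lia.
by case: i ij => // i ij; apply: pb; lia.
Qed.
Lemma box_dy p A B : box p A B -> box (opdy F * p) A B.+1.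
Proof.
move=> pb i j ij; rewrite opcoef_dy pb ?raddf0 ?add0r; last by lia.
by case: j ij => // j ij; apply: pb; lia.
Qed.
Lemma box_monomial p A B k l : box p A B -> box (opdx F ^+ k * opdy F ^+ l * p) (k + A) (l + B).
Proof.
move=> pb; elim: k => [|k IH]; last by rewrite exprS -!mulrA addSn; apply: box_dx; rewrite mulrA.
rewrite expr0 mul1r; elim: l => [|l IH]; first by rewrite expr0 mul1r.
by rewrite exprS -mulrA addSn; exact: box_dy.
Qed.
Lemma box_exists p : exists n, box p n n.
Proof. by have [n pn] := order_le_exists p; exists n => i j ij; apply: pn; lia. Qed.
Lemma boxW p A B A' B' : (A <= A')%N -> (B <= B')%N -> box p A B -> box p A' B'.
Proof. by move=> AA BB pb i j ij; apply: pb; lia. Qed.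

(* The hypothesis makes the operators (a, b) more numerous than the            *)
(* coefficients of a p - b q.                                                  *)
Lemma ore_box p q A B N M : p != 0 -> q != 0 -> box p A B -> box q A B ->
    ((N + A).+1 * (M + B).+1 < 2 * (N.+1 * M.+1))%N ->
  exists a b, [/\ a != 0, b != 0, box a N M, box b N M & a * p = b * q].
Proof.
move=> p0 q0 pb qb count.
pose mon (x : 'I_N.+1 * 'I_M.+1) : diffop F := opdx F ^+ x.1 * opdy F ^+ x.2.
pose v (x : bool * ('I_N.+1 * 'I_M.+1)) (y : 'I_(N + A).+1 * 'I_(M + B).+1) : F :=
  opcoef (mon x.2 * (if x.1 then p else - q)) y.1 y.2.
have [|c [[[t0 [k0 l0]] c0] cv]] := linear_relation v.
  by rewrite !card_prod !card_ord card_bool.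
pose op (t : bool) : diffop F := \sum_x c (t, x) *: mon x.
have opE t (k : 'I_N.+1) (l : 'I_M.+1) : opcoef (op t) k l = c (t, (k, l)).
  rewrite opcoef_sum (bigD1 (k, l)) //= opcoefZ opcoef_monomial !eqxx mulr1 big1 ?addr0 //.
  move=> [k' l'] /eqP ne; rewrite opcoefZ opcoef_monomial.
  case: eqP => [/val_inj kk|]; case: eqP => [/val_inj ll|] /=; rewrite ?mulr0 //.
  by case: ne; rewrite kk ll.
have opB t : box (op t) N M.
  move=> i j ij; rewrite opcoef_sum big1 // => -[k l] _; rewrite opcoefZ opcoef_monomial.
  have := ltn_ord k; have := ltn_ord l => /=.
  by move=> lM kN; case: eqP => [ik|]; case: eqP => [jl|] /=; rewrite ?mulr0 //; lia.
have box_neg : box (- q) A B by move=> i j ij; rewrite opcoefN qb ?oppr0.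
have rel : op true * p = op false * q.
  apply/eqP; rewrite -subr_eq0; apply/eqP; apply: opP => i j; rewrite opcoef0.
  have -> : op true * p - op false * q =
      \sum_(x : bool * ('I_N.+1 * 'I_M.+1)) c (x.1, x.2) *: (mon x.2 * (if x.1 then p else - q)).
    rewrite -(pair_bigA _ (fun t x => c (t, x) *: (mon x * (if t then p else - q)))) /=.
    rewrite big_bool /= /op !mulr_suml -sumrN; congr (_ + _); apply: eq_bigr => x _.
      by rewrite [RHS]scalerAl.
    by rewrite mulrN scalerN [in RHS]scalerAl.
  rewrite opcoef_sum; case: (boolP ((i < (N + A).+1) && (j < (M + B).+1))%N) => ij; last first.
    rewrite big1 // => -[t [k l]] _; rewrite opcoefZ /mon /=.
    have := ltn_ord k; have := ltn_ord l => lM kN.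
    have bx : box (if t then p else - q) A B by case: t.
    by rewrite (@box_monomial _ _ _ k l bx) ?mulr0 //; lia.
  have [iN jM] := andP ij.
  rewrite -[RHS](cv (Ordinal iN, Ordinal jM)); apply: eq_bigr => -[t x] _.
  by rewrite opcoefZ.
have nz t : op t != 0 -> op true != 0 /\ op false != 0.
  case: t => nz; split=> //; apply/eqP => e.
    by have := opmul_neq0 nz p0; rewrite rel e mul0r eqxx.
  by have := opmul_neq0 nz q0; rewrite -rel e mul0r eqxx.
have [] := nz t0; first by apply: contraNneq c0 => e; rewrite -opE e opcoef0.
by move=> a0 b0; exists (op true), (op false); split.
Qed.

Lemma ore_common p q : p != 0 -> q != 0 -> exists a b, [/\ a != 0, b != 0 & a * p = b * q].
Proof.
move=> p0 q0; have [n1 pb] := box_exists p; have [n2 qb] := box_exists q.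
pose n := maxn n1 n2.
(* The count is (4n + 1)^2 < 2 (3n + 1)^2. *)
have [|||a [b [a0 b0 _ _ e]]] := @ore_box p q n n (3 * n) (3 * n) p0 q0.
- by apply: boxW pb; rewrite leq_maxl.
- by apply: boxW qb; rewrite leq_maxr.
- nia.
- by exists a, b.
Qed.

(** In F[d_y] multipliers of order [n] suffice: 2n + 2 unknowns against 2n + 1 equations. *)
Lemma ore_dy p q : p != 0 -> q != 0 -> xdeg_lt p 1 -> xdeg_lt q 1 ->
  exists a b, [/\ a != 0, b != 0, xdeg_lt a 1, xdeg_lt b 1 & a * p = b * q].
Proof.
move=> p0 q0 p1 q1; have [n1 pb] := box_exists p; have [n2 qb] := box_exists q.
pose n := maxn n1 n2.
have bx r m : xdeg_lt r 1 -> box r m m -> (m <= n)%N -> box r 0 n.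
  by move=> r1 rb mn i j /orP[i0|nj]; [exact: r1|apply: rb; lia].
have [|||a [b [a0 b0 ab bb e]]] := @ore_box p q 0 n 0 n p0 q0.
- by apply: bx pb _; rewrite // leq_maxl.
- by apply: bx qb _; rewrite // leq_maxr.
- nia.
- by exists a, b; split=> // i j i1; [apply: ab|apply: bb]; rewrite i1.
Qed.

Definition xcoef p k : diffop F := ((p : {poly {poly F}})`_k)%:P.

Lemma opcoef_xcoef p k i j : opcoef (xcoef p k) i j = if i == 0%N then opcoef p k j else 0.
Proof. by rewrite /opcoef /xcoef coefC; case: eqP; rewrite ?coef0. Qed.

Lemma xcoef_xdeg p k : xdeg_lt (xcoef p k) 1.
Proof. by move=> [|i] j //; rewrite opcoef_xcoef. Qed.

(** An operator is a sum of c_k(d_y) d_x^k, and left multiplication by an element of F[d_y] acts on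
    each c_k separately. *)
Lemma opcoef_mul_dy a q k j : xdeg_lt a 1 ->
  opcoef (a * q) k j = opcoef (a * xcoef q k) 0 j.
Proof.
move=> a1; rewrite (diffopE a) !mulr_suml !opcoef_sum; apply: eq_bigr => i _.
rewrite !mulr_suml !opcoef_sum; apply: eq_bigr => l _; rewrite -!scalerAl !opcoefZ.
move: (nat_of_ord l) => {}l; case: (nat_of_ord i) => [|i']; last by rewrite a1 ?mul0r.
congr (_ * _); rewrite !expr0 !mul1r.
elim: l j => [|m IH] j; first by rewrite expr0 !mul1r opcoef_xcoef.
by rewrite !exprS -!mulrA !opcoef_dy IH; case: j => // j; rewrite IH.
Qed.

Lemma xdeg_lt_mul_dy a q k : xdeg_lt a 1 -> xdeg_lt q k -> xdeg_lt (a * q) k.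
Proof.
move=> a1 qk i j ki; rewrite opcoef_mul_dy //.
rewrite (_ : xcoef q i = 0) ?mulr0 ?opcoef0 //.
by apply: opP => i' j'; rewrite opcoef_xcoef opcoef0; case: eqP => // _; rewrite qk.
Qed.

Lemma xdeg_lt_dx p m k : xdeg_lt p m.+1 -> xdeg_lt (opdx F ^+ k * p) (k + m).+1 /\
  forall j, opcoef (opdx F ^+ k * p) (k + m) j = opcoef p m j.
Proof.
move=> pm; elim: k => [|k [IH E]]; first by rewrite expr0 mul1r.
rewrite exprS -mulrA addSn; split=> [i j ki|j].
  rewrite opcoef_dx IH ?raddf0 ?add0r; last by lia.
  by case: i ki => // i ki; rewrite IH.
by rewrite opcoef_dx IH ?raddf0 ?add0r.
Qed.

(** The leading coefficients in F[d_y] have a common left multiple, by which the top power of d_x is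
    cancelled repeatedly. *)
Lemma pseudo_division p q m : xdeg p m ->
  exists a u, [/\ a != 0, xdeg_lt a 1 & xdeg_lt (a * q - u * p) m].
Proof.
move=> [pm [j0 nz0]].
have [k qk] : exists k, xdeg_lt q (m + k).
  by have [n qn] := order_le_exists q; exists n.+1 => i j ij; apply: qn; lia.
elim: k q qk => [|k IH] q qk.
  exists 1, 0; rewrite mul1r mul0r subr0 oner_neq0 -[m]addn0; split=> // i j i1.
  by rewrite opcoef1; case: i i1.
case: (eqVneq (xcoef q (m + k)) 0) => [E|b0].
  apply: IH => i j; rewrite leq_eqVlt => /orP[/eqP <-|lt]; last by apply: qk; lia.
  by have := opcoef_xcoef q (m + k) 0 j; rewrite E opcoef0 eqxx.
have am0 : xcoef p m != 0.
  by apply: contraNneq nz0 => E; have := opcoef_xcoef p m 0 j0; rewrite E opcoef0 eqxx => <-.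
have [a' [b' [a'0 b'0 a'1 b'1 e]]] := ore_dy b0 am0 (xcoef_xdeg _ _) (xcoef_xdeg _ _).
pose q' := a' * q - b' * (opdx F ^+ k * p).
have [kp kpE] := xdeg_lt_dx k pm.
have q'k : xdeg_lt q' (m + k).
  move=> i j; rewrite leq_eqVlt => /orP[/eqP <-|lt]; last first.
    have lt1 : (m + k.+1 <= i)%N by rewrite addnS.
    have lt2 : ((k + m).+1 <= i)%N by rewrite addnC.
    by rewrite opcoefB (@xdeg_lt_mul_dy _ _ _ a'1 qk i j lt1) (@xdeg_lt_mul_dy _ _ _ b'1 kp i j lt2) subr0.
  rewrite opcoefB (@opcoef_mul_dy a') // (@opcoef_mul_dy b') // e (_ : xcoef (opdx F ^+ k * p) (m + k) = xcoef p m) ?subrr //.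
  by apply: opP => i' j'; rewrite !opcoef_xcoef; case: eqP => // _; rewrite addnC kpE.
have [a [u [a0 a1 lt]]] := IH q' q'k.
exists (a * a'), (a * b' * opdx F ^+ k + u); split.
- exact: opmul_neq0.
- exact: xdeg_lt_mul_dy.
- rewrite (_ : _ - _ = a * q' - u * p) // /q' mulrBr mulrDl !mulrA opprD addrA.
  by rewrite -!mulrA.
Qed.

End Division.

(** * Hilbert functions *)

Section Dimension.
Variables (F : fieldType) (V : lmodType F).
Implicit Types (A J : V -> Prop) (p q : V).

Definition subspace J := [/\ J 0, forall p q, J p -> J q -> J (p + q) & forall a p, J p -> J (a *: p)].

Definition independent_mod J (I : finType) (e : I -> V) :=
  forall c : I -> F, J (\sum_i c i *: e i) -> forall i, c i = 0.
Definition spans_mod A J (I : finType) (g : I -> V) :=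
  forall p, A p -> exists c : I -> F, J (p - \sum_i c i *: g i).

Lemma subspace_sum J (I : finType) (f : I -> V) : subspace J -> (forall i, J (f i)) -> J (\sum_i f i).
Proof. by move=> [J0 JD _] Jf; apply: (big_ind J) => //. Qed.

Lemma subspaceB J p q : subspace J -> J p -> J q -> J (p - q).
Proof. by move=> [_ JD JZ] Jp Jq; apply: JD => //; rewrite -scaleN1r; exact: JZ. Qed.

Lemma subspaceI J J' : subspace J -> subspace J' -> subspace (fun p => J p /\ J' p).
Proof.
move=> [J0 JD JZ] [J'0 J'D J'Z]; split=> // [p q [Jp J'p] [Jq J'q]|a p [Jp J'p]].
  by split; [exact: JD|exact: J'D].
by split; [exact: JZ|exact: J'Z].
Qed.

Lemma independent_le_spanning A J (I K : finType) (e : I -> V) (g : K -> V) :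
    subspace J -> (forall i, A (e i)) -> independent_mod J e -> spans_mod A J g ->
  (#|I| <= #|K|)%N.
Proof.
move=> sJ Ae ind sp; rewrite leqNgt; apply/negP => KI.
have [M MP] := choice (fun i => sp _ (Ae i)).
have [c [[i ci] cM]] := linear_relation M KI.
case/eqP: ci; apply: ind.
have -> : \sum_i c i *: e i = \sum_i c i *: (e i - \sum_j M i j *: g j).
  apply/eqP; rewrite -subr_eq0 -sumrB; apply/eqP.
  under eq_bigr => k _ do rewrite scalerBr opprB addrC subrK scaler_sumr.
  rewrite exchange_big big1 // => j _.
  under eq_bigr => k _ do rewrite scalerA.
  by rewrite -scaler_suml cM scale0r.
by apply: subspace_sum => // k; have [_ _ JZ] := sJ; exact: JZ.
Qed.

Definition basis_mod A J n := exists e : 'I_n -> V,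
  [/\ forall i, A (e i), independent_mod J e & spans_mod A J e].

Lemma basis_exists A J (K : finType) (g : K -> V) : subspace A -> subspace J -> spans_mod A J g ->
  exists n, basis_mod A J n.
Proof.
move=> sA sJ sp.
pose P n := `[< exists e : 'I_n -> V, (forall i, A (e i)) /\ independent_mod J e >].
have exP : exists n, P n.
  by exists 0%N; apply/asboolP; exists (fun=> 0); split=> [[]|c _ []].
have bP n : P n -> (n <= #|K|)%N.
  by move=> /asboolP[e [Ae ind]]; have := independent_le_spanning sJ Ae ind sp; rewrite card_ord.
case: (ex_maxnP exP bP) => n /asboolP[e [Ae ind]] max; exists n, e; split=> // p Ap.
apply: contrapT => np.
have : (n.+1 <= n)%N; last by rewrite ltnn.
apply: max; apply/asboolP.
exists (fun i => if unlift ord0 i is Some j then e j else p); split.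
  by move=> i; case: unliftP.
move=> c; rewrite big_ord_recl /= unlift_none => Jc.
have Jc' : J (c ord0 *: p + \sum_(i < n) c (lift ord0 i) *: e i).
  suff -> : \sum_(i < n) c (lift ord0 i) *: e i = \sum_(i < n)
     c (lift ord0 i) *: match unlift ord0 (lift ord0 i) with Some j => e j | None => p end by [].
  by apply: eq_bigr => i _; rewrite liftK.
case: (eqVneq (c ord0) 0) => [c0|c0].
  rewrite c0 scale0r add0r in Jc'.
  by move=> i; case: (unliftP ord0 i) => [j ->|-> //]; exact: (ind (fun j => c (lift ord0 j))).
case: np; exists (fun i => - (c ord0)^-1 * c (lift ord0 i)).
have [_ _ JZ] := sJ; have := JZ (c ord0)^-1 _ Jc'.
rewrite scalerDr scalerA mulVf // scale1r scaler_sumr.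
congr (J (_ + _)); rewrite -sumrN; apply: eq_bigr => i _.
by rewrite scalerA mulNr scaleNr opprK.
Qed.

(** A basis of [A] modulo [J] joined to a basis, modulo [J'], of the part of [A] in [J] is a basis
    of [A] modulo [J']. *)
Lemma basis_add A J J' n r n' : subspace A -> subspace J -> subspace J' -> (forall p, J' p -> J p) ->
    basis_mod A J n -> basis_mod (fun p => A p /\ J p) J' r -> basis_mod A J' n' ->
  n' = (n + r)%N.
Proof.
move=> [A0 AD AZ] [J0 JD JZ] sJ' J'J [e [Ae inde spe]] [f [Af indf spf]] [g [Ag indg spg]].
have sJ : subspace J by split.
pose k (x : 'I_n + 'I_r) := match x with inl i => e i | inr i => f i end.
have sumE (c : 'I_n + 'I_r -> F) : \sum_x c x *: k x =
    \sum_(i < n) c (inl i) *: e i + \sum_(i < r) c (inr i) *: f i by rewrite big_sumType.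
have Ak x : A (k x) by case: x => i; [exact: Ae|case: (Af i)].
have Jf (c : 'I_r -> F) : J (\sum_i c i *: f i).
  by apply: subspace_sum => // i; apply: JZ; case: (Af i).
have indk : independent_mod J' k.
  move=> c; rewrite sumE => J'c.
  have ce : forall i, c (inl i) = 0.
    apply: (inde (fun i => c (inl i))).
    by have := subspaceB sJ (J'J _ J'c) (Jf (fun i => c (inr i))); rewrite addrK.
  have cf : forall i, c (inr i) = 0.
    apply: (indf (fun i => c (inr i))); move: J'c.
    by rewrite big1 ?add0r // => i _; rewrite ce scale0r.
  by case.
have spk : spans_mod A J' k.
  move=> p Ap; have [c Jc] := spe p Ap; set q := p - _ in Jc.
  have Aq : A q.
    apply: (AD) => //; rewrite -scaleN1r; apply: (AZ).
    by apply: (big_ind A) => [|u w Au Aw|i _]; [exact: A0|exact: AD|exact: AZ].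
  have [c' Jc'] := spf q (conj Aq Jc).
  exists (fun x => match x with inl i => c i | inr i => c' i end).
  by rewrite sumE /= opprD addrA.
apply/eqP; rewrite eqn_leq.
have := independent_le_spanning sJ' Ag indg spk; rewrite card_ord card_sum !card_ord => ->.
by have := independent_le_spanning sJ' Ak indk spg; rewrite card_ord card_sum !card_ord.
Qed.

End Dimension.

Section Hilbert.
Variable F : diffFieldType.
Implicit Types (p q r : diffop F) (J : diffop F -> Prop).

Lemma left_ideal_subspace J : left_ideal J -> subspace J.
Proof.
move=> [J0 JD JM]; split=> // a p Jp.
by rewrite -mulr_algl; exact: JM.
Qed.

Lemma order_le_subspace z : subspace (fun p : diffop F => order_le p z).
Proof.
split=> [|p q pz qz|a p pz]; [exact: order_le0|exact: order_leD|exact: order_leZ].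
Qed.

(* The operators supported on the exponents in l span A modulo J.              *)
Lemma spans_support (A : diffop F -> Prop) J (l : seq (nat * nat)) : subspace J ->
    (forall p, A p -> exists r, J (p - r) /\ forall i j, opcoef r i j != 0 -> (i, j) \in l) ->
  exists2 n, (n <= size l)%N & exists g : 'I_n -> diffop F, spans_mod A J g.
Proof.
move=> sJ red; pose l' := undup l.
exists (size l'); first exact: size_undup.
exists (fun k : 'I_(size l') => opdx F ^+ (nth (0, 0)%N l' k).1 * opdy F ^+ (nth (0, 0)%N l' k).2) => p Ap.
have [r [Jr rl]] := red p Ap.
exists (fun k : 'I_(size l') => opcoef r (nth (0, 0)%N l' k).1 (nth (0, 0)%N l' k).2).
suff <- : r = \sum_(k < size l') opcoef r (nth (0, 0)%N l' k).1 (nth (0, 0)%N l' k).2 *: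
   (opdx F ^+ (nth (0, 0)%N l' k).1 * opdy F ^+ (nth (0, 0)%N l' k).2) by [].
apply: opP => i j; rewrite opcoef_sum.
case: (boolP ((i, j) \in l')) => [ijl|nij]; last first.
  rewrite (_ : opcoef r i j = 0); last first.
    by apply/eqP; apply: contraNT nij => /rl; rewrite mem_undup.
  rewrite big1 // => k _; rewrite opcoefZ opcoef_monomial.
  case: andP => [[/eqP ik /eqP jk]|_]; last by rewrite mulr0.
  by case/negP: nij; rewrite ik jk -surjective_pairing mem_nth.
have kl : (index (i, j) l' < size l')%N by rewrite index_mem.
rewrite (bigD1 (Ordinal kl)) //= nth_index //= opcoefZ opcoef_monomial !eqxx mulr1.
rewrite big1 ?addr0 // => k /eqP ne; rewrite opcoefZ opcoef_monomial.
case: andP => [[/eqP ik /eqP jk]|_]; last by rewrite mulr0.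
case: ne; apply: val_inj; rewrite /= ik jk -surjective_pairing index_uniq ?undup_uniq //.
Qed.

Lemma quotient_dim_exists J z : left_ideal J -> exists n, quotient_dim J z n.
Proof.
move=> /left_ideal_subspace sJ.
have [|n _ [g sp]] := @spans_support (fun p => order_le p z) J
    [seq (i, j) | i <- iota 0 z.+1, j <- iota 0 z.+1] sJ.
  move=> p pz; exists p; rewrite subrr; split; first by case: sJ.
  move=> i j nz; have ij : (i + j <= z)%N by rewrite leqNgt; apply: contra nz => lt; rewrite pz.
  by apply: allpairs_f; rewrite mem_iota /=; lia.
exact: basis_exists (order_le_subspace z) sJ sp.
Qed.

(** The monomials d_x^i d_y^j with i < m and j <= z - m are independent modulo [J]: a relation would
    have d_x-degree below [m]. *)
Lemma quotient_dim_lower J m z n : left_ideal J ->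
    (forall p, J p -> xdeg_lt p m -> p = 0) -> (m <= z)%N -> quotient_dim J z n ->
  (m * (z - m).+1 <= n)%N.
Proof.
move=> /left_ideal_subspace sJ Jm mz [e [_ _ sp]].
pose g (x : 'I_m * 'I_(z - m).+1) : diffop F := opdx F ^+ x.1 * opdy F ^+ x.2.
have := @independent_le_spanning _ _ (fun p => order_le p z) J _ _ g e sJ _ _ sp.
rewrite card_prod !card_ord; apply.
  move=> [i j] k l kl; rewrite opcoef_monomial; case: andP => // -[/eqP ki /eqP lj].
  by move: kl; have := ltn_ord i; have := ltn_ord j; rewrite ki lj /=; lia.
move=> c Jc; have z0 : \sum_x c x *: g x = 0.
  apply: Jm Jc _ => i j mi; rewrite opcoef_sum big1 // => -[k l] _.
  rewrite opcoefZ opcoef_monomial /=; case: andP => [[/eqP ik _]|_]; last by rewrite mulr0.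
  by have := ltn_ord k; rewrite -ik ltnNge mi.
move=> [k l]; have := congr1 (fun p => opcoef p k l) z0.
rewrite /= opcoef0 opcoef_sum (bigD1 (k, l)) //= opcoefZ opcoef_monomial !eqxx mulr1 big1 ?addr0 //.
move=> [k' l'] /eqP ne; rewrite opcoefZ opcoef_monomial.
case: andP => [[/eqP kk /eqP ll]|_]; last by rewrite mulr0.
by case: ne; congr (_, _); apply: val_inj.
Qed.

End Hilbert.

Section UpperBound.
Variable F : diffFieldType.
Implicit Types (p q r w : diffop F).
Variables (J : diffop F -> Prop) (idealJ : left_ideal J).

Let sJ : subspace J := left_ideal_subspace idealJ.
Let JM p q : J q -> J (p * q). Proof. by case: idealJ => _ _; apply. Qed.
Let JZ a p : J p -> J (a *: p). Proof. by have [_ _] := sJ; apply. Qed.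
Let JD p q : J p -> J q -> J (p + q). Proof. by have [_ + _] := sJ; apply. Qed.
Let J0 : J 0. Proof. by have [] := sJ. Qed.
Lemma opcoef_dy_column w k d l : (forall j, (d < j)%N -> opcoef w k j = 0) -> opcoef w k d = 1 ->
  (forall j, (l + d < j)%N -> opcoef (opdy F ^+ l * w) k j = 0) /\
  opcoef (opdy F ^+ l * w) k (l + d) = 1.
Proof.
move=> w0 w1; elim: l => [|l [IH0 IH1]]; first by rewrite expr0 mul1r.
rewrite exprS -mulrA addSn; split=> [[|j] lj|]; rewrite opcoef_dy //.
  rewrite !IH0 ?raddf0 ?add0r //; lia.
by rewrite IH0 ?raddf0 ?add0r // IH1.
Qed.

(** The order of [w] is attained at d_x^n with coefficient 1, so subtracting multiples of [w]
    removes high powers of d_x without raising the order. *)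
Lemma reduce_order w n z p : J w -> order_le w n -> opcoef w n 0 = 1 -> order_le p z ->
  exists r, [/\ J (p - r), order_le r z & xdeg_lt r n].
Proof.
move=> Jw wn w1 pz.
have wx : xdeg_lt w n.+1 by move=> i j ni; apply: wn; lia.
have wcol j : (0 < j)%N -> opcoef w n j = 0 by move=> j0; apply: wn; lia.
have [k pk] : exists k, xdeg_lt p (n + k) by exists z.+1 => i j ij; apply: pz; lia.
elim: k p pz pk => [|k IH] p pz pk.
  by exists p; rewrite subrr; split=> //; rewrite addn0 in pk.
suff [q [Jq qz qk]] : exists q, [/\ J (p - q), order_le q z & xdeg_lt q (n + k)].
  have [r [Jr rz rn]] := IH q qz qk; exists r; split=> //.
  by rewrite -(subrK q p) -addrA; exact: JD.
have [e pe] : exists e, forall j, (e <= j)%N -> opcoef p (n + k) j = 0.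
  by exists z.+1 => j zj; apply: pz; lia.
elim: e p pz pk pe {IH} => [|e IHe] p pz pk pe.
  exists p; rewrite subrr; split=> // i j; rewrite leq_eqVlt => /orP[/eqP <-|lt]; first exact: pe.
  by apply: pk; lia.
pose c := opcoef p (n + k) e.
pose p' := p - c *: (opdx F ^+ k * (opdy F ^+ e * w)).
have [y0 y1] := opcoef_dy_column e wcol w1.
have yx : xdeg_lt (opdy F ^+ e * w) n.+1.
  apply: xdeg_lt_mul_dy wx => i j i1; rewrite -[opdy F ^+ e]mul1r -(expr0 (opdx F)).
  by rewrite opcoef_monomial; case: i i1.
have [xk xE] := xdeg_lt_dx k yx.
have Jp' : J (p - p') by rewrite /p' opprB addrC subrK; apply/JZ/JM/JM.
have p'z : order_le p' z.
  move=> i j ij; rewrite opcoefB opcoefZ pz // sub0r.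
  case: (eqVneq c 0) => [->|cn0]; first by rewrite mul0r oppr0.
  have nke : (n + k + e <= z)%N by rewrite leqNgt; apply: contra cn0 => lt; rewrite /c pz.
  have /order_le_weight wle := wn.
  have [le _] := wform_monomial k e (ltn0Sn 0) (ltn0Sn 0) wle.
  by rewrite mulrA le ?mulr0 ?oppr0 //; lia.
have p'k : xdeg_lt p' (n + k.+1).
  move=> i j ij; rewrite opcoefB opcoefZ pk // xk ?mulr0 ?subr0 //; lia.
have p'e j : (e <= j)%N -> opcoef p' (n + k) j = 0.
  rewrite opcoefB opcoefZ addnC xE leq_eqVlt => /orP[/eqP <-|lt].
    by rewrite addn0 in y1; rewrite y1 mulr1 /c addnC subrr.
  by rewrite addnC pe // y0 ?addn0 // mulr0 subr0.
have [q [Jq qz qk]] := IHe p' p'z p'k p'e; exists q; split=> //.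
by rewrite -(subrK p' p) -addrA; exact: JD.
Qed.

(** The column of d_x^k is divided by the leading coefficient of [p1], of degree [d] in d_y. The
    multiples subtracted may alter lower columns, but stay inside the box. *)
Lemma reduce_column p1 m N d k B p : J p1 -> box p1 m N ->
    (forall j, (d < j)%N -> opcoef p1 m j = 0) -> opcoef p1 m d = 1 -> (m <= k)%N ->
    box p k B -> forall e, (e + N <= B)%N -> (forall j, (e <= j)%N -> opcoef p k j = 0) ->
  exists r, [/\ J (p - r), box r k B & forall j, (d <= j)%N -> opcoef r k j = 0].
Proof.
move=> Jp1 p1b p1c p11 mk pb e; elim: e p pb => [|e IH] p pb eB pe.
  by exists p; rewrite subrr; split=> // j _; exact: pe.
case: (leqP e.+1 d) => [ed|de].
  by exists p; rewrite subrr; split=> // j dj; apply: pe; exact: leq_trans dj.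
pose l := (e - d)%N; pose c := opcoef p k e.
pose s := opdx F ^+ (k - m) * (opdy F ^+ l * p1).
have [y0 y1] := opcoef_dy_column l p1c p11.
have yx : xdeg_lt (opdy F ^+ l * p1) m.+1.
  apply: xdeg_lt_mul_dy => [i j i1|i j mi]; last by apply: p1b; rewrite mi.
  rewrite -[opdy F ^+ l]mul1r -(expr0 (opdx F)).
  by rewrite opcoef_monomial; case: i i1.
have [_ xE] := xdeg_lt_dx (k - m) yx.
have sE j : opcoef s k j = opcoef (opdy F ^+ l * p1) m j by rewrite -xE subnK.
have sb : box s k B.
  rewrite /s mulrA; apply: boxW (box_monomial (k := k - m) (l := l) p1b); first by rewrite subnK.
  by rewrite /l; lia.
pose p' := p - c *: s.
have p'b : box p' k B by move=> i j ij; rewrite opcoefB opcoefZ pb // sb // mulr0 subr0.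
have ld : (l + d = e)%N by rewrite /l; lia.
have p'e j : (e <= j)%N -> opcoef p' k j = 0.
  rewrite opcoefB opcoefZ sE leq_eqVlt => /orP[/eqP <-|lt].
    by rewrite -{2}ld y1 mulr1 subrr.
  by rewrite pe // y0 ?ld // mulr0 subr0.
have [|r [Jr rb rd]] := IH p' p'b _ p'e; first by lia.
exists r; split=> //; rewrite -(subrK p' p) -addrA; apply: JD => //.
by rewrite /p' opprB addrC subrK; apply/JZ/JM/JM.
Qed.

(** Columns are cleared from the top down, and each raises the power of d_y by at most N + 1. The
    bound grows with [L] at rate 1, which is what gives the slope [m] later. *)
Lemma reduce_columns p1 m N d p k L : J p1 -> box p1 m N ->
    (forall j, (d < j)%N -> opcoef p1 m j = 0) -> opcoef p1 m d = 1 ->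
    xdeg_lt p (m + k) -> (forall i j, (L < j)%N -> opcoef p i j = 0) ->
  exists r, J (p - r) /\ forall i j, opcoef r i j != 0 ->
    ((i < m) && (j <= L + k * N.+1))%N || ((m <= i < m + k) && (j < d))%N.
Proof.
move=> Jp1 p1b p1c p11; elim: k p L => [|k IH] p L pk pL.
  exists p; rewrite subrr; split=> // i j nz; rewrite addn0 in pk.
  have im : (i < m)%N by rewrite ltnNge; apply: contra nz => mi; rewrite pk.
  have jL : (j <= L)%N by rewrite leqNgt; apply: contra nz => Lj; rewrite pL.
  by rewrite im mul0n addn0 jL.
have pb : box p (m + k) (L.+1 + N).
  by move=> i j /orP[ik|jL]; [apply: pk; lia|apply: pL; lia].
have [r0 [Jr0 r0b r0d]] := reduce_column Jp1 p1b p1c p11 (leq_addr k m) pb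
  (leqnn (L.+1 + N)) (fun j lj => pL _ _ lj).
(* The reduced top column is set aside, and the induction treats the rest. *)
pose col : diffop F := (r0 : {poly {poly F}})`_(m + k) *: 'X^(m + k).
have colE i j : opcoef col i j = if i == (m + k)%N then opcoef r0 (m + k) j else 0.
  by rewrite /opcoef /col coefZ coefXn; case: eqP => _; rewrite ?mulr1 // mulr0 coef0.
have [|i j Lj|r1 [Jr1 r1S]] := IH (r0 - col) (L.+1 + N)%N.
- move=> i j; rewrite opcoefB colE; case: eqP => [->|/eqP ne mki]; first by rewrite subrr.
  by rewrite subr0 r0b // ltn_neqAle eq_sym ne mki.
- rewrite opcoefB colE; case: eqP => [->|_]; first by rewrite subrr.
  by rewrite subr0 r0b // Lj orbT.
exists (col + r1); split.
  have -> : p - (col + r1) = (p - r0) + (r0 - col - r1).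
    by rewrite -[r0 - col - r1]addrA -opprD addrA subrK.
  exact: JD.
move=> i j; rewrite opcoefD colE; case: (eqVneq i (m + k)%N) => [->|ne].
  case: (ltnP j d) => jd; first by move=> _; apply/orP; right; apply/andP; split=> //; lia.
  by rewrite r0d // add0r => /r1S; lia.
rewrite add0r => /r1S /orP[/andP[im jL]|/andP[/andP[mi ik] jd]].
  by rewrite im /=; apply/orP; left; nia.
by apply/orP; right; rewrite jd andbT mi; lia.
Qed.

(* Division by the monic w bounds the power of d_x by n, and division by p1    *)
(* then bounds the power of d_y next to d_x^m, ..., d_x^(n-1).                 *)
Lemma quotient_dim_upper w n p1 m : J w -> order_le w n -> opcoef w n 0 = 1 ->
    J p1 -> xdeg p1 m -> (m <= n)%N ->
  exists C, forall z k, quotient_dim J z k -> (k <= m * z + C)%N.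
Proof.
move=> Jw wn w1 Jp1 [p1x [j0 nz0]] mn.
have [N p1N] := box_exists p1.
have exP : exists j, opcoef p1 m j != 0 by exists j0.
have bP j : opcoef p1 m j != 0 -> (j <= N)%N.
  by move=> nz; rewrite leqNgt; apply: contra nz => lt; rewrite p1N // lt orbT.
case: (ex_maxnP exP bP) => d nzd maxd.
pose q := (opcoef p1 m d)^-1 *: p1.
have qb : box q m N.
  move=> i j /orP[mi|Nj]; rewrite opcoefZ; first by rewrite (p1x i j mi) mulr0.
  by rewrite (p1N i j) ?mulr0 // Nj orbT.
have qc j : (d < j)%N -> opcoef q m j = 0.
  move=> dj; rewrite opcoefZ (_ : opcoef p1 m j = 0) ?mulr0 //.
  by apply/eqP; apply: contraTT dj => /maxd; rewrite -leqNgt.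
have q1 : opcoef q m d = 1 by rewrite opcoefZ mulVf.
have Jq : J q by exact: JZ.
(* The surviving exponents are those in [l]: [m] columns of length z + (n - m)(N + 1) + 1, and n - m
   columns of length [d]. *)
exists (m * ((n - m) * N.+1).+1 + (n - m) * d)%N => z k [e [ez inde _]].
pose l := [seq (i, j) | i <- iota 0 m, j <- iota 0 (z + (n - m) * N.+1).+1] ++
  [seq (i, j) | i <- iota m (n - m), j <- iota 0 d].
have red p : order_le p z -> exists r, J (p - r) /\ forall i j, opcoef r i j != 0 -> (i, j) \in l.
  move=> pz; have [r [Jr rz rn]] := reduce_order Jw wn w1 pz.
  have rk : xdeg_lt r (m + (n - m)) by rewrite subnKC.
  have rL i j : (z < j)%N -> opcoef r i j = 0 by move=> zj; apply: rz; lia.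
  have [r' [Jr' r'S]] := reduce_columns Jq qb qc q1 rk rL.
  exists r'; split; first by rewrite -(subrK r p) -addrA; exact: JD.
  move=> i j /r'S /orP[/andP[im jL]|/andP[/andP[mi ik] jd]]; rewrite mem_cat; apply/orP.
    by left; apply: allpairs_f; rewrite mem_iota //= ?add0n ?ltnS.
  by right; apply: allpairs_f; rewrite mem_iota ?add0n ?mi.
have [n' n'l [g sp]] := spans_support sJ red.
have := independent_le_spanning sJ ez inde sp; rewrite !card_ord => kn'.
apply: leq_trans kn' (leq_trans n'l _).
rewrite size_cat !size_allpairs !size_iota; nia.
Qed.

End UpperBound.

(** * Shears of the derivations *)

Lemma mul_act1 (F : diffFieldType) (p : diffop F) :
  opact (fun v : diffop F => opdx F * v) (fun v => opdy F * v) p 1 = p.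
Proof.
have A := mul_action F; elim/diffop_ind: p => [|p q IHp IHq|a p IH|p IH|p IH].
- by rewrite act1.
- by rewrite actD IHp IHq.
- by rewrite actZ IH.
- by rewrite (act_dx A) IH.
- by rewrite (act_dy A) IH.
Qed.

(* An alias of F whose second derivation is d_y + m d_x. *)
Definition shear (F : diffFieldType) (m : int) : Type := F.

Section Shear.
Variables (F : diffFieldType) (m : int).

HB.instance Definition _ := GRing.Field.copy (shear F m) F.

Definition shear_dy (a : F) : F := dy a + dx a *~ m.

Let shear_dyD a b : shear_dy (a + b) = shear_dy a + shear_dy b.
Proof. by rewrite /shear_dy !raddfD /= mulrzDl addrACA. Qed.
Let shear_dyM a b : shear_dy (a * b) = shear_dy a * b + a * shear_dy b.
Proof. by rewrite /shear_dy dxM dyM mulrzDl mulrDl mulrDr mulrzAl mulrzAr addrACA. Qed.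
Let shear_dxdyC a : dx (shear_dy a) = shear_dy (dx a).
Proof. by rewrite /shear_dy raddfD /= raddfMz /= dxdyC. Qed.

HB.instance Definition _ := Field_hasTwoDerivations.Build (shear F m)
  (@dxD F) shear_dyD (@dxM F) shear_dyM shear_dxdyC.

Notation F' := (shear F m).


Let actMz (U V : zmodType) (X : U -> V) : (forall u v, X (u + v) = X u + X v) ->
  forall v k, X (v *~ k) = X v *~ k.
Proof.
move=> XD v k.
have X0 : X 0 = 0 by apply: (addrI (X 0)); rewrite -XD !addr0.
have Xn n : X (v *+ n) = X v *+ n by elim: n => // n IH; rewrite !mulrS XD IH.
have XN u : X (- u) = - X u by apply: (addrI (X u)); rewrite -XD !subrr X0.
by case: k => n; rewrite /intmul ?XN Xn.
Qed.

Lemma shear_action (V : lmodType F) (X Y : V -> V) : diff_action X Y ->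
  @diff_action F' (V : lmodType F) X (fun v => Y v + X v *~ m).
Proof.
move=> [XD YD XZ YZ XY]; split=> //.
- by move=> u v; rewrite XD YD mulrzDl addrACA.
- move=> a v; rewrite YZ XZ mulrzDl.
  rewrite -[(dy a : F')]/(dy (a : F) + dx (a : F) *~ m).
  by rewrite scalerDl scalerDr -!scalerMzl -!scalerMzr addrACA.
- by move=> v; rewrite XD actMz // XY.
Qed.

Lemma unshear_action (V : lmodType F') (X Y : V -> V) : diff_action X Y ->
  @diff_action F (V : lmodType F') X (fun v => Y v + X v *~ (- m)).
Proof.
move=> [XD YD XZ YZ XY]; split=> //.
- by move=> u v; rewrite XD YD mulrzDl addrACA.
- move=> a v; rewrite YZ XZ mulrzDl.
  rewrite -[(dy (a : F'))]/(dy (a : F) + dx (a : F) *~ m).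
  rewrite -[LHS]/((dy (a : F) + dx (a : F) *~ m) *: v + a *: Y v +
    (((dx (a : F) : F') *: v) *~ (- m) + (a *: X v) *~ (- m))).
  by rewrite scalerDl scalerDr -scalerMzl -scalerMzr mulrNz addrACA addrK.
- by move=> v; rewrite XD actMz // XY.
Qed.

(** The same operator in the new derivations: d_y is replaced by the new second derivation minus m
    d_x. *)
Definition shear_op (p : diffop F) : diffop F' :=
  @opact F (diffop F' : lmodType F') (fun v => opdx F' * v) (fun v => opdy F' * v + (opdx F' * v) *~ (- m)) p 1.
Definition unshear_op (p : diffop F') : diffop F :=
  @opact F' (diffop F : lmodType F) (fun v => opdx F * v) (fun v => opdy F * v + (opdx F * v) *~ m) p 1.

Let A' := unshear_action (mul_action F').
Let A := shear_action (mul_action F).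

Lemma shear_opD p q : shear_op (p + q) = shear_op p + shear_op q.
Proof. exact: (@actD F (diffop F' : lmodType F')). Qed.
Lemma shear_opZ a p : shear_op (a *: p) = (a : F') *: shear_op p.
Proof. exact: (@actZ F (diffop F' : lmodType F')). Qed.
Lemma unshear_opD p q : unshear_op (p + q) = unshear_op p + unshear_op q.
Proof. exact: (@actD F' (diffop F : lmodType F)). Qed.
Lemma unshear_opZ a p : unshear_op (a *: p) = (a : F) *: unshear_op p.
Proof. exact: (@actZ F' (diffop F : lmodType F)). Qed.

Lemma shear_opact (V : lmodType F) (X Y : V -> V) p v : diff_action X Y ->
  @opact F' V X (fun v => Y v + X v *~ m) (shear_op p) v = opact X Y p v.
Proof.
move=> B; have B' := shear_action B.
elim/diffop_ind: p => [|p q IHp IHq|a p IH|p IH|p IH].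
- by rewrite /shear_op act1 act1 act1.
- by rewrite shear_opD !actD IHp IHq.
- by rewrite shear_opZ !actZ IH.
- by rewrite /shear_op (act_dx A') (act_dx B') (act_dx B) IH.
- rewrite /shear_op (act_dy A') actD (act_dy B') IH -/(shear_op p).
  rewrite (actMz (X := fun p => opact _ _ p v)) ?(act_dx B') ?IH ?(act_dy B); last first.
    by move=> *; exact: actD.
  by rewrite mulrNz addrK.
Qed.

Lemma unshear_opact (V : lmodType F') (X Y : V -> V) p v : diff_action X Y ->
  @opact F V X (fun v => Y v + X v *~ (- m)) (unshear_op p) v = opact X Y p v.
Proof.
move=> B; have B' := unshear_action B.
elim/diffop_ind: p => [|p q IHp IHq|a p IH|p IH|p IH].
- by rewrite /unshear_op act1 act1 act1.
- by rewrite unshear_opD !actD IHp IHq.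
- by rewrite unshear_opZ !actZ IH.
- by rewrite /unshear_op (act_dx A) (act_dx B') (act_dx B) IH.
- rewrite /unshear_op (act_dy A) actD (act_dy B') IH -/(unshear_op p).
  rewrite (actMz (X := fun p => opact _ _ p v)) ?(act_dx B') ?IH ?(act_dy B); last first.
    by move=> *; exact: actD.
  by rewrite mulrNz subrK.
Qed.

Lemma shear_opK : cancel shear_op unshear_op.
Proof.
move=> p; have E := @shear_opact (diffop F : lmodType F) _ _ p 1 (mul_action F).
by rewrite /unshear_op E mul_act1.
Qed.
Lemma unshear_opK : cancel unshear_op shear_op.
Proof.
move=> p; have E := @unshear_opact (diffop F' : lmodType F') _ _ p 1 (mul_action F').
by rewrite /shear_op E mul_act1.
Qed.

Lemma unshear_op_dx p : unshear_op (opdx F' * p) = opdx F * unshear_op p.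
Proof. exact: (act_dx A). Qed.
Lemma unshear_op_dy p :
  unshear_op (opdy F' * p) = opdy F * unshear_op p + (opdx F * unshear_op p) *~ m.
Proof. exact: (act_dy A). Qed.

Lemma unshear_opM p q : unshear_op (p * q) = unshear_op p * unshear_op q.
Proof.
elim/diffop_ind: p => [|p r IHp IHr|a p IH|p IH|p IH].
- by rewrite mul1r {2}/unshear_op act1 mul1r.
- by rewrite mulrDl !unshear_opD mulrDl IHp IHr.
- by rewrite -scalerAl !unshear_opZ IH scalerAl.
- by rewrite -mulrA !unshear_op_dx -mulrA IH.
- rewrite -mulrA !unshear_op_dy IH [RHS]mulrDl !mulrA; congr (_ + _).
  exact/esym/(@mulrzAl (diffop F : nzRingType)).
Qed.

Lemma unshear_op0 : unshear_op 0 = 0.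
Proof. exact: (@act0 F' (diffop F : lmodType F)). Qed.
Lemma unshear_opN p : unshear_op (- p) = - unshear_op p.
Proof. by apply: (addrI (unshear_op p)); rewrite -unshear_opD !subrr unshear_op0. Qed.
Lemma unshear_op_sum n (f : 'I_n -> diffop F') : unshear_op (\sum_i f i) = \sum_i unshear_op (f i).
Proof. by apply: (big_morph unshear_op) => [p q|]; rewrite (unshear_opD, unshear_op0). Qed.

Let order_le_int (K : diffFieldType) (p : diffop K) k n : order_le p n -> order_le (p *~ k) n.
Proof. by rewrite -scaler_int; exact: order_leZ. Qed.

Lemma unshear_op_order p n : order_le p n -> order_le (unshear_op p) n.
Proof.
move: n p; apply: order_ind => [|n p q|n a p|n p IH|n p IH|n p /(@order_leW F _ _ _ (leqnSn n))] //.
- by rewrite /unshear_op act1; exact: order_le1.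
- by rewrite unshear_opD; exact: order_leD.
- by rewrite unshear_opZ; exact: order_leZ.
- by rewrite unshear_op_dx; exact: order_le_dx.
- rewrite unshear_op_dy; apply: order_leD; first exact: order_le_dy.
  by apply: order_le_int; exact: order_le_dx.
Qed.

(** The new coefficient of d_x^n is the principal symbol of [p] at (1, -m). *)
Lemma shear_op_order_top p n : order_le p n ->
  [/\ order_le p n, order_le (shear_op p) n &
  opcoef (shear_op p) n 0 = \sum_(i < n.+1) opcoef p (n - i) i * ((- m)%:~R : F) ^+ i].
Proof.
move: n p; apply: order_ind => [|n p q [p0 p1 p2] [q0 q1 q2]|n a p [p0 p1 p2]|n p [p0 p1 p2]|n p [p0 p1 p2]|n p [p0 p1 p2]].
- split; rewrite /shear_op ?act1; [exact: order_le1|exact: order_le1|].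
  by rewrite big_ord1 !opcoef1 mulr1.
- split; rewrite ?shear_opD; [exact: order_leD|exact: order_leD|].
  rewrite opcoefD p2 q2 -big_split; apply: eq_bigr => i _.
  by rewrite opcoefD mulrDl.
- split; rewrite ?shear_opZ; [exact: order_leZ|exact: order_leZ|].
  rewrite opcoefZ p2 mulr_sumr; apply: eq_bigr => i _.
  by rewrite opcoefZ mulrA.
- split; rewrite /shear_op ?(act_dx A') -/(shear_op p); [exact: order_le_dx|exact: order_le_dx|].
  rewrite opcoef_dx p1 ?raddf0 ?add0r ?addn0 // p2 [RHS]big_ord_recr /= subnn.
  rewrite opcoef_dx p0 ?add0n // raddf0 !addr0 mul0r addr0.
  apply: eq_bigr => i _; rewrite subSn ?leq_ord // opcoef_dx (p0 (n - i).+1) ?raddf0 ?add0r //.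
  by have := leq_ord i; lia.
- split; rewrite /shear_op ?(act_dy A') -/(shear_op p); first exact: order_le_dy.
    apply: order_leD; first exact: order_le_dy.
    by apply: order_le_int; exact: order_le_dx.
  rewrite opcoefD opcoef_dy p1 ?addn0 // raddf0 addr0 add0r -scaler_int opcoefZ opcoef_dx.
  rewrite p1 ?addn0 // raddf0 add0r p2 [RHS]big_ord_recl /= subn0.
  rewrite opcoef_dy p0 ?addn0 // raddf0 !add0r mul0r add0r mulr_sumr.
  apply: eq_bigr => i _; rewrite /bump /= add1n subSS opcoef_dy.
  rewrite (p0 (n - i)%N i.+1) ?raddf0 ?add0r ?addnS ?subnK ?leq_ord //.
  by rewrite exprS mulrCA.
- split; [exact: (order_leW (leqnSn n))|exact: (order_leW (leqnSn n))|].
  rewrite p1 ?addn0 // big1 // => i _; rewrite p0 ?mul0r //.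
  by rewrite subnK // -ltnS.
Qed.

Section Ideals.
Variable J : diffop F -> Prop.
Definition shear_ideal (p : diffop F') := J (unshear_op p).

Lemma shear_left_ideal : left_ideal J -> left_ideal shear_ideal.
Proof.
case=> J0 JD JM; split; rewrite /shear_ideal; [|move=> p q Jp Jq|move=> p q Jq].
- by rewrite unshear_op0.
- by rewrite unshear_opD; exact: JD.
- by rewrite unshear_opM; exact: JM.
Qed.

Lemma shear_quotient_dim z n : quotient_dim shear_ideal z n <-> quotient_dim J z n.
Proof.
split=> [[e [ez ind sp]]|[e [ez ind sp]]].
  exists (fun i => unshear_op (e i)); split=> [i|c Jc|p pz].
  - exact/unshear_op_order/ez.
  - apply: (ind c); rewrite /shear_ideal unshear_op_sum.
    by under eq_bigr => i _ do rewrite unshear_opZ.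
  - have [_ pz' _] := shear_op_order_top pz; have [c Jc] := sp _ pz'.
    exists c; move: Jc; rewrite /shear_ideal unshear_opD unshear_opN shear_opK unshear_op_sum.
    by under eq_bigr => i _ do rewrite unshear_opZ.
exists (fun i => shear_op (e i)); split=> [i|c|p pz].
- by have [] := shear_op_order_top (ez i).
- rewrite /shear_ideal unshear_op_sum => Jc; apply: (ind c).
  by under eq_bigr => i _ do rewrite -[e i]shear_opK -unshear_opZ.
- have [c Jc] := sp _ (unshear_op_order pz).
  exists c; rewrite /shear_ideal unshear_opD unshear_opN unshear_op_sum.
  by under eq_bigr => i _ do rewrite unshear_opZ shear_opK.
Qed.

Lemma shear_hilbert_kolchin K : hilbert_kolchin_poly shear_ideal K <-> hilbert_kolchin_poly J K.
Proof.
by split=> [[z0 Kz]|[z0 Kz]]; exists z0 => z /Kz[n dn Kn]; exists n => //; apply/shear_quotient_dim.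
Qed.

End Ideals.

Section Symbols.
Variable G : fd_symbol F'.

Fact unshear_nonconst : (dx (fd_head G : F), dy (fd_head G : F)) <> (0, 0).
Proof.
case=> x0 y0; apply: (@fd_head_nonconst _ G).
rewrite -[dx (fd_head G)]/(dx (fd_head G : F)) x0.
by rewrite -[dy (fd_head G)]/(dy (fd_head G : F) + dx (fd_head G : F) *~ m) x0 y0 mul0rz addr0.
Qed.

Definition unshear_symbol : fd_symbol F :=
  @FdSymbol F (fd_head G) (fd_tail G) unshear_nonconst
    (fd_exponents_decreasing G) (fd_exponents_gt0 G).

Lemma fd_act_shear p H : fd_act G (shear_op p) H = fd_act unshear_symbol p H.
Proof.
have E := @shear_opact (rat -> F^o : lmodType F) _ _ p H (fd_action unshear_symbol).
rewrite -[RHS]E /fd_act; congr opact; apply/funext => v; apply/funext => s.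
have fMz (w : rat -> F^o) : (w *~ m) s = w s *~ m.
  by apply: (actMz (X := fun k : rat -> F^o => k s)).
rewrite [RHS](_ : _ = fd_derive unshear_symbol (@dy F) v s +
  fd_derive unshear_symbol (@dx F) v s *~ m); last by rewrite -fMz.
rewrite /fd_derive mulrzDl -[dy (v s)]/(dy (v s : F) + dx (v s : F) *~ m).
rewrite -!addrA; congr (_ + _); rewrite addrCA; congr (_ + _).
rewrite [X in _ = _ + X]mulrz_suml -big_split; apply: eq_bigr => t _.
by rewrite -[dy t.2]/(dy (t.2 : F) + dx (t.2 : F) *~ m) mulrDl mulrzAl.
Qed.

Lemma shear_solution J H :
  fd_series_solution G (shear_ideal J) H <-> fd_series_solution unshear_symbol J H.
Proof.
split=> [[sH solH]|[sH solH]]; split=> // p Jp.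
  by rewrite -fd_act_shear; apply: solH; rewrite /shear_ideal shear_opK.
by rewrite -[p]unshear_opK fd_act_shear; exact: solH.
Qed.

End Symbols.

End Shear.

Lemma shear_diff_generates (K : diffFieldType) m (S : K -> Prop) :
  diff_generates S -> @diff_generates (shear K m) S.
Proof.
move=> gen P [P1 PB PV Px Py] SP a; apply: gen SP a; split=> // a Pa.
have P0 : P 0 by rewrite -[0](subrr 1); exact: PB.
have PN b : P b -> P (- b) by move=> Pb; rewrite -sub0r; exact: PB.
have PMz b k : P b -> P (b *~ k).
  move=> Pb; have Pn n : P (b *+ n).
    elim: n => [|n IH]; first by rewrite mulr0n.
    by rewrite mulrSr -[b in _ + b]opprK; apply/PB/PN.
  by case: k => n; rewrite /intmul; [|apply: PN]; exact: Pn.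
rewrite -[dy a](addrK (dx a *~ m)); apply: PB; first exact: Py.
by apply: PMz; exact: Px.
Qed.

(** Shearing [E] and [K] back by -m turns the extension problem over the sheared field into one over
    [F]. Generation is unaffected, as each second derivation is the other plus an integer multiple
    of d_x. *)
Lemma shear_universal (F : diffFieldType) m : kolchin_universal F -> kolchin_universal (shear F m).
Proof.
move=> univF E i [ix iy] [s Es] K j [jx jy] [t Kt].
pose i0 : {rmorphism shear E (- m) -> F} := i; pose j0 : {rmorphism shear E (- m) -> shear K (- m)} := j.
have i0d : diff_morphism i0.
  split=> a; first exact: ix.
  rewrite -[LHS]/(i (dy (a : E) + dx (a : E) *~ (- m))) rmorphD rmorphMz /= iy ix mulrNz.
  exact: addrK.
have j0d : diff_morphism j0.
  split=> a; first exact: jx.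
  by rewrite -[LHS]/(j (dy (a : E) + dx (a : E) *~ (- m))) rmorphD rmorphMz /= jy jx.
have fgE : diff_finitely_generated (shear E (- m)) by exists s; exact: shear_diff_generates.
have fgK : diff_finitely_generated_over j0 by exists t; exact: shear_diff_generates.
have [h [[hx hy] hj]] := univF _ i0 i0d fgE _ j0 j0d fgK.
pose h0 : {rmorphism K -> shear F m} := h.
exists h0; split; last exact: hj.
split=> a; first exact: hx.
rewrite -[RHS]/(dy (h a) + dx (h a) *~ m) -hx -hy.
rewrite -[X in h X + _]/(dy (a : K) + dx (a : K) *~ (- m)) rmorphD rmorphMz mulrNz /=.
by rewrite -[dx (a : shear K _)]/(dx (a : K)) subrK.
Qed.

(** The principal symbol at (1, T) is a nonzero polynomial in T, and in characteristic 0 some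
    natural number is not a root of it. *)
Lemma shear_noncharacteristic (F : diffFieldType) (w : diffop F) : [pchar F] =i pred0 -> w != 0 ->
  exists m n, order_le (shear_op m w) n /\ opcoef (shear_op m w) n 0 != 0.
Proof.
move=> char0 w0; have [n lead] := weight_lead_exists 1 1 w0.
have wn := weight_lead_order lead; have [_ [i [j [ijn nz]]]] := lead.
pose s : {poly F} := \poly_(i < n.+1) opcoef w (n - i) i.
have sn0 : s != 0.
  apply/eqP => /polyP/(_ j); rewrite coef_poly coef0 ltnS (_ : (j <= n)%N); last lia.
  by rewrite (_ : (n - j)%N = i); [exact/eqP|lia].
have natI : injective (fun k : nat => k%:R : F).
  move=> k l /=; wlog kl : k l / (k <= l)%N => [IH kl|].
    by case: (leqP k l) => [/IH/(_ kl)|/ltnW/IH/(_ (esym kl))].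
  move=> /eqP; rewrite eq_sym -subr_eq0 -natrB // ((pcharf0P F).1 char0); lia.
have [k sk] : exists k : nat, s.[k%:R] != 0.
  apply: contrapT => nk.
  have : (size [seq (k%:R : F) | k <- iota 0 (size s)] < size s)%N.
    apply: max_poly_roots => //; last by rewrite map_inj_uniq ?iota_uniq.
    by apply/allP => _ /mapP[k _ ->]; rewrite rootE; apply: contra_notT nk; exists k.
  by rewrite size_map size_iota ltnn.
exists (- k%:Z), n; have [_ ? E] := shear_op_order_top (- k%:Z) wn; split=> //.
by rewrite E opprK; move: sk; rewrite horner_poly.
Qed.

(** * The equivalence *)

Lemma eventually_ge0_slope (a b : rat) z0 :
  (forall z : nat, (z0 <= z)%N -> 0 <= a * z%:R + b) -> 0 <= a.
Proof.
move=> H; rewrite leNgt; apply/negP => a0.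
pose k := Num.bound `|b / - a|.
have kb : b / - a < k%:R by apply: le_lt_trans (ler_norm _) (archi_boundP (normr_ge0 _)).
have := H (maxn z0 k) (leq_maxl _ _); apply/negP; rewrite -ltNge.
have kz : k%:R <= (maxn z0 k)%:R :> rat by rewrite ler_nat leq_maxr.
have /(lt_le_trans kb) : k%:R <= (maxn z0 k)%:R :> rat by [].
rewrite ltr_pdivrMr ?oppr_gt0 //; lra.
Qed.

Lemma bounded_nondecreasing_stable (r : nat -> nat) z0 B :
    (forall z, (z0 <= z)%N -> (r z <= r z.+1)%N) -> (forall z, (z0 <= z)%N -> (r z <= B)%N) ->
  exists R z1, forall z, (z1 <= z)%N -> r z = R.
Proof.
move=> mono bnd.
pose P v := `[< exists2 z, (z0 <= z)%N & r z = v >].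
have exP : exists v, P v by exists (r z0); apply/asboolP; exists z0.
have bP v : P v -> (v <= B)%N by move=> /asboolP[z zz <-]; exact: bnd.
case: (ex_maxnP exP bP) => R /asboolP[z1 z01 E] max; exists R, z1 => z zz.
have le k : (r z1 <= r (z1 + k)%N)%N.
  by elim: k => [|k /leq_trans]; rewrite ?addn0 // addnS; apply; apply: mono; lia.
apply/eqP; rewrite eqn_leq max; last by apply/asboolP; exists z => //; lia.
by rewrite -E -(subnKC zz) le.
Qed.

Lemma horner_size2 (K : {poly rat}) x : (size K <= 2)%N -> K.[x] = K`_1 * x + K`_0.
Proof.
by move=> K2; rewrite (horner_coef_wide x K2) !big_ord_recl big_ord0 /= expr0 mulr1 addr0 addrC.
Qed.

(** * From equal solutions to equivalence *)

Section Minimal.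
Variable F : diffFieldType.
Implicit Types (p q r w : diffop F) (J I : diffop F -> Prop).

(** Such a [p] generates the ideal once the nonzero operators in F[d_y] are inverted
    ([min_xdeg_divides]). *)
Definition min_xdeg J p m := [/\ J p, xdeg p m & forall q, J q -> xdeg_lt q m -> q = 0].

Lemma xdeg_neq0 p m : xdeg p m -> p != 0.
Proof. by move=> [_ [j]]; apply: contraNneq => ->; rewrite opcoef0. Qed.

Lemma min_xdeg_exists J p : J p -> p != 0 -> exists q m, min_xdeg J q m.
Proof.
move=> Jp p0; have [k pk] := xdeg_exists p0.
pose P m := `[< exists2 q, J q & xdeg q m >].
have exP : exists m, P m by exists k; apply/asboolP; exists p.
case: (ex_minnP exP) => m /asboolP[q Jq qm] min; exists q, m; split=> // r Jr rm.
apply/eqP; apply: contraT => /xdeg_exists[l rl].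
have /min : P l by apply/asboolP; exists r.
by move: rl => [_ [j nz]] ml; move: nz; rewrite rm ?eqxx.
Qed.

(** The remainder of the pseudo-division lies in [J] with d_x-degree below [m], hence vanishes. *)
Lemma min_xdeg_divides J p m q : left_ideal J -> min_xdeg J p m -> J q ->
  exists a u, [/\ a != 0, xdeg_lt a 1 & a * q = u * p].
Proof.
move=> idJ [Jp pm min] Jq; have [a [u [a0 a1 le]]] := pseudo_division q pm.
exists a, u; split=> //; apply/eqP; rewrite -subr_eq0; apply/eqP/min => //.
have sJ := left_ideal_subspace idJ; have [_ _ JM] := idJ.
by apply: subspaceB => //; exact: JM.
Qed.

Lemma dy_operatorE p : xdeg_lt p 1 -> exists N, p = \sum_(i < N) opcoef p 0 i *: opdy F ^+ i.
Proof.
move=> p1; have [n pn] := order_le_exists p; exists n.+1; apply: opP => i j.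
rewrite opcoef_sum; under eq_bigr => k _ do
  rewrite opcoefZ -[opdy F ^+ k]mul1r -(expr0 (opdx F)) opcoef_monomial.
case: i => [|i]; last by rewrite p1 // big1 // => k _; rewrite mulr0.
case: (ltnP j n.+1) => [jn|nj]; last first.
  rewrite pn ?add0n // big1 // => k _; rewrite (_ : (j == k) = false) ?mulr0 //.
  by apply/negP => /eqP E; have := ltn_ord k; rewrite -E ltnNge nj.
rewrite (bigD1 (Ordinal jn)) //= !eqxx mulr1 big1 ?addr0 // => k kj.
rewrite (_ : (j == k) = false) ?mulr0 //; apply/negP => /eqP E.
by case/eqP: kj; apply: val_inj.
Qed.

Lemma dy_operator_xdeg p : p != 0 -> xdeg_lt p 1 -> xdeg p 0.
Proof.
move=> p0 p1; have [k pk] := xdeg_exists p0; suff <- : k = 0%N by [].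
have [_ [j nz]] := pk; apply/eqP; rewrite -leqn0 leqNgt.
by apply: contra nz => k1; rewrite p1.
Qed.

Lemma dy_operator_normal p : p != 0 -> xdeg_lt p 1 -> exists n, normal p 0 n.
Proof.
move=> p0 p1; have [n lead] := weight_lead_exists 1 1 p0.
have [_ [i [j [ij nz]]]] := lead; exists n; split=> //.
- exact: dy_operator_xdeg.
- exact: weight_lead_order.
- case: i ij nz => [|i] ij; last by rewrite p1 ?eqxx.
  by move=> nz; rewrite subn0 (_ : n = j) //; lia.
Qed.

(** Leading exponents make a nonzero operator of F[d_y] injective here, so denominators can be
    cancelled. *)
Lemma dy_operator_act_neq0 (G : fd_symbol F) a p H : dy (fd_head G) != 0 -> is_fd_series G H ->
    a != 0 -> xdeg_lt a 1 -> fd_act G (a * p) H = 0 ->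
  fd_act G p H = 0.
Proof.
move=> d0 HG a0 a1 aH; apply: contrapT => nz.
have [N aE] := dy_operatorE a1.
apply: (sum_dy_act_neq0 (N := N) (c := fun i => opcoef a 0 i) d0 HG nz).
  apply: contrapT => no; case/eqP: a0; rewrite aE big1 // => i _.
  by apply/eqP; rewrite scaler_eq0; apply/orP; left; apply: contra_notT no; exists i.
by rewrite -aE -fd_act_mul.
Qed.

(** In a p1 = u p3 the operator [u] has degree m - m3. Were it positive, a nonzero kernel series H'
    of [u] would have the form p3 H. Then p1 H = 0, so [H] solves [J] and hence [I], which
    contradicts p3 H = H'. *)
Lemma min_xdeg_eq (char0 : [pchar F] =i pred0) (univF : kolchin_universal F) J I w n p1 m p3 m3 :
    left_ideal J -> left_ideal I -> (forall p, J p -> I p) ->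
    (forall G H, fd_series_solution G J H -> fd_series_solution G I H) ->
    J w -> order_le w n -> opcoef w n 0 != 0 ->
    min_xdeg J p1 m -> min_xdeg I p3 m3 ->
  m = m3.
Proof.
move=> idJ idI JI sol Jw wn wn0 min1 min3.
have [Jp1 p1m _] := min1; have [Ip3 p3m _] := min3.
have [a [u [a0 a1 E]]] := min_xdeg_divides idI min3 (JI _ Jp1).
have [b [v [b0 b1 E']]] := min_xdeg_divides idJ min1 Jw.
have [na aN] := dy_operator_normal a0 a1; have [nb bN] := dy_operator_normal b0 b1.
have wN : normal w n n.
  by split=> //; [split=> [i j ni|]; [apply: wn; lia|exists 0%N]|rewrite subnn].
(* Normality passes from the monic [w] to its factor [p1] in b w = v p1, and then to [u] in a p1 = u
   p3. This puts a positive power of d_x into the principal symbol of [u] when its degree is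
   positive. *)
have [_ [k1 [n1 p1N]]] : (exists l k, normal v l k) /\ (exists l k, normal p1 l k).
  by apply: (@normal_factors _ v p1 (0 + n) (nb + n)); rewrite -E'; exact: normalM.
have [[l [mu uN]] _] : (exists l k, normal u l k) /\ (exists l k, normal p3 l k).
  by apply: (@normal_factors _ u p3 (0 + k1) (na + n1)); rewrite -E; exact: normalM.
have [ul uo lmu nz] := uN.
have mE : m = (l + m3)%N.
  by apply: (@xdeg_unique _ (a * p1)); [exact: (xdegM (dy_operator_xdeg a0 a1))|rewrite E; exact: xdegM].
case: (posnP l) => [l0|l0]; first by rewrite mE l0.
have [G [G0 top]] := newton_puiseux char0 (universal_closed char0 univF)
  (transport_solvable char0 univF) (characteristic_solvable char0 univF) uo
  (introT andP (conj l0 lmu)) nz.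
have [H' [H'G H'0 uH']] := fd_act_kernel (field_surj char0 univF) (field_kernel char0 univF) top.
have [H [HG HH']] := fd_act_surj (field_surj char0 univF) (xdeg_neq0 p3m) H'G.
case: H'0; rewrite -HH'.
have p1H : fd_act G p1 H = 0.
  by apply: (dy_operator_act_neq0 G0 HG a0 a1); rewrite E fd_act_mul HH'.
have solJ : fd_series_solution G J H.
  split=> // q Jq; have [a' [u' [a'0 a'1 Eq]]] := min_xdeg_divides idJ min1 Jq.
  apply: (dy_operator_act_neq0 G0 HG a'0 a'1).
  by rewrite Eq fd_act_mul p1H fd_act0r.
by have [_ solI] := sol _ _ solJ; exact: solI.
Qed.

Lemma hilbert_slope_ge J K m : left_ideal J -> hilbert_kolchin_poly J K -> (size K <= 2)%N ->
  (forall p, J p -> xdeg_lt p m -> p = 0) -> m%:R <= K`_1.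
Proof.
move=> idJ [z0 KP] K2 Jm; rewrite -subr_ge0.
apply: (@eventually_ge0_slope _ (K`_0 + (m * m)%:R) (maxn z0 m)) => z.
rewrite geq_max => /andP[z0z mz]; have [n dim Kz] := KP z z0z.
have le := quotient_dim_lower idJ Jm mz dim.
rewrite (horner_size2 _ K2) in Kz.
have : (m * z)%:R <= (n + m * m)%:R :> rat by rewrite ler_nat; nia.
rewrite !natrD !natrM -Kz; lra.
Qed.

(** For the zero ideal every natural number would bound the slope from below. *)
Lemma nonholonomic_neq0 J : left_ideal J -> nonholonomic J -> exists2 p, J p & p != 0.
Proof.
move=> idJ [K KP K2]; apply: contrapT => no.
have Jm m p : J p -> xdeg_lt p m -> p = 0.
  by move=> Jp _; apply/eqP; apply: contra_notT no => p0; exists p.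
have := hilbert_slope_ge idJ KP _ (Jm (Num.bound K`_1)); rewrite K2 => /(_ isT).
by rewrite leNgt => /negP; apply; apply: archi_boundP; apply: (hilbert_slope_ge idJ KP _ (Jm 0%N)); rewrite K2.
Qed.

End Minimal.

Section Intersection.
Variable F : diffFieldType.
Implicit Types (p q r w : diffop F) (J I : diffop F -> Prop).

Lemma left_idealI J I : left_ideal J -> left_ideal I -> left_ideal (fun p => J p /\ I p).
Proof.
move=> [J0 JD JM] [I0 ID IM]; split=> // [p q [Jp Ip] [Jq Iq]|p q [Jq Iq]].
  by split; [exact: JD|exact: ID].
by split; [exact: JM|exact: IM].
Qed.

Lemma left_idealD J I : left_ideal J -> left_ideal I ->
  left_ideal (fun p => exists q r, [/\ J q, I r & p = q + r]).
Proof.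
move=> [J0 JD JM] [I0 ID IM]; split.
- by exists 0, 0; rewrite addr0.
- move=> _ _ [q [r [Jq Ir ->]]] [q' [r' [Jq' Ir' ->]]]; exists (q + q'), (r + r').
  by rewrite addrACA; split=> //; [exact: JD|exact: ID].
- move=> p _ [q [r [Jq Ir ->]]]; exists (p * q), (p * r).
  by rewrite mulrDr; split=> //; [exact: JM|exact: IM].
Qed.

Definition relative_dim J L z n := basis_mod (fun p => order_le p z /\ J p) L n.

Lemma relative_dim_exists J L z : left_ideal J -> left_ideal L -> exists n, relative_dim J L z n.
Proof.
move=> idJ idL; have [n [e [_ _ sp]]] := quotient_dim_exists z idL.
apply: (@basis_exists _ _ (fun p => order_le p z /\ J p) L _ e).
- by apply: subspaceI; [exact: order_le_subspace|exact: left_ideal_subspace].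
- exact: left_ideal_subspace.
- by move=> p [pz _]; exact: sp.
Qed.

Lemma relative_dim_le J L z z' n n' : left_ideal L -> (z <= z')%N ->
  relative_dim J L z n -> relative_dim J L z' n' -> (n <= n')%N.
Proof.
move=> idL zz' [e [eA ind _]] [e' [_ _ sp]].
have := independent_le_spanning (left_ideal_subspace idL) _ ind sp; rewrite !card_ord; apply.
by move=> i; have [ez Je] := eA i; split=> //; exact: order_leW ez.
Qed.

Lemma relative_dim_quotient J L z h h' k : left_ideal J -> left_ideal L -> (forall p, L p -> J p) ->
  quotient_dim J z h -> relative_dim J L z k -> quotient_dim L z h' -> h' = (h + k)%N.
Proof.
move=> idJ idL LJ; apply: basis_add => //.
- exact: order_le_subspace.
- exact: left_ideal_subspace.
- exact: left_ideal_subspace.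
Qed.


(** The dimension modulo [L] is at most m z + C and at least that modulo [J], whose slope is at
    least [m]. So the slope is [m] and the relative dimension stays bounded; being nondecreasing, it
    is eventually a constant R, and K + R serves [L]. This provides the polynomial of the
    intersection demanded by [equivalent_ideals]. *)
Lemma hilbert_kolchin_sub J L K w n p m : left_ideal J -> left_ideal L -> (forall p, L p -> J p) ->
    hilbert_kolchin_poly J K -> size K = 2%N -> (forall q, J q -> xdeg_lt q m -> q = 0) ->
    L w -> order_le w n -> opcoef w n 0 != 0 -> L p -> xdeg p m ->
  lead_coef K = m%:R /\ exists K1, [/\ hilbert_kolchin_poly L K1, size K1 = 2%N & lead_coef K1 = m%:R].
Proof.
move=> idJ idL LJ KP K2 Jm Lw wn wn0 Lp pm.
have sL := left_ideal_subspace idL.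
have lK : lead_coef K = K`_1 by rewrite lead_coefE K2.
have slope : m%:R <= K`_1 by apply: (hilbert_slope_ge idJ KP); rewrite ?K2.
have mn : (m <= n)%N.
  rewrite leqNgt; apply/negP => nm; case/eqP: wn0.
  by rewrite (Jm w) ?opcoef0 //; [exact: LJ|move=> i j mi; apply: wn; lia].
pose w' := (opcoef w n 0)^-1 *: w.
have [C CP] : exists C, forall z k, quotient_dim L z k -> (k <= m * z + C)%N.
  apply: (@quotient_dim_upper _ L idL w' n p m) => //.
  - by have [_ _ LZ] := sL; exact: LZ.
  - exact: order_leZ.
  - by rewrite opcoefZ mulVf.
have [z0 KE] := KP.
have [h1 h1P] := choice (fun z => quotient_dim_exists z idL).
have [r rP] := choice (fun z => relative_dim_exists z idJ idL).
have hE z : (z0 <= z)%N -> (h1 z)%:R = K`_1 * z%:R + K`_0 + (r z)%:R.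
  move=> zz; have [h hP Kh] := KE z zz; rewrite -horner_size2 ?K2 // Kh -natrD.
  by rewrite -(relative_dim_quotient idJ idL LJ hP (rP z) (h1P z)).
have ub z : (h1 z)%:R <= m%:R * z%:R + C%:R :> rat.
  by rewrite -natrM -natrD ler_nat; exact: CP.
have K1m : K`_1 = m%:R.
  apply/le_anti; rewrite slope andbT -subr_ge0.
  apply: (@eventually_ge0_slope _ (C%:R - K`_0) z0) => z zz.
  have := ub z; rewrite hE //; have : 0 <= (r z)%:R :> rat by [].
  lra.
pose B := Num.bound `|K`_0|.
have rb z : (z0 <= z)%N -> (r z <= C + B)%N.
  move=> zz; rewrite -(ler_nat rat) natrD; have := ub z; rewrite hE // K1m.
  have := archi_boundP (normr_ge0 K`_0); have := ler_norm (- K`_0); rewrite normrN; lra.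
have [R [z1 RP]] : exists R z1, forall z, (z1 <= z)%N -> r z = R.
  apply: bounded_nondecreasing_stable rb => z _.
  exact: relative_dim_le idL (leqnSn z) (rP z) (rP z.+1).
have sK1 : size (K + R%:R%:P) = 2%N.
  by rewrite size_polyDl ?K2 // ltnS; exact: size_polyC_leq1.
split; first by rewrite lK.
exists (K + R%:R%:P); split=> //; last first.
  by rewrite lead_coefE sK1 coefD coefC addr0.
exists (maxn z0 z1) => z; rewrite geq_max => /andP[zz0 zz1]; exists (h1 z) => //.
by rewrite hornerD hornerC horner_size2 ?K2 // hE // RP.
Qed.

(** Common solutions solve [I], the sum of the ideals, so all least degrees agree. Then [p1] is
    minimal for [I] too, and the operator a p2 = u p1 lies in both ideals and still has d_x-degree
    [m]. *)
Lemma same_solutions_equivalent (char0 : [pchar F] =i pred0) (univF : kolchin_universal F)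
    J J0 w n : left_ideal J -> left_ideal J0 -> nonholonomic J -> nonholonomic J0 ->
    (forall G H, fd_series_solution G J H <-> fd_series_solution G J0 H) ->
    J w -> J0 w -> order_le w n -> opcoef w n 0 != 0 ->
  equivalent_ideals J J0.
Proof.
move=> idJ idJ0 nhJ nhJ0 sol Jw J0w wn wn0.
pose I p := exists q r, [/\ J q, J0 r & p = q + r].
have idI : left_ideal I by exact: left_idealD.
have idL := left_idealI idJ idJ0.
have JI p : J p -> I p by move=> Jp; exists p, 0; rewrite addr0; split=> //; case: idJ0.
have J0I p : J0 p -> I p by move=> Jp; exists 0, p; rewrite add0r; split=> //; case: idJ.
have solI G H : fd_series_solution G J H -> fd_series_solution G I H.
  move=> solJ; have [HG HJ] := solJ; have [_ HJ0] := (sol G H).1 solJ.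
  split=> // _ [q [r [Jq Jr ->]]]; apply/funext => s.
  by rewrite fd_actD HJ // HJ0 // addr0.
have w0 : w != 0 by apply: contraNneq wn0 => ->; rewrite opcoef0.
have [p1 [m min1]] := min_xdeg_exists Jw w0.
have [p2 [m2 min2]] := min_xdeg_exists J0w w0.
have [p3 [m3 min3]] := min_xdeg_exists (JI _ Jw) w0.
have e1 := min_xdeg_eq char0 univF idJ idI JI solI Jw wn wn0 min1 min3.
have e2 := min_xdeg_eq char0 univF idJ0 idI J0I (fun G H h => solI G H ((sol G H).2 h)) J0w wn wn0 min2 min3.
subst m m2; move: m3 => m in min1 min2 min3.
have [Jp1 p1m Jm] := min1; have [J0p2 p2m J0m] := min2.
have minI : min_xdeg I p1 m by have [_ _ Im] := min3; split=> //; exact: JI.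
have [a [u [a0 a1 E]]] := min_xdeg_divides idI minI (J0I _ J0p2).
pose p := a * p2.
have Lp : J p /\ J0 p.
  have [_ _ JM] := idJ; have [_ _ J0M] := idJ0.
  by split; [rewrite /p E; exact: JM|exact: J0M].
have pm : xdeg p m by exact: (xdegM (dy_operator_xdeg a0 a1) p2m).
have [K KP K2] := nhJ; have [K0 K0P K02] := nhJ0.
have [lK [K1 [K1P K12 lK1]]] := hilbert_kolchin_sub idJ idL (fun p => @proj1 _ _) KP K2 Jm
  (conj Jw J0w) wn wn0 Lp pm.
have [lK0 _] := hilbert_kolchin_sub idJ0 idL (fun p => @proj2 _ _) K0P K02 J0m
  (conj Jw J0w) wn wn0 Lp pm.
by exists K, K0, K1; split=> //; split; rewrite ?lK ?lK0 ?lK1.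
Qed.

End Intersection.

(** * From equivalence to equal solutions *)

Section Equivalent.
Variable F : diffFieldType.
Implicit Types (p q r w : diffop F) (J L : diffop F -> Prop).

(** The B + 1 elements have bounded order, so they lie in a space of dimension at most [B] modulo
    [L]. *)
Lemma relative_dim_relation J L z0 B (e : nat -> diffop F) : left_ideal J -> left_ideal L ->
    (forall z k, (z0 <= z)%N -> relative_dim J L z k -> (k <= B)%N) -> (forall i, J (e i)) ->
  exists2 c : nat -> F, exists2 i, (i < B.+1)%N & c i != 0 & L (\sum_(i < B.+1) c i *: e i).
Proof.
move=> idJ idL bnd Je; apply: contrapT => no.
have [n en] : exists n, forall i : 'I_B.+1, order_le (e i) n.
  have [n nP] := choice (fun i => order_le_exists (e i)).
  exists (\max_(i < B.+1) n i)%N => i; apply: order_leW (nP i).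
  exact: (leq_bigmax (F := fun i : 'I_B.+1 => n i)).
pose z := maxn n z0; have [k kz] := relative_dim_exists z idJ idL.
have kB := bnd _ _ (leq_maxr n z0) kz; have [g [_ _ sp]] := kz.
suff : (#|'I_B.+1| <= #|'I_k|)%N by rewrite !card_ord ltnNge kB.
apply: (independent_le_spanning (left_ideal_subspace idL) (e := fun i : 'I_B.+1 => e i) _ _ sp).
- by move=> i; split=> //; apply: order_leW (en i); rewrite leq_maxl.
- move=> c Lc i; apply/eqP/negPn/negP => ci; apply: no.
  exists (fun i => if insub i is Some j then c j else 0); first by exists i; rewrite ?valK ?ltn_ord.
  by under eq_bigr => j _ do rewrite valK.
Qed.

(** For [p] in [J], a nontrivial combination of the d^i p lies in [L] and kills [H]. With [d] chosen
    so that d f_1 is nonzero, leading exponents force p H = 0. *)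
Lemma relative_dim_bounded_solution J L z0 B (G : fd_symbol F) H : left_ideal J -> left_ideal L ->
    (forall z k, (z0 <= z)%N -> relative_dim J L z k -> (k <= B)%N) ->
  fd_series_solution G L H -> fd_series_solution G J H.
Proof.
move=> idJ idL bnd [HG LH]; split=> // p Jp; apply: contrapT => nz.
have [_ _ JM] := idJ.
have rel (d : diffop F) : exists2 c : nat -> F, exists2 i, (i < B.+1)%N & c i != 0 &
    fd_act G (\sum_(i < B.+1) c i *: d ^+ i) (fd_act G p H) = 0.
  have [c cn0 Lc] := relative_dim_relation idJ idL bnd (fun i => JM (d ^+ i) p Jp).
  exists c => //; rewrite -fd_act_mul; apply: LH; move: Lc; rewrite mulr_suml.
  by under eq_bigr => i _ do rewrite scalerAl.
have := @fd_head_nonconst _ G; case: (eqVneq (dx (fd_head G)) 0) => [->|dx0 _].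
  case: (eqVneq (dy (fd_head G)) 0) => [-> //|dy0 _].
  by have [c cn0] := rel (opdy F); apply: sum_dy_act_neq0.
by have [c cn0] := rel (opdx F); apply: sum_dx_act_neq0.
Qed.

(** The relative dimension is eventually K1 - K, a constant since the slopes agree. *)
Lemma hilbert_kolchin_relative_bound J L K K1 : left_ideal J -> left_ideal L -> (forall p, L p -> J p) ->
    hilbert_kolchin_poly J K -> hilbert_kolchin_poly L K1 -> size K = 2%N -> size K1 = 2%N ->
    lead_coef K = lead_coef K1 ->
  exists z0 B, forall z k, (z0 <= z)%N -> relative_dim J L z k -> (k <= B)%N.
Proof.
move=> idJ idL LJ [z0 KP] [z1 K1P] K2 K12; rewrite !lead_coefE K2 K12 /= => lead.
pose B := Num.bound `|K1`_0 - K`_0|; exists (maxn z0 z1), B => z k; rewrite geq_max => /andP[zz0 zz1] kz.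
have [h hP Kh] := KP z zz0; have [h' h'P Kh'] := K1P z zz1.
have E := relative_dim_quotient idJ idL LJ hP kz h'P.
move: Kh'; rewrite E natrD -Kh !horner_size2 ?K2 ?K12 // lead -addrA => /addrI E'.
rewrite -(ler_nat rat); have := archi_boundP (normr_ge0 (K1`_0 - K`_0)); rewrite -/B.
have := ler_norm (K1`_0 - K`_0); lra.
Qed.

Lemma equivalent_same_solutions J J0 (G : fd_symbol F) H : left_ideal J -> left_ideal J0 ->
  equivalent_ideals J J0 -> fd_series_solution G J H <-> fd_series_solution G J0 H.
Proof.
move=> idJ idJ0 [K [K0 [K1 [KP K0P K1P [K2 K02 K12] [lK lK0]]]]].
have idL := left_idealI idJ idJ0.
have [z [B bJ]] := hilbert_kolchin_relative_bound idJ idL (fun p => @proj1 _ _) KP K1P K2 K12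
  (etrans lK lK0).
have [z' [B' bJ0]] := hilbert_kolchin_relative_bound idJ0 idL (fun p => @proj2 _ _) K0P K1P K02 K12 lK0.
split=> [[HG JH]|[HG J0H]].
  apply: (relative_dim_bounded_solution idJ0 idL bJ0).
  by split=> // p [Jp _]; exact: JH.
apply: (relative_dim_bounded_solution idJ idL bJ).
by split=> // p [_ J0p]; exact: J0H.
Qed.

End Equivalent.

Theorem proposition5p2 (F : diffFieldType)
    (char0 : [pchar F] =i pred0) (univF : kolchin_universal F)
    (J J0 : diffop F -> Prop)
    (idealJ : left_ideal J) (idealJ0 : left_ideal J0)
    (nonholJ : nonholonomic J) (nonholJ0 : nonholonomic J0) :
  equivalent_ideals J J0 <->
  (forall (G : fd_symbol F) (H : rat -> F^o),
     fd_series_solution G J H <-> fd_series_solution G J0 H).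
Proof.
split=> [eqv G H|sol]; first exact: equivalent_same_solutions.
have [p Jp p0] := nonholonomic_neq0 idealJ nonholJ.
have [q J0q q0] := nonholonomic_neq0 idealJ0 nonholJ0.
(* A common left multiple is a nonzero element of the intersection. *)
have [a [b [a0 b0 E]]] := ore_common p0 q0; pose w := a * p.
have Jw : J w by case: idealJ => _ _; apply.
have J0w : J0 w by rewrite /w E; case: idealJ0 => _ _; apply.
have w0 : w != 0 by exact: opmul_neq0.
(* The Hilbert-Kolchin polynomials are unchanged by the shear, and every symbol over the sheared
   field is one over [F], so the hypotheses carry over and the conclusion comes back. *)
have [m [n [wn wn0]]] := shear_noncharacteristic char0 w0.
have nh I : nonholonomic I -> nonholonomic (shear_ideal (m := m) I).
  by move=> [K KP K2]; exists K => //; apply/shear_hilbert_kolchin.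
have [K [K0 [K1 [KP K0P K1P sz lead]]]] : equivalent_ideals (shear_ideal (m := m) J) (shear_ideal (m := m) J0).
  have := @same_solutions_equivalent (shear F m) char0 (shear_universal univF) (shear_ideal (m := m) J) (shear_ideal (m := m) J0) (shear_op m w) n.
  apply=> //.
  - exact: shear_left_ideal.
  - exact: shear_left_ideal.
  - exact: nh.
  - exact: nh.
  - by move=> G H; rewrite !shear_solution.
  - by rewrite /shear_ideal shear_opK.
  - by rewrite /shear_ideal shear_opK.
exists K, K0, K1; split=> //.
- exact/(shear_hilbert_kolchin m).
- exact/(shear_hilbert_kolchin m).
- exact/(shear_hilbert_kolchin m).
Qed.
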